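(* Let $u$ be a bounded solution of $\mathcal{L}u=0$ in $(0,\infty)\times\mathbb{S}^1$. Then \[ u(r,t)=\sum_{\mathrm{Re}(\sigma_j^\pm)=0}a_j^\pm w_j^\pm(r,t),\qquad a_j^\pm\in\mathbb{R}, \] (a finite sum over the basic solutions whose exponents lie on $i\mathbb{R}$). In particular, if $\mathcal{L}$ has no spectral values in $i\mathbb{R}$, then $u\equiv0$.
   Context: Fix $a>0$, $b\in\mathbb{R}\setminus\{0\}$, $\lambda=a+ib$, $\nu\in[0,1)$, an integer $k\ge2$ and $c\in C^k(\mathbb{S}^1,\mathbb{C})$. On $(0,\infty)\times\mathbb{S}^1$ (coordinates $(r,t)$) let $\mathcal{L}u=\lambda u_t-iru_r+i\lambda\nu u-c(t)\bar u$. A basic solution of $\mathcal{L}$ is a nontrivial solution of $\mathcal{L}w=0$ on $(0,\infty)\times\mathbb{S}^1$ of the form $w=r^\sigma\phi(t)+\overline{r^\sigma\psi(t)}$, $\sigma\in\mathbb{C}$, $\phi,\psi$ $2\pi$-periodic, written with $|\phi|>|\psi|$ when $\sigma\notin\mathbb{R}$ and as $r^\sigma f$ when $\sigma\in\mathbb{R}$; $\sigma$ is its exponent (a spectral value of $\mathcal{L}$) and the winding number of $\phi$ (resp. $f$) is its winding number. For each $j\in\mathbb{Z}$, $w_j^\pm$ denote the two $\mathbb{R}$-independent basic solutions with winding number $j$, with exponents $\sigma_j^\pm$; these exhaust the spectral values. *)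

(* Defs.v *)
From Stdlib Require Import Reals List.
Open Scope R_scope.

Definition CC := (R * R)%type.
Definition Cre (z : CC) : R := fst z.
Definition Cim (z : CC) : R := snd z.
Definition C0 : CC := (0, 0).
Definition Ci : CC := (0, 1).
Definition RtoC (x : R) : CC := (x, 0).
Definition Cadd (z w : CC) : CC := (fst z + fst w, snd z + snd w).
Definition Cmul (z w : CC) : CC :=
  (fst z * fst w - snd z * snd w, fst z * snd w + snd z * fst w).
Definition Cconj (z : CC) : CC := (fst z, - snd z).
Definition Cnorm (z : CC) : R := sqrt (fst z * fst z + snd z * snd z).

(* r^sigma := exp(sigma * ln r) for r > 0 *)
Definition Cpow (r : R) (s : CC) : CC :=
  (exp (fst s * ln r) * cos (snd s * ln r),
   exp (fst s * ln r) * sin (snd s * ln r)).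

(* 2*pi-periodic functions: functions on S^1 = R / 2 pi Z *)
Definition periodic (f : R -> CC) : Prop := forall t, f (t + 2 * PI) = f t.

Definition Cderiv_at (f : R -> CC) (x : R) (d : CC) : Prop :=
  derivable_pt_lim (fun s => fst (f s)) x (fst d) /\
  derivable_pt_lim (fun s => snd (f s)) x (snd d).

Definition Ccontinuous (f : R -> CC) : Prop :=
  continuity (fun s => fst (f s)) /\ continuity (fun s => snd (f s)).

Fixpoint Ck (k : nat) (f : R -> CC) : Prop :=
  match k with
  | O => Ccontinuous f
  | S n => exists f' : R -> CC, (forall x, Cderiv_at f x (f' x)) /\ Ck n f'
  end.

(* Classical solution of L u = 0 on (0,oo) x S^1, where
   L u = lambda u_t - i r u_r + i lambda nu u - c(t) conj(u),
   lambda = a + i b.  u : r -> t -> CC, 2 pi periodic in t. *)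
Definition is_solution (a b nu : R) (c : R -> CC) (u : R -> R -> CC) : Prop :=
  (forall r t, 0 < r -> u r (t + 2 * PI) = u r t) /\
  exists ur ut : R -> R -> CC,
    forall r t, 0 < r ->
      Cderiv_at (fun s => u s t) r (ur r t) /\
      Cderiv_at (fun s => u r s) t (ut r t) /\
      Cadd (Cadd (Cmul (a, b) (ut r t))
                 (Cmul (0, - r) (ur r t)))
           (Cadd (Cmul (Cmul Ci (Cmul (a, b) (RtoC nu))) (u r t))
                 (Cmul (RtoC (-1)) (Cmul (c t) (Cconj (u r t))))) = C0.

Definition bounded_on_half_cyl (u : R -> R -> CC) : Prop :=
  exists M, forall r t, 0 < r -> Cnorm (u r t) <= M.

Definition basic_solution (a b nu : R) (c : R -> CC)
    (w : R -> R -> CC) (sigma : CC) : Prop :=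
  is_solution a b nu c w /\
  (exists r t, 0 < r /\ w r t <> C0) /\
  exists phi psi : R -> CC, periodic phi /\ periodic psi /\
    forall r t, 0 < r ->
      w r t = Cadd (Cmul (Cpow r sigma) (phi t))
                   (Cconj (Cmul (Cpow r sigma) (psi t))).

Definition spectral_value (a b nu : R) (c : R -> CC) (sigma : CC) : Prop :=
  exists w, basic_solution a b nu c w sigma.

Definition lin_comb (l : list ((R -> R -> CC) * CC * R)) (r t : R) : CC :=
  fold_right (fun x acc => Cadd (Cmul (RtoC (snd x)) (fst (fst x) r t)) acc) C0 l.

(* Main.v *)
(* In the variable [x = ln r] a bounded solution becomes a bounded function [v] on [R x S^1] with [v_x = - i lam
   v_t + lam nu v + e conj v], where [e = i c]. Its Fourier modes [V_n (x)] satisfy [V_n' = lam (n + nu) V_n +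
   H_n], where [H_n] is the convolution of the coefficients of [e] and of [conj v]. As [v] is only separately
   differentiable, this rests on a divergence theorem of Looman-Menchoff type: by Baire's theorem the difference
   quotients are uniformly bounded on a portion of the set of singular points, and there the one-dimensional
   estimate [|f b - f a - integral of f' over G| <= 3 N |[a, b] \ G|] applies to every row. For [N] large the
   energy [sum_(n > N) |V_n|^2 - sum_(n <= N) |V_n|^2] grows exponentially, up to a small error: the coupling is
   symmetric in the two indices, so it cancels between modes on opposite sides of [N]. As [V] is bounded the
   energy is nonpositive, and the same holds for the reflected system [V_(-n) (-x)]. Hence [v] vanishes as soon
   as finitely many [V_n (0)] do. The bounded solutions of the complexified system thus form a
   finite-dimensional space invariant under translations in [x]; on it [d/dx] is annihilated by a polynomial,
   and boundedness leaves only sums of eigenfunctions [exp (i tau x) phi], whose real sums are basic solutions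
   with exponent [i tau]. *)
Require Import Defs.
From HB Require structures.
From mathcomp Require all_boot all_order all_algebra all_classical all_reals all_analysis.
From mathcomp Require measurable_realfun ring complex Rstruct Rstruct_topology.
From Stdlib Require Import Reals Lra Lia ZArith List Permutation ClassicalEpsilon FunctionalExtensionality.
From Coquelicot Require Import Rcomplements Complex.
Open Scope R_scope.

(** * Bounded measurable functions *)

Module BoundedMeasurable.
Import HB.structures all_boot all_order all_algebra all_classical all_reals all_analysis.
Import measurable_realfun mathcomp.algebra_tactics.ring.
Set Implicit Arguments. Unset Strict Implicit. Unset Printing Implicit Defensive.
Import Order.TTheory GRing.Theory Num.Theory numFieldNormedType.Exports.
Local Open Scope classical_set_scope.
Local Open Scope ring_scope.

Section BoundedMeasurableFunctions.
Context (R : realType) d (T : measurableType d).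
Implicit Types f g : T -> R.

Definition bounded_measurable f : Prop :=
  measurable_fun setT f /\ exists M : R, forall x, `|f x| <= M.

Lemma bounded_measurable_cst c : bounded_measurable (fun=> c).
Proof. by split; [exact: measurable_cst|exists `|c|]. Qed.

Lemma bounded_measurableD f g :
  bounded_measurable f -> bounded_measurable g -> bounded_measurable (fun x => f x + g x).
Proof.
move=> [mf [M fM]] [mg [N gN]]; split; first exact: measurable_funD.
by exists (M + N) => x; apply: le_trans (ler_normD _ _) _; exact: lerD.
Qed.

Lemma bounded_measurableM f g :
  bounded_measurable f -> bounded_measurable g -> bounded_measurable (fun x => f x * g x).
Proof.
move=> [mf [M fM]] [mg [N gN]]; split; first exact: measurable_funM.
by exists (M * N) => x; rewrite normrM ler_pM.
Qed.

Lemma bounded_measurable_cvg (h : nat -> T -> R) f (M : R) :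
  (forall n, bounded_measurable (h n)) -> (forall x, h ^~ x @ \oo --> f x) ->
  (forall x, `|f x| <= M) -> bounded_measurable f.
Proof.
move=> bh hf fM; split; last by exists M.
by apply: (measurable_fun_cvg (h := h)) => // n; exact: (bh n).1.
Qed.

Lemma bounded_measurable_indic (A : set T) : measurable A -> bounded_measurable \1_A.
Proof.
move=> mA; split; first exact: measurable_indic.
by exists 1 => x; rewrite indicE; case: (_ \in _); rewrite ?normr1 ?normr0.
Qed.

Lemma bounded_measurable_integrable (mu : {measure set T -> \bar R}) (A : set T) f :
  measurable A -> (mu A < +oo)%E -> bounded_measurable f -> mu.-integrable A (EFin \o f).
Proof.
move=> mA muA [mf [M fM]]; apply: measurable_bounded_integrable => //.
- exact: measurable_funTS.
- exists M; split; first exact: num_real.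
  by move=> x Mx y _; exact: le_trans (fM y) (ltW Mx).
Qed.
End BoundedMeasurableFunctions.

Lemma bounded_measurable_comp (R : realType) d1 d2 (T1 : measurableType d1) (T2 : measurableType d2)
    (f : T2 -> R) (h : T1 -> T2) :
  bounded_measurable f -> measurable_fun setT h -> bounded_measurable (f \o h).
Proof.
by move=> [mf [M fM]] mh; split; [exact: measurableT_comp|exists M => x; exact: fM].
Qed.

Section Line.
Variable R : realType.
Local Notation T1 := (measurableTypeR R).
Local Notation T2 := (T1 * T1)%type.
Local Notation mu := (@lebesgue_measure R).
Implicit Types (f g : T1 -> R) (k : R -> R -> R).

Lemma lebesgue_measure_itvcc_fin (a b : R) : (mu `[a, b] < +oo)%E.
Proof. by rewrite /= lebesgue_measure_itv/=; case: ifP => _; rewrite ?ltry. Qed.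

Lemma bounded_measurable_continuous f (M : R) :
  continuous (f : R -> R) -> (forall x, `|f x| <= M) -> bounded_measurable f.
Proof. by move=> cf fM; split; [exact: continuous_measurable_fun|exists M]. Qed.

Lemma measurable_shift (h : R) : measurable_fun setT ((fun x => x + h) : T1 -> T1).
Proof. by apply: measurable_funD => //; exact: measurable_cst. Qed.

Definition segment_integral (a b : R) (f : R -> R) : R := \int[mu]_(x in `[a, b]) f x.

Lemma bounded_measurable_segment a b f :
  bounded_measurable f -> mu.-integrable `[a, b] (EFin \o f).
Proof. by apply: bounded_measurable_integrable => //; exact: lebesgue_measure_itvcc_fin. Qed.

Lemma segment_integralD a b f g : bounded_measurable f -> bounded_measurable g ->
  segment_integral a b (fun x => f x + g x) = segment_integral a b f + segment_integral a b g.
Proof. by move=> bf bg; apply: RintegralD => //; exact: bounded_measurable_segment. Qed.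

Lemma segment_integralZl a b f c : bounded_measurable f ->
  segment_integral a b (fun x => c * f x) = c * segment_integral a b f.
Proof. by move=> bf; apply: RintegralZl => //; exact: bounded_measurable_segment. Qed.

Lemma le_segment_integral a b f g : bounded_measurable f -> bounded_measurable g ->
  (forall x, a <= x <= b -> f x <= g x) -> segment_integral a b f <= segment_integral a b g.
Proof. by move=> bf bg fg; apply: le_Rintegral => //; exact: bounded_measurable_segment. Qed.

Lemma segment_integral_cst a b c : a <= b -> segment_integral a b (fun=> c) = c * (b - a).
Proof.
move=> ab; rewrite /segment_integral Rintegral_cst//= lebesgue_measure_itv/= lte_fin.
by move: ab; rewrite le_eqVlt => /predU1P[->|->//]; rewrite ltxx subrr.
Qed.

Lemma segment_integral_cat a b c f : bounded_measurable f -> a <= b -> b <= c ->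
  segment_integral a c f = segment_integral a b f + segment_integral b c f.
Proof.
move=> bf ab bc; apply/eqP; rewrite addrC -subr_eq; apply/eqP.
rewrite /segment_integral Rintegral_itvB ?bnd_simp//; last exact: bounded_measurable_segment.
rewrite Rintegral_itv_obnd_cbnd//.
apply: integrableS (bounded_measurable_segment b c bf) => //.
by apply: subset_itvr; rewrite bnd_simp.
Qed.

Lemma cvg_segment_integral (a b : R) (h : nat -> T1 -> R) f (M : R) :
  (forall n, bounded_measurable (h n)) -> bounded_measurable f ->
  (forall n x, a <= x <= b -> `|h n x| <= M) ->
  (forall x, a <= x <= b -> h ^~ x @ \oo --> f x) ->
  (fun n => segment_integral a b (h n)) @ \oo --> segment_integral a b f.
Proof.
move=> bh bf hM hf.
have [] := @dominated_convergence _ _ _ mu `[a, b] _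
  (fun n => EFin \o h n) (EFin \o f) (cst M%:E) _ _ _ _ _ => //.
- by move=> n; apply/measurable_EFinP; apply: measurable_funTS; exact: (bh n).1.
- by apply/measurable_EFinP; apply: measurable_funTS; exact: bf.1.
- apply: aeW => x /=; rewrite in_itv/= => xab.
  by apply: cvg_EFin; [exact: nearW|exact: hf].
- exact: bounded_measurable_segment (bounded_measurable_cst _ M).
- by apply: aeW => x n /=; rewrite in_itv/= lee_fin; exact: hM.
move=> if1 _ hc; rewrite /segment_integral /Rintegral; apply: fine_cvg; rewrite fineK//.
exact: integrable_fin_num.
Qed.

Lemma lebesgue_measure_shift h (A : set R) : measurable A ->
  pushforward mu ((fun x => x + h) : T1 -> T1) A = mu A.
Proof.
move=> mA.
pose shift := HB.pack_for {mfun T1 >-> T1} ((fun x => x + h) : T1 -> T1)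
  (isMeasurableFun.Build _ _ _ _ _ (measurable_shift h)).
rewrite -[LHS]/(pushforward mu shift A).
apply/esym/lebesgue_measure_unique => //= _ [[a b]] _ <-; rewrite /pushforward.
have -> : (fun x => x + h) @^-1` `]a, b] = `]a - h, b - h]%classic.
  by apply/seteqP; split => x /=; rewrite !in_itv/= ltrBlDr lerBrDr.
rewrite !lebesgue_measure_itv/= !lte_fin ltrD2r; case: ifP => // _.
by congr (_%:E); ring.
Qed.

Lemma segment_integral_shift a b h f : bounded_measurable f ->
  segment_integral a b (fun x => f (x + h)) = segment_integral (a + h) (b + h) f.
Proof.
move=> bf; rewrite /segment_integral /Rintegral; congr fine.
have preE : (fun x => x + h) @^-1` `[a + h, b + h] = `[a, b]%classic.
  by apply/seteqP; split => x /=; rewrite !in_itv/= !lerD2r.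
have shift_integrable :
    mu.-integrable ((fun x => x + h) @^-1` `[a + h, b + h]) ((EFin \o f) \o (fun x => x + h)).
  rewrite preE; apply: (@bounded_measurable_segment a b (fun x => f (x + h))).
  exact: bounded_measurable_comp bf (measurable_shift h).
rewrite -preE -[LHS](@integral_pushforward _ _ _ _ _ _ (measurable_shift h) mu
  `[a + h, b + h] (EFin \o f))//.
- by apply: eq_measure_integral => [|? B mB _]; [exact: measurable_shift|exact: lebesgue_measure_shift].
- by apply/measurable_EFinP; exact: bf.1.
Qed.

Lemma EFin_segment_integral a b f : bounded_measurable f ->
  (segment_integral a b f)%:E = (\int[mu]_x (\1_(`[a, b]%classic) x * f x)%:E)%E.
Proof.
move=> bf; rewrite /segment_integral /Rintegral fineK; last first.
  by apply: integrable_fin_num => //; exact: bounded_measurable_segment.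
rewrite integral_mkcond; apply: eq_integral => x _.
by rewrite patchE indicE; case: ifPn => xab; rewrite ?mul1r ?mul0r.
Qed.

Lemma bounded_measurable_section2 k x :
  bounded_measurable (fun z : T2 => k z.1 z.2) -> bounded_measurable (k x : T1 -> R).
Proof. by move=> bk; exact: bounded_measurable_comp bk (pair1_measurable x). Qed.

Lemma bounded_measurable_section1 k y :
  bounded_measurable (fun z : T2 => k z.1 z.2) -> bounded_measurable ((k ^~ y) : T1 -> R).
Proof. by move=> bk; exact: bounded_measurable_comp bk (pair2_measurable y). Qed.

Lemma bounded_measurable_swap k : bounded_measurable (fun z : T2 => k z.1 z.2) ->
  bounded_measurable (fun z : T2 => k z.2 z.1).
Proof. by move=> bk; exact: bounded_measurable_comp bk (@measurable_swap _ _ _ _). Qed.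

Lemma bounded_measurable_shift k h : bounded_measurable (fun z : T2 => k z.1 z.2) ->
  bounded_measurable (fun z : T2 => k (z.1 + h) z.2).
Proof.
move=> bk; apply: (bounded_measurable_comp (h := fun z : T2 => (z.1 + h, z.2) : T2) bk).
apply: measurable_fun_pair; last exact: measurable_snd.
by apply: (measurableT_comp (measurable_shift h)); exact: measurable_fst.
Qed.

Lemma bounded_measurable_segment_integral c d k : bounded_measurable (fun z : T2 => k z.1 z.2) ->
  bounded_measurable ((fun x => segment_integral c d (k x)) : T1 -> R).
Proof.
move=> bk; have [_ [M kM]] := bk.
have [cd|dc] := leP c d; last first.
  rewrite (_ : (fun _ => _) = cst 0); first exact: bounded_measurable_cst.
  by apply/funext => x; rewrite /segment_integral set_itv_ge -?ltNge ?bnd_simp// Rintegral_set0.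
have kM' x y : - M <= k x y <= M by rewrite -ler_norml; exact: (kM (x, y)).
have bkM : bounded_measurable (fun z : T2 => k z.1 z.2 + M).
  by apply: bounded_measurableD => //; exact: bounded_measurable_cst.
split; last first.
  exists (M * (d - c)) => x; rewrite ler_norml -mulNr -!segment_integral_cst//.
  by apply/andP; split; apply: le_segment_integral => [| |y _];
    first [exact: bounded_measurable_cst|exact: bounded_measurable_section2|have /andP[] := kM' x y].
pose g (z : T2) := (\1_(`[c, d]%classic) z.2 * (k z.1 z.2 + M))%:E.
have mg : measurable_fun setT g.
  apply/measurable_EFinP; apply: (bounded_measurableM _ bkM).1.
  by apply: bounded_measurable_comp measurable_snd; exact: bounded_measurable_indic.
have g0 z : (0 <= g z)%E.
  by rewrite lee_fin mulr_ge0 ?indicE// -lerBlDr sub0r; have /andP[] := kM' z.1 z.2.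
have := @measurable_fun_fubini_tonelli_F _ _ _ _ _ mu g mg g0.
have -> : fubini_F mu g = fun x => (segment_integral c d (k x) + M * (d - c))%:E.
  apply/funext => x; rewrite /fubini_F -segment_integral_cst// -segment_integralD//.
  - rewrite EFin_segment_integral//.
    exact: bounded_measurableD (bounded_measurable_section2 x bk) (bounded_measurable_cst _ M).
  - exact: bounded_measurable_section2.
  - exact: bounded_measurable_cst.
move=> /measurable_EFinP mF.
rewrite (_ : (fun x => _) = (fun x => (segment_integral c d (k x) + M * (d - c)) - M * (d - c))).
  by apply: measurable_funB => //; exact: measurable_cst.
by apply/funext => x; rewrite addrK.
Qed.

Lemma segment_integral_Fubini a b c d k : bounded_measurable (fun z : T2 => k z.1 z.2) ->
  segment_integral a b (fun x => segment_integral c d (k x)) =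
  segment_integral c d (fun y => segment_integral a b (k ^~ y)).
Proof.
move=> bk.
pose Q := (`[a, b] `*` `[c, d])%classic : set T2.
pose g (z : T2) := \1_Q z * k z.1 z.2.
have mQ : measurable Q by exact: measurableX.
have ig : (mu \x mu)%E.-integrable setT (EFin \o g).
  rewrite (_ : EFin \o g = (EFin \o fun z : T2 => k z.1 z.2) \_ Q); last first.
    apply/funext => z; rewrite /= /g patchE indicE.
    by case: ifPn => _; rewrite ?mul1r ?mul0r.
  apply: (integrable_mkcond _ mQ).1; apply: bounded_measurable_integrable => //.
  rewrite [ltLHS](_ : _ = (mu `[a, b] * mu `[c, d])%E); last exact: product_measure1E.
  apply: lte_mul_pinfty => //; last exact: lebesgue_measure_itvcc_fin.
  by rewrite ge0_fin_numE//; exact: lebesgue_measure_itvcc_fin.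
have QE x y : \1_Q (x, y) = \1_(`[a, b]%classic) x * \1_(`[c, d]%classic) y :> R.
  by rewrite !indicE in_setX -natrM mulnb.
apply: EFin_inj; rewrite EFin_segment_integral; last exact: bounded_measurable_segment_integral.
rewrite EFin_segment_integral; last first.
  exact: (@bounded_measurable_segment_integral a b (fun y x => k x y) (bounded_measurable_swap bk)).
transitivity (\int[mu]_x \int[mu]_y (g (x, y))%:E)%E.
  apply: eq_integral => x _; have bx := bounded_measurable_section2 x bk.
  rewrite -segment_integralZl// EFin_segment_integral.
    by apply: eq_integral => y _; rewrite /g QE mulrCA mulrA.
  by apply: bounded_measurableM => //; exact: bounded_measurable_cst.
rewrite (Fubini ig); apply: eq_integral => y _.
have by_ := bounded_measurable_section1 y bk.
rewrite -segment_integralZl// EFin_segment_integral.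
  by apply: eq_integral => x _; rewrite /= /g QE -mulrA.
by apply: bounded_measurableM => //; exact: bounded_measurable_cst.
Qed.

Definition grid_floor (n : nat) (x : R) : R := (Num.floor (n.+1%:R * x))%:~R / n.+1%:R.

Lemma cvg_grid_floor x : grid_floor ^~ x @ \oo --> x.
Proof.
apply/cvgrPdist_le => e e0; near=> n.
have := ge_floor (n.+1%:R * x); have := lt_succ_floor (n.+1%:R * x).
rewrite /grid_floor; set j := (Num.floor _)%:~R; rewrite intrD -/j => ltj gej.
have gex : j / n.+1%:R <= x by rewrite ler_pdivrMr// mulrC.
have lex : x <= (j + 1) / n.+1%:R by rewrite ler_pdivlMr// mulrC ltW.
have small : n.+1%:R^-1 < e by near: n; exact: (near_infty_natSinv_lt (PosNum e0)).
by rewrite ger0_norm ?subr_ge0// lerBlDr (le_trans lex)// mulrDl mul1r addrC lerD2r ltW.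
Unshelve. all: by end_near. Qed.

(* [k] is the pointwise limit of its restrictions to the vertical lines at grid points. *)
Lemma bounded_measurable_separately_continuous k (M : R) :
  (forall y, continuous (k ^~ y)) -> (forall x, continuous (k x)) ->
  (forall x y, `|k x y| <= M) -> bounded_measurable (fun z : T2 => k z.1 z.2).
Proof.
move=> cx cy kM.
apply: (@bounded_measurable_cvg _ _ _ (fun n z => k (grid_floor n z.1) z.2) _ M) => //; last first.
  move=> [x y] /=; apply: (@cvg_comp _ _ _ (grid_floor ^~ x) (k ^~ y)); last exact: cx.
  exact: cvg_grid_floor.
move=> n; split; last by exists M.
move=> _ Y mY; rewrite setTI.
rewrite (_ : _ @^-1` _ = \bigcup_(j : int)
    ((fst @^-1` ((fun x => Num.floor (n.+1%:R * x)) @^-1` [set j])) `&`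
     (snd @^-1` (k (j%:~R / n.+1%:R) @^-1` Y)) : set T2)); last first.
  apply/seteqP; split => [[x y] /= kY|[x y] [j _ [/= <-]]//].
  by exists (Num.floor (n.+1%:R * x)).
apply: countable_bigcupT_measurable => // j.
apply: measurableI; rewrite -[X in measurable X]setTI.
  apply: measurable_fst => //.
  have -> : (fun x : R => Num.floor (n.+1%:R * x)) @^-1` [set j] =
      `[j%:~R / n.+1%:R, (j + 1)%:~R / n.+1%:R[%classic.
    apply/seteqP; split => x /=; rewrite in_itv/= ler_pdivrMr// ltr_pdivlMr// (mulrC x).
      by move=> <-; rewrite ge_floor lt_succ_floor.
    by move=> jx; apply/eqP; rewrite floor_eq.
  exact: measurable_itv.
apply: measurable_snd => //.
by rewrite -[X in measurable X]setTI; exact: continuous_measurable_fun.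
Qed.
End Line.
End BoundedMeasurable.
Module Integral.
Import all_boot all_order all_algebra all_classical all_reals all_analysis.
Import Rstruct Rstruct_topology BoundedMeasurable.
Import Order.TTheory GRing.Theory Num.Theory numFieldNormedType.Exports.

Definition Rreal : realType := R.

(* The integral is meaningful only for bounded measurable functions and [a <= b]. *)
Definition integral (a b : R) (f : R -> R) : R := @segment_integral Rreal a b f.
Definition bmeasurable (f : R -> R) : Prop :=
  @bounded_measurable Rreal _ (measurableTypeR Rreal) f.
Definition bmeasurable2 (f : R -> R -> R) : Prop :=
  @bounded_measurable Rreal _ (measurableTypeR Rreal * measurableTypeR Rreal)%type (fun z => f z.1 z.2).

Lemma Un_cvE (u : nat -> R) (l : R) : Un_cv u l <-> (u @ \oo --> (l : Rreal))%classic.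
Proof.
split.
- move=> h; apply/(@cvgrPdist_lt Rreal Rreal) => e /RltP e0.
  have [N hN] := h e e0; exists N => // n /= Nn.
  by rewrite distrC -RdistE; apply/RltP; apply: hN; exact/ssrnat.leP.
- move=> /(@cvgrPdist_lt Rreal Rreal) h e /RltP e0; have [N _ hN] := h e e0.
  by exists N => n Nn; apply/RltP; rewrite RdistE distrC; apply: hN => /=; exact/ssrnat.leP.
Qed.

Lemma Rabs_normr_le (x M : R) : Rabs x <= M <-> (`|x| <= M)%R.
Proof. by rewrite -RabsE; split=> /RleP. Qed.

Lemma integral_plus a b f g : bmeasurable f -> bmeasurable g ->
  integral a b (fun x => f x + g x) = integral a b f + integral a b g.
Proof. exact: segment_integralD. Qed.

Lemma integral_scal a b f c : bmeasurable f -> integral a b (fun x => c * f x) = c * integral a b f.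
Proof. exact: segment_integralZl. Qed.

Lemma integral_le a b f g : bmeasurable f -> bmeasurable g ->
  (forall x, a <= x <= b -> f x <= g x) -> integral a b f <= integral a b g.
Proof.
move=> bf bg fg; apply/RleP; apply: le_segment_integral => // x /andP[/RleP ? /RleP ?].
by apply/RleP; exact: fg.
Qed.

Lemma integral_const a b c : a <= b -> integral a b (fun _ => c) = c * (b - a).
Proof. by move=> /RleP ab; exact: segment_integral_cst. Qed.

Lemma integral_Chasles a b c f : bmeasurable f -> a <= b -> b <= c ->
  integral a c f = integral a b f + integral b c f.
Proof. by move=> bf /RleP ab /RleP bc; exact: segment_integral_cat. Qed.

Lemma integral_lim a b (h : nat -> R -> R) f M : (forall n, bmeasurable (h n)) -> bmeasurable f ->
  (forall n x, a <= x <= b -> Rabs (h n x) <= M) ->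
  (forall x, a <= x <= b -> Un_cv (fun n => h n x) (f x)) ->
  Un_cv (fun n => integral a b (h n)) (integral a b f).
Proof.
move=> bh bf hM hf; apply/Un_cvE; apply: (@cvg_segment_integral Rreal a b h f M) => //.
- by move=> n x /andP[/RleP ? /RleP ?]; apply/Rabs_normr_le; exact: hM.
- by move=> x /andP[/RleP ? /RleP ?]; apply/Un_cvE; exact: hf.
Qed.

Lemma integral_shift a b h f : bmeasurable f ->
  integral a b (fun x => f (x + h)) = integral (a + h) (b + h) f.
Proof. exact: segment_integral_shift. Qed.

Lemma integral_Fubini a b c d f : bmeasurable2 f ->
  integral a b (fun x => integral c d (fun y => f x y)) =
  integral c d (fun y => integral a b (fun x => f x y)).
Proof. exact: (@segment_integral_Fubini Rreal). Qed.

Lemma bmeasurable_const c : bmeasurable (fun _ => c).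
Proof. exact: bounded_measurable_cst. Qed.

Lemma bmeasurable_plus f g : bmeasurable f -> bmeasurable g -> bmeasurable (fun x => f x + g x).
Proof. exact: bounded_measurableD. Qed.

Lemma bmeasurable_mult f g : bmeasurable f -> bmeasurable g -> bmeasurable (fun x => f x * g x).
Proof. exact: bounded_measurableM. Qed.

Lemma bmeasurable_shift f h : bmeasurable f -> bmeasurable (fun x => f (x + h)).
Proof. by move=> bf; exact: (bounded_measurable_comp bf (measurable_shift h)). Qed.

Lemma bmeasurable_continuity f M : continuity f -> (forall x, Rabs (f x) <= M) -> bmeasurable f.
Proof.
move=> cf fM; apply: (@bounded_measurable_continuous Rreal f M).
- by move=> x; apply/continuity_ptE/cf.
- by move=> x; apply/Rabs_normr_le.
Qed.

Lemma bmeasurable2_const c : bmeasurable2 (fun _ _ => c).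
Proof. exact: bounded_measurable_cst. Qed.

Lemma bmeasurable2_plus f g : bmeasurable2 f -> bmeasurable2 g -> bmeasurable2 (fun x y => f x y + g x y).
Proof. exact: bounded_measurableD. Qed.

Lemma bmeasurable2_mult f g : bmeasurable2 f -> bmeasurable2 g -> bmeasurable2 (fun x y => f x y * g x y).
Proof. exact: bounded_measurableM. Qed.

Lemma bmeasurable2_lim (h : nat -> R -> R -> R) f M : (forall n, bmeasurable2 (h n)) ->
  (forall x y, Un_cv (fun n => h n x y) (f x y)) -> (forall x y, Rabs (f x y) <= M) -> bmeasurable2 f.
Proof.
move=> bh hf fM; apply: (@bounded_measurable_cvg Rreal _ (measurableTypeR Rreal * measurableTypeR Rreal)%type
  (fun n z => h n z.1 z.2) (fun z => f z.1 z.2) M) => //.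
- by move=> z; apply/Un_cvE.
- by move=> z; apply/Rabs_normr_le.
Qed.

Lemma bmeasurable2_separate_continuity f M : (forall y, continuity (fun x => f x y)) ->
  (forall x, continuity (f x)) -> (forall x y, Rabs (f x y) <= M) -> bmeasurable2 f.
Proof.
move=> cx cy fM; apply: (@bounded_measurable_separately_continuous Rreal f M).
- by move=> y x; apply/continuity_ptE/cx.
- by move=> x y; apply/continuity_ptE/cy.
- by move=> x y; apply/Rabs_normr_le.
Qed.

Lemma bmeasurable2_section1 f y : bmeasurable2 f -> bmeasurable (fun x => f x y).
Proof. exact: (@bounded_measurable_section1 Rreal). Qed.

Lemma bmeasurable2_section2 f x : bmeasurable2 f -> bmeasurable (f x).
Proof. exact: (@bounded_measurable_section2 Rreal). Qed.

Lemma bmeasurable2_swap f : bmeasurable2 f -> bmeasurable2 (fun x y => f y x).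
Proof. exact: (@bounded_measurable_swap Rreal). Qed.

Lemma bmeasurable2_shift f h : bmeasurable2 f -> bmeasurable2 (fun x y => f (x + h) y).
Proof. exact: (@bounded_measurable_shift Rreal). Qed.

Lemma bmeasurable2_integral2 f c d : bmeasurable2 f -> bmeasurable (fun x => integral c d (f x)).
Proof. exact: (@bounded_measurable_segment_integral Rreal). Qed.
End Integral.
#[global] Opaque Integral.integral Integral.bmeasurable Integral.bmeasurable2.
Import Integral ListNotations.

Lemma bmeasurable_opp f : bmeasurable f -> bmeasurable (fun x => - f x).
Proof.
intros bf. replace (fun x => - f x) with (fun x => -1 * f x) by (extensionality x; ring).
apply bmeasurable_mult; [apply bmeasurable_const|exact bf].
Qed.

Lemma bmeasurable_minus f g : bmeasurable f -> bmeasurable g -> bmeasurable (fun x => f x - g x).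
Proof. intros bf bg. apply bmeasurable_plus; [exact bf|apply bmeasurable_opp; exact bg]. Qed.

Ltac bmeas := repeat first
  [ assumption | apply bmeasurable_const | apply bmeasurable_opp | apply bmeasurable_minus
  | apply bmeasurable_plus | apply bmeasurable_mult ].

Lemma bmeasurable2_minus f g : bmeasurable2 f -> bmeasurable2 g -> bmeasurable2 (fun x y => f x y - g x y).
Proof.
intros bf bg. replace (fun x y => f x y - g x y) with (fun x y => f x y + -1 * g x y)
  by (extensionality x; extensionality y; ring).
apply bmeasurable2_plus; [exact bf|]. apply bmeasurable2_mult; [apply bmeasurable2_const|exact bg].
Qed.

Lemma bmeasurable2_integral1 f a b : bmeasurable2 f -> bmeasurable (fun y => integral a b (fun x => f x y)).
Proof. intros bf. apply (bmeasurable2_integral2 (fun y x => f x y)), bmeasurable2_swap, bf. Qed.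

Lemma integral_ext a b f g : (forall x, f x = g x) -> integral a b f = integral a b g.
Proof. intros e. f_equal. extensionality x. apply e. Qed.

Lemma integral_minus a b f g : bmeasurable f -> bmeasurable g ->
  integral a b (fun x => f x - g x) = integral a b f - integral a b g.
Proof.
intros bf bg. rewrite (integral_ext a b _ (fun x => f x + -1 * g x)) by (intros; ring).
rewrite integral_plus, integral_scal by bmeas. ring.
Qed.

Lemma integral_ge_0 a b f : bmeasurable f -> a <= b -> (forall x, a <= x <= b -> 0 <= f x) -> 0 <= integral a b f.
Proof.
intros bf ab f0. rewrite <- (Rmult_0_l (b - a)), <- (integral_const a b 0 ab).
apply integral_le; bmeas.
Qed.

Lemma integral_Rabs_le a b f g : bmeasurable f -> bmeasurable g ->
  (forall x, a <= x <= b -> Rabs (f x) <= g x) -> Rabs (integral a b f) <= integral a b g.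
Proof.
intros bf bg fg. apply Rabs_le. split.
- replace (- integral a b g) with (integral a b (fun x => -1 * g x)) by (rewrite integral_scal by exact bg; ring).
  apply integral_le; [bmeas|bmeas|]. intros x hx. apply fg, Rabs_le_between in hx. lra.
- apply integral_le; [bmeas|bmeas|]. intros x hx. apply fg, Rabs_le_between in hx. lra.
Qed.

Lemma integral_Rabs_le_const a b f K : bmeasurable f -> a <= b ->
  (forall x, a <= x <= b -> Rabs (f x) <= K) -> Rabs (integral a b f) <= K * (b - a).
Proof. intros bf ab fK. rewrite <- (integral_const a b K ab). apply integral_Rabs_le; bmeas. Qed.

Lemma integral_le_subsegment a b a' b' f : bmeasurable f -> (forall x, 0 <= f x) ->
  a <= a' -> a' <= b' -> b' <= b -> integral a' b' f <= integral a b f.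
Proof.
intros bf f0 aa ab bb. rewrite (integral_Chasles a a' b), (integral_Chasles a' b' b) by (assumption || lra).
pose proof (integral_ge_0 a a' f bf aa (fun x _ => f0 x)). pose proof (integral_ge_0 b' b f bf bb (fun x _ => f0 x)).
lra.
Qed.

Definition integral2 a b c d (f : R -> R -> R) : R := integral c d (fun y => integral a b (fun x => f x y)).

Lemma integral2_plus a b c d f g : bmeasurable2 f -> bmeasurable2 g ->
  integral2 a b c d (fun x y => f x y + g x y) = integral2 a b c d f + integral2 a b c d g.
Proof.
intros bf bg. unfold integral2. rewrite <- integral_plus by (apply bmeasurable2_integral1; assumption).
apply integral_ext. intros y. apply integral_plus; apply bmeasurable2_section1; assumption.
Qed.

Lemma integral2_scal a b c d f k : bmeasurable2 f ->
  integral2 a b c d (fun x y => k * f x y) = k * integral2 a b c d f.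
Proof.
intros bf. unfold integral2. rewrite <- integral_scal by (apply bmeasurable2_integral1; assumption).
apply integral_ext. intros y. apply integral_scal, bmeasurable2_section1, bf.
Qed.

Lemma integral2_minus a b c d f g : bmeasurable2 f -> bmeasurable2 g ->
  integral2 a b c d (fun x y => f x y - g x y) = integral2 a b c d f - integral2 a b c d g.
Proof.
intros bf bg. unfold integral2. rewrite <- integral_minus by (apply bmeasurable2_integral1; assumption).
apply integral_ext. intros y. apply integral_minus; apply bmeasurable2_section1; assumption.
Qed.

Lemma integral2_const a b c d k : a <= b -> c <= d -> integral2 a b c d (fun _ _ => k) = k * (b - a) * (d - c).
Proof.
intros ab cd. unfold integral2. rewrite (integral_ext c d _ (fun _ => k * (b - a))).
- apply integral_const, cd.
- intros y. apply integral_const, ab.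
Qed.

Lemma integral2_le a b c d f g : bmeasurable2 f -> bmeasurable2 g ->
  (forall x y, a <= x <= b -> c <= y <= d -> f x y <= g x y) -> integral2 a b c d f <= integral2 a b c d g.
Proof.
intros bf bg fg. apply integral_le; try (apply bmeasurable2_integral1; assumption). intros y hy.
apply integral_le; try (apply (bmeasurable2_section1 _ y); assumption). auto.
Qed.

Lemma integral2_ge_0 a b c d f : bmeasurable2 f -> a <= b -> c <= d ->
  (forall x y, a <= x <= b -> c <= y <= d -> 0 <= f x y) -> 0 <= integral2 a b c d f.
Proof.
intros bf ab cd f0. apply integral_ge_0; [apply bmeasurable2_integral1, bf|exact cd|]. intros y hy.
apply integral_ge_0; [apply (bmeasurable2_section1 f y), bf|exact ab|]. auto.
Qed.

Lemma integral2_Rabs_le a b c d f g : bmeasurable2 f -> bmeasurable2 g ->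
  (forall x y, a <= x <= b -> c <= y <= d -> Rabs (f x y) <= g x y) ->
  Rabs (integral2 a b c d f) <= integral2 a b c d g.
Proof.
intros bf bg fg. apply integral_Rabs_le; try (apply bmeasurable2_integral1; assumption). intros y hy.
apply integral_Rabs_le; try (apply (bmeasurable2_section1 _ y); assumption). auto.
Qed.

Lemma integral2_Chasles1 a m b c d f : bmeasurable2 f -> a <= m -> m <= b ->
  integral2 a b c d f = integral2 a m c d f + integral2 m b c d f.
Proof.
intros bf am mb. unfold integral2. rewrite <- integral_plus by (apply bmeasurable2_integral1; assumption).
apply integral_ext. intros y. apply integral_Chasles; [apply (bmeasurable2_section1 f y), bf|assumption|assumption].
Qed.

Lemma integral2_Chasles2 a b c m d f : bmeasurable2 f -> c <= m -> m <= d ->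
  integral2 a b c d f = integral2 a b c m f + integral2 a b m d f.
Proof. intros bf cm md. apply integral_Chasles; [apply bmeasurable2_integral1, bf|assumption|assumption]. Qed.

Lemma integral2_quarters a m b c s d f : bmeasurable2 f -> a <= m -> m <= b -> c <= s -> s <= d ->
  integral2 a b c d f = integral2 a m c s f + integral2 a m s d f + integral2 m b c s f + integral2 m b s d f.
Proof.
intros bf am mb cs sd. rewrite (integral2_Chasles1 a m b), (integral2_Chasles2 a m c s d) by assumption.
rewrite (integral2_Chasles2 m b c s d) by assumption. ring.
Qed.

Lemma integral2_swap a b c d f : bmeasurable2 f -> integral2 a b c d f = integral2 c d a b (fun y x => f x y).
Proof. intros bf. symmetry. apply integral_Fubini, bf. Qed.

Lemma integral2_le_subrectangle a b c d a' b' c' d' f : bmeasurable2 f -> (forall x y, 0 <= f x y) ->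
  a <= a' -> a' <= b' -> b' <= b -> c <= c' -> c' <= d' -> d' <= d ->
  integral2 a' b' c' d' f <= integral2 a b c d f.
Proof.
intros bf f0 ? ? ? ? ? ?. apply Rle_trans with (integral2 a b c' d' f).
- apply integral_le; try (apply bmeasurable2_integral1; assumption). intros y _.
  apply integral_le_subsegment; auto. apply (bmeasurable2_section1 f y), bf.
- apply integral_le_subsegment; auto; [apply bmeasurable2_integral1, bf|]. intros y.
  apply integral_ge_0; [apply (bmeasurable2_section1 f y), bf|lra|auto].
Qed.

Lemma integral2_lim a b c d (h : nat -> R -> R -> R) f M : a <= b -> (forall n, bmeasurable2 (h n)) ->
  bmeasurable2 f -> (forall n x y, Rabs (h n x y) <= M) ->
  (forall x y, Un_cv (fun n => h n x y) (f x y)) ->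
  Un_cv (fun n => integral2 a b c d (h n)) (integral2 a b c d f).
Proof.
intros ab bh bf hM hf.
apply (integral_lim c d (fun n y => integral a b (fun x => h n x y)) _ (M * (b - a))).
- intros n. apply bmeasurable2_integral1, bh.
- apply bmeasurable2_integral1, bf.
- intros n y _. apply integral_Rabs_le_const; auto. apply (bmeasurable2_section1 _ y), bh.
- intros y _. apply (integral_lim a b (fun n x => h n x y) _ M); auto.
  + intros n. apply (bmeasurable2_section1 _ y), bh.
  + apply (bmeasurable2_section1 _ y), bf.
Qed.

(** * Calculus of real functions *)

Lemma Un_cv_const c : Un_cv (fun _ => c) c.
Proof. intros eps e0. exists 0%nat. intros n _. rewrite Rdist_eq. exact e0. Qed.

Lemma Un_cv_scal c u l : Un_cv u l -> Un_cv (fun n => c * u n) (c * l).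
Proof. intros hu. apply CV_mult; [apply Un_cv_const|exact hu]. Qed.

Lemma Un_cv_eventually_const u c : (exists N, forall n, (N <= n)%nat -> u n = c) -> Un_cv u c.
Proof. intros [N hN] eps e0. exists N. intros n hn. rewrite (hN n hn), Rdist_eq. exact e0. Qed.

Lemma Un_cv_squeeze (u v : nat -> R) l : (forall n, Rabs (u n - l) <= v n) -> Un_cv v 0 -> Un_cv u l.
Proof.
intros uv hv eps e0. destruct (hv eps e0) as [N hN]. exists N. intros n hn. specialize (hN n hn).
unfold Rdist in *. rewrite Rminus_0_r in hN. pose proof (uv n). pose proof (Rle_abs (v n)). lra.
Qed.

Lemma derivable_pt_lim_continuity_pt f x l : derivable_pt_lim f x l -> continuity_pt f x.
Proof. intros df. apply derivable_continuous_pt. exists l. exact df. Qed.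

Lemma derivable_pt_lim_eq f x l l' : l = l' -> derivable_pt_lim f x l -> derivable_pt_lim f x l'.
Proof. intros ->. tauto. Qed.

Lemma derivable_pt_lim_seq f x l (h : nat -> R) : derivable_pt_lim f x l -> (forall n, h n <> 0) -> Un_cv h 0 ->
  Un_cv (fun n => (f (x + h n) - f x) / h n) l.
Proof.
intros df h0 ch eps e0. destruct (df eps e0) as [dl hdl].
destruct (ch dl (cond_pos dl)) as [N hN]. exists N. intros n hn. specialize (hN n hn).
unfold Rdist in *. rewrite Rminus_0_r in hN. apply hdl; [apply h0|exact hN].
Qed.

Lemma continuity_pt_delta f x eps : continuity_pt f x -> 0 < eps ->
  exists dl, 0 < dl /\ forall y, Rabs (y - x) < dl -> Rabs (f y - f x) < eps.
Proof.
intros cf e0. destruct (cf eps e0) as [dl [d0 hd]]. exists dl. split; [exact d0|]. intros y hy.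
destruct (Req_dec x y) as [->|ne]; [rewrite Rminus_diag, Rabs_R0; exact e0|].
apply hd. split; [split; [exact I|exact ne]|exact hy].
Qed.

Definition lipschitz N (f : R -> R) : Prop := forall x y, Rabs (f x - f y) <= N * Rabs (x - y).

Lemma lipschitz_continuity N f : lipschitz N f -> continuity f.
Proof.
intros lf x eps e0. exists (eps / (Rabs N + 1)). pose proof (Rabs_pos N).
split; [apply Rdiv_lt_0_compat; lra|]. intros y [_ hy]. simpl in *. unfold Rdist in *.
apply Rlt_div_r in hy; [|lra]. apply Rle_lt_trans with (1 := lf y x).
pose proof (Rle_abs N). pose proof (Rabs_pos (y - x)). nra.
Qed.

Lemma Rabs_diff_integral_le G x p q eps : bmeasurable G -> p <= q ->
  (forall z, p <= z <= q -> Rabs (G z - G x) <= eps) -> Rabs (integral p q G - G x * (q - p)) <= eps * (q - p).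
Proof.
intros bG pq hG. rewrite <- (integral_const p q (G x) pq), <- integral_minus by bmeas.
apply integral_Rabs_le_const; bmeas.
Qed.

Lemma derivable_pt_lim_of_integral F G : bmeasurable G -> continuity G ->
  (forall x y, x <= y -> F y - F x = integral x y G) -> forall x, derivable_pt_lim F x (G x).
Proof.
intros bG cG hF x eps e0. destruct (continuity_pt_delta G x (eps / 2) (cG x) ltac:(lra)) as [d [d0 hd]].
exists (mkposreal d d0). intros y y0 hy. simpl in hy. apply Rabs_def2 in hy.
assert (near : forall z, x + Rmin 0 y <= z <= x + Rmax 0 y -> Rabs (G z - G x) <= eps / 2).
{ intros z hz. left. apply hd. unfold Rmin, Rmax in hz. destruct (Rle_dec 0 y); apply Rabs_def1; lra. }
assert (diff : Rabs (F (x + y) - F x - G x * y) <= eps / 2 * Rabs y).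
{ destruct (Rle_lt_dec 0 y) as [h|h].
  - rewrite Rmin_left, Rmax_right in near by lra. rewrite (Rabs_right y), (hF x (x + y)) by lra.
    replace y with (x + y - x) at 2 3 by ring. apply Rabs_diff_integral_le; [exact bG|lra|].
    intros z hz. apply near. lra.
  - rewrite Rmin_right, Rmax_left in near by lra. rewrite (Rabs_left y) by lra.
    replace (F (x + y) - F x - G x * y) with (- (integral (x + y) x G - G x * (x - (x + y))))
      by (rewrite <- hF by lra; ring).
    rewrite Rabs_Ropp. replace (- y) with (x - (x + y)) by ring. apply Rabs_diff_integral_le; [exact bG|lra|].
    intros z hz. apply near. lra. }
replace ((F (x + y) - F x) / y - G x) with ((F (x + y) - F x - G x * y) / y) by (field; exact y0).
rewrite Rabs_div by exact y0. assert (0 < Rabs y) by (apply Rabs_pos_lt; exact y0).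
apply Rlt_div_l; [assumption|]. nra.
Qed.

Definition primitive G x : R := if Rle_dec 0 x then integral 0 x G else - integral x 0 G.

Lemma primitive_minus G x y : bmeasurable G -> x <= y -> primitive G y - primitive G x = integral x y G.
Proof.
intros bG xy. unfold primitive. destruct (Rle_dec 0 x), (Rle_dec 0 y); try lra.
- rewrite (integral_Chasles 0 x y) by (assumption || lra). ring.
- rewrite (integral_Chasles x 0 y) by (assumption || lra). ring.
- rewrite (integral_Chasles x y 0) by (assumption || lra). ring.
Qed.

Lemma derivable_pt_lim_primitive G : bmeasurable G -> continuity G ->
  forall x, derivable_pt_lim (primitive G) x (G x).
Proof. intros bG cG. apply derivable_pt_lim_of_integral; auto. intros x y. apply primitive_minus, bG. Qed.

Lemma derivable_pt_lim_0_const f : (forall x, derivable_pt_lim f x 0) -> forall x y, f x = f y.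
Proof.
intros df. assert (lt : forall x y, x < y -> f x = f y).
{ intros x y xy. destruct (MVT_cor2 f (fun _ => 0) x y xy) as [z [e _]]; [auto|lra]. }
intros x y. destruct (Rtotal_order x y) as [h|[->|h]]; [auto|reflexivity|symmetry; auto].
Qed.

Lemma integral_FTC f F a b : bmeasurable f -> continuity f -> a <= b ->
  (forall x, derivable_pt_lim F x (f x)) -> integral a b f = F b - F a.
Proof.
intros bf cf ab dF. rewrite <- (primitive_minus f a b bf ab).
assert (e : F b - primitive f b = F a - primitive f a); [|lra].
apply (derivable_pt_lim_0_const (fun x => F x - primitive f x)). intros x.
apply (derivable_pt_lim_eq _ _ (f x - f x)); [ring|].
apply derivable_pt_lim_minus; [apply dF|apply derivable_pt_lim_primitive; assumption].
Qed.

Lemma integral_difference_quotient f a b (h : nat -> R) : bmeasurable f -> continuity f -> a <= b ->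
  (forall n, 0 < h n) -> Un_cv h 0 ->
  Un_cv (fun n => integral a b (fun x => (f (x + h n) - f x) / h n)) (f b - f a).
Proof.
intros bf cf ab h0 ch. pose proof (derivable_pt_lim_primitive f bf cf) as dF.
assert (hn0 : forall n, h n <> 0) by (intros n; specialize (h0 n); lra).
apply (Un_cv_ext (fun n => (primitive f (b + h n) - primitive f b) / h n
                         - (primitive f (a + h n) - primitive f a) / h n)).
- intros n. specialize (h0 n). rewrite !primitive_minus by (assumption || lra).
  rewrite (integral_ext a b _ (fun x => / h n * (f (x + h n) - f x))) by (intros; unfold Rdiv; ring).
  pose proof (bmeasurable_shift f (h n) bf) as bfh.
  rewrite integral_scal, (integral_minus a b (fun x => f (x + h n))), integral_shift by bmeas.
  pose proof (integral_Chasles a b (b + h n) f bf ltac:(lra) ltac:(lra)).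
  pose proof (integral_Chasles a (a + h n) (b + h n) f bf ltac:(lra) ltac:(lra)).
  unfold Rdiv. rewrite <- Rmult_minus_distr_r, Rmult_comm. f_equal. lra.
- apply CV_minus; apply (derivable_pt_lim_seq (primitive f)); auto.
Qed.

(** * Lipschitz extensions and closed sets of the plane *)

Section LipschitzExtension.
Variables (X : Type) (dist : X -> X -> R).
Hypothesis dist_refl : forall x, dist x x = 0.
Hypothesis dist_sym : forall x y, dist x y = dist y x.
Hypothesis dist_triangle : forall x y z, dist x z <= dist x y + dist y z.
Variables (E : X -> Prop) (f : X -> R) (N M : R).
Hypothesis N_ge_0 : 0 <= N.
Hypothesis f_bounded : forall x, Rabs (f x) <= M.

Lemma dist_ge_0 x y : 0 <= dist x y.
Proof. pose proof (dist_triangle x y x) as h. rewrite dist_refl, (dist_sym y x) in h. lra. Qed.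

Definition under_cone x v : Prop := v = - M \/ exists y, E y /\ v = f y - N * dist x y.

Lemma under_cone_le x v : under_cone x v -> v <= M.
Proof.
intros [->|[y [_ ->]]].
- pose proof (f_bounded x). pose proof (Rabs_pos (f x)). lra.
- pose proof (f_bounded y) as h. apply Rabs_le_between in h. pose proof (dist_ge_0 x y). nra.
Qed.

Definition lipschitz_extension x : R :=
  proj1_sig (completeness (under_cone x) (ex_intro _ M (under_cone_le x)) (ex_intro _ (- M) (or_introl eq_refl))).

Lemma lipschitz_extension_ge x v : under_cone x v -> v <= lipschitz_extension x.
Proof. unfold lipschitz_extension. destruct completeness as [s hs]. apply hs. Qed.

Lemma lipschitz_extension_le x c : (forall v, under_cone x v -> v <= c) -> lipschitz_extension x <= c.
Proof. unfold lipschitz_extension. destruct completeness as [s hs]. apply hs. Qed.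

Lemma lipschitz_extension_bounded x : Rabs (lipschitz_extension x) <= M.
Proof.
apply Rabs_le. split; [apply lipschitz_extension_ge; left; reflexivity|].
apply lipschitz_extension_le. apply under_cone_le.
Qed.

Lemma lipschitz_extension_eq x : E x -> (forall y, E y -> f y - f x <= N * dist x y) ->
  lipschitz_extension x = f x.
Proof.
intros Ex lf. apply Rle_antisym.
- apply lipschitz_extension_le. intros v [->|[y [Ey ->]]].
  + pose proof (f_bounded x) as h. apply Rabs_le_between in h. lra.
  + specialize (lf y Ey). lra.
- apply lipschitz_extension_ge. right. exists x. rewrite dist_refl. split; [exact Ex|ring].
Qed.

Lemma lipschitz_extension_lipschitz x y :
  Rabs (lipschitz_extension x - lipschitz_extension y) <= N * dist x y.
Proof.
assert (one_sided : forall x y, lipschitz_extension x <= lipschitz_extension y + N * dist x y).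
{ intros x' y'. apply lipschitz_extension_le. intros v [->|[z [Ez ->]]].
  - pose proof (lipschitz_extension_ge y' (- M) (or_introl eq_refl)). pose proof (dist_ge_0 x' y'). nra.
  - pose proof (lipschitz_extension_ge y' _ (or_intror (ex_intro _ z (conj Ez eq_refl)))).
    pose proof (dist_triangle y' x' z) as h. rewrite (dist_sym y' x') in h. nra. }
apply Rabs_le. pose proof (one_sided x y). pose proof (one_sided y x) as h. rewrite (dist_sym y x) in h. lra.
Qed.
End LipschitzExtension.

Definition closed1 (G : R -> Prop) : Prop :=
  forall x, ~ G x -> exists rho, 0 < rho /\ forall y, Rabs (y - x) <= rho -> ~ G y.

Definition closed2 (F : R -> R -> Prop) : Prop :=
  forall x t, ~ F x t -> exists rho, 0 < rho /\
    forall y s, Rabs (y - x) <= rho -> Rabs (s - t) <= rho -> ~ F y s.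

Definition transpose {T : Type} (F : R -> R -> T) : R -> R -> T := fun x t => F t x.

Lemma closed2_transpose F : closed2 F -> closed2 (transpose F).
Proof.
intros cF x t nF. destruct (cF t x nF) as [r [r0 h]]. exists r. split; [exact r0|].
intros y s hy hs. apply h; assumption.
Qed.

Lemma closed2_and F G : closed2 F -> closed2 G -> closed2 (fun x t => F x t /\ G x t).
Proof.
intros cF cG x t n. destruct (classic (F x t)) as [h|h].
- destruct (cG x t (fun g => n (conj h g))) as [r [r0 hr]]. exists r. split; [exact r0|].
  intros y s hy hs [_ g]. exact (hr y s hy hs g).
- destruct (cF x t h) as [r [r0 hr]]. exists r. split; [exact r0|].
  intros y s hy hs [g _]. exact (hr y s hy hs g).
Qed.

Lemma closed2_square xc tc rho : closed2 (fun x t => Rabs (x - xc) <= rho /\ Rabs (t - tc) <= rho).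
Proof.
assert (away : forall u c, ~ Rabs (u - c) <= rho ->
  exists r, 0 < r /\ forall v, Rabs (v - u) <= r -> ~ Rabs (v - c) <= rho).
{ intros u c h. exists ((Rabs (u - c) - rho) / 2). split; [lra|]. intros v hv g.
  pose proof (Rabs_triang (u - v) (v - c)) as tr. replace (u - v + (v - c)) with (u - c) in tr by ring.
  rewrite (Rabs_minus_sym u v) in tr. lra. }
intros x t n. destruct (Rle_dec (Rabs (x - xc)) rho) as [h|h].
- destruct (away t tc (fun g => n (conj h g))) as [r [r0 hr]]. exists r. split; [exact r0|].
  intros y s _ hs [_ g]. exact (hr s hs g).
- destruct (away x xc h) as [r [r0 hr]]. exists r. split; [exact r0|].
  intros y s hy _ [g _]. exact (hr y hy g).
Qed.

Lemma closed2_of_sequences F :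
  (forall (x t : nat -> R) x0 t0, (forall n, F (x n) (t n)) -> Un_cv x x0 -> Un_cv t t0 -> F x0 t0) -> closed2 F.
Proof.
intros seqF x0 t0 nF. apply NNPP. intros n.
assert (near : forall k, exists z, F (fst z) (snd z) /\ Rabs (fst z - x0) <= RinvN k /\ Rabs (snd z - t0) <= RinvN k).
{ intros k. apply NNPP. intros m. apply n. exists (RinvN k). split; [apply cond_pos|].
  intros y s hy hs g. apply m. exists (y, s). auto. }
destruct (boolp.choice near) as [z hz].
apply nF, (seqF (fun k => fst (z k)) (fun k => snd (z k))); [apply hz| |];
  apply (Un_cv_squeeze _ RinvN); try apply RinvN_cv; apply hz.
Qed.

(* Cousin's lemma: bisection in its supremum form. *)
Lemma segment_induction (Phi : R -> R -> Prop) a b : a <= b ->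
  (forall p m q, a <= p -> p <= m -> m <= q -> q <= b -> Phi p m -> Phi m q -> Phi p q) ->
  (forall x, a <= x <= b -> exists rho, 0 < rho /\
     forall p q, a <= p -> x - rho <= p -> p <= x -> x <= q -> q <= x + rho -> q <= b -> Phi p q) ->
  Phi a b.
Proof.
intros ab glue local.
set (E := fun y => a <= y <= b /\ Phi a y).
assert (Ea : E a) by (split; [lra|]; destruct (local a ltac:(lra)) as [rho [r0 h]]; apply h; lra).
destruct (completeness E) as [s [ub lub]].
{ exists b. intros y [hy _]. lra. }
{ exists a. exact Ea. }
assert (as_ : a <= s) by (apply ub; exact Ea).
assert (sb : s <= b) by (apply lub; intros y [hy _]; lra).
destruct (local s ltac:(lra)) as [rho [r0 h]].
assert (exists y, E y /\ s - rho < y) as [y [[hy Phi_ay] sy]].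
{ apply NNPP. intros n. assert (s <= s - rho); [|lra]. apply lub. intros y Ey.
  destruct (Rle_lt_dec y (s - rho)); [assumption|]. exfalso. apply n. exists y. auto. }
assert (ys : y <= s) by (apply ub; split; assumption).
set (q := Rmin b (s + rho)).
assert (sq : s <= q) by (apply Rmin_glb; lra).
assert (qb : q <= b) by apply Rmin_l. assert (qr : q <= s + rho) by apply Rmin_r.
assert (Eq : E q) by (split; [lra|]; apply (glue a y q); try lra; [assumption|apply h; lra]).
assert (q <= s) by (apply ub; exact Eq).
replace b with q; [apply Eq|]. unfold q, Rmin in *. destruct (Rle_dec b (s + rho)); lra.
Qed.

Lemma closed2_tube F x c d : closed2 F -> c <= d -> (forall t, c <= t <= d -> ~ F x t) ->
  exists rho, 0 < rho /\ forall y t, Rabs (y - x) <= rho -> c <= t <= d -> ~ F y t.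
Proof.
intros cF cd free.
apply (segment_induction (fun c d => exists rho, 0 < rho /\
  forall y t, Rabs (y - x) <= rho -> c <= t <= d -> ~ F y t)); [assumption| |].
- intros p m q _ _ _ _ [rm [rm_gt_0 below]] [rq [rq_gt_0 above]]. exists (Rmin rm rq).
  split; [apply Rmin_pos; assumption|]. intros y t hy ht.
  pose proof (Rmin_l rm rq). pose proof (Rmin_r rm rq).
  destruct (Rle_dec t m); [apply below|apply above]; lra.
- intros t ht. destruct (cF x t (free t ht)) as [rho [r0 h]]. exists rho. split; [assumption|].
  intros p q ? ? ? ? ? ?. exists rho. split; [assumption|]. intros y s hy hs. apply h; [assumption|].
  apply Rabs_le. lra.
Qed.

Definition projection (F : R -> R -> Prop) c d x : Prop := exists t, c <= t <= d /\ F x t.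

Lemma closed1_projection F c d : closed2 F -> c <= d -> closed1 (projection F c d).
Proof.
intros cF cd x n. destruct (closed2_tube F x c d cF cd) as [rho [r0 h]].
{ intros t ht g. apply n. exists t. auto. }
exists rho. split; [assumption|]. intros y hy [t [ht g]]. exact (h y t hy ht g).
Qed.

Lemma closed1_max G a b : closed1 G -> (exists x, a <= x <= b /\ G x) ->
  exists m, a <= m <= b /\ G m /\ forall x, a <= x <= b -> G x -> x <= m.
Proof.
intros cG [x0 [hx0 G0]].
destruct (completeness (fun x => a <= x <= b /\ G x)) as [s [ub lub]].
{ exists b. intros x [hx _]. lra. }
{ exists x0. auto. }
assert (x0 <= s) by (apply ub; auto). assert (s <= b) by (apply lub; intros x [hx _]; lra).
exists s. split; [lra|]. split; [|intros x hx Gx; apply ub; auto].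
apply NNPP. intros n. destruct (cG s n) as [rho [r0 h]].
assert (s <= s - rho); [|lra]. apply lub. intros x [hx Gx].
destruct (Rle_lt_dec x (s - rho)); [assumption|]. exfalso. apply (h x); [|exact Gx].
assert (x <= s) by (apply ub; auto). apply Rabs_le. lra.
Qed.

Lemma closed1_min G a b : closed1 G -> (exists x, a <= x <= b /\ G x) ->
  exists m, a <= m <= b /\ G m /\ forall x, a <= x <= b -> G x -> m <= x.
Proof.
intros cG [x0 [hx0 G0]].
destruct (closed1_max (fun x => G (- x)) (- b) (- a)) as [m [hm [Gm max]]].
- intros x n. destruct (cG (- x) n) as [rho [r0 h]]. exists rho. split; [assumption|]. intros y hy. apply h.
  replace (- y - - x) with (- (y - x)) by ring. rewrite Rabs_Ropp. exact hy.
- exists (- x0). rewrite Ropp_involutive. split; [lra|assumption].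
- exists (- m). split; [lra|]. split; [assumption|]. intros x hx Gx.
  assert (- x <= m); [|lra]. apply max; [lra|]. rewrite Ropp_involutive. exact Gx.
Qed.

Lemma closed2_bounding_rectangle F a b c d : closed2 F -> a <= b -> c <= d ->
  (exists x t, a <= x <= b /\ c <= t <= d /\ F x t) ->
  exists a' b' c' d', (a <= a' /\ a' <= b' /\ b' <= b) /\ (c <= c' /\ c' <= d' /\ d' <= d) /\
    (projection F c d a' /\ projection F c d b' /\
     projection (transpose F) a b c' /\ projection (transpose F) a b d') /\
    forall x t, a <= x <= b -> c <= t <= d -> F x t -> a' <= x <= b' /\ c' <= t <= d'.
Proof.
intros cF ab cd [x0 [t0 [hx0 [ht0 F0]]]].
pose proof (closed1_projection F c d cF cd) as cX.
pose proof (closed1_projection (transpose F) a b (closed2_transpose F cF) ab) as cT.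
assert (neX : exists x, a <= x <= b /\ projection F c d x) by (exists x0; split; [|exists t0]; auto).
assert (neT : exists t, c <= t <= d /\ projection (transpose F) a b t) by (exists t0; split; [|exists x0]; auto).
destruct (closed1_min _ a b cX neX) as [a' [ha [Fa mina]]]. destruct (closed1_max _ a b cX neX) as [b' [hb [Fb maxb]]].
destruct (closed1_min _ c d cT neT) as [c' [hc [Fc minc]]]. destruct (closed1_max _ c d cT neT) as [d' [hd [Fd maxd]]].
exists a', b', c', d'.
assert (a' <= b') by (apply mina; assumption). assert (c' <= d') by (apply minc; assumption).
repeat split; try lra; try assumption.
- apply mina; [assumption|exists t; auto].
- apply maxb; [assumption|exists t; auto].
- apply minc; [assumption|exists x; auto].
- apply maxd; [assumption|exists x; auto].
Qed.

Definition taxicab (z w : R * R) : R := Rabs (fst z - fst w) + Rabs (snd z - snd w).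

Lemma taxicab_refl z : taxicab z z = 0.
Proof. unfold taxicab. rewrite !Rminus_diag, Rabs_R0. ring. Qed.

Lemma taxicab_sym z w : taxicab z w = taxicab w z.
Proof. unfold taxicab. rewrite (Rabs_minus_sym (fst z)), (Rabs_minus_sym (snd z)). reflexivity. Qed.

Lemma taxicab_triangle z w v : taxicab z v <= taxicab z w + taxicab w v.
Proof.
unfold taxicab. pose proof (Rabs_triang (fst z - fst w) (fst w - fst v)) as triangle1.
pose proof (Rabs_triang (snd z - snd w) (snd w - snd v)) as triangle2.
replace (fst z - fst w + (fst w - fst v)) with (fst z - fst v) in triangle1 by ring.
replace (snd z - snd w + (snd w - snd v)) with (snd z - snd v) in triangle2 by ring. lra.
Qed.

Lemma bmeasurable2_lipschitz k N M : (forall z w, Rabs (k z - k w) <= N * taxicab z w) ->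
  (forall z, Rabs (k z) <= M) -> bmeasurable2 (fun x t => k (x, t)).
Proof.
intros lk kM. apply (bmeasurable2_separate_continuity _ M); [| |intros; apply kM].
- intros t. apply (lipschitz_continuity N). intros x y. specialize (lk (x, t) (y, t)).
  unfold taxicab in lk. simpl in lk. rewrite Rminus_diag, Rabs_R0, Rplus_0_r in lk. exact lk.
- intros x. apply (lipschitz_continuity N). intros t s. specialize (lk (x, t) (x, s)).
  unfold taxicab in lk. simpl in lk. rewrite Rminus_diag, Rabs_R0, Rplus_0_l in lk. exact lk.
Qed.

Section TruncatedDistance.
Variable F : R -> R -> Prop.

Lemma Rabs_0_le_1 (z : R * R) : Rabs 0 <= 1.
Proof. rewrite Rabs_R0. lra. Qed.

Definition truncated_distance x t : R :=
  - lipschitz_extension (R * R) taxicab taxicab_refl taxicab_sym taxicab_triangle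
      (fun z => F (fst z) (snd z)) (fun _ => 0) 1 1 Rle_0_1 Rabs_0_le_1 (x, t).

Lemma truncated_distance_lipschitz x t y s :
  Rabs (truncated_distance x t - truncated_distance y s) <= taxicab (x, t) (y, s).
Proof.
rewrite Rabs_minus_sym. unfold truncated_distance, Rminus. rewrite Ropp_involutive, Rplus_comm.
rewrite <- (Rmult_1_l (taxicab _ _)). apply lipschitz_extension_lipschitz.
Qed.

Lemma truncated_distance_le_taxicab x t y s : F y s -> truncated_distance x t <= Rabs (x - y) + Rabs (t - s).
Proof.
intros Fy. unfold truncated_distance.
assert (h : 0 - 1 * taxicab (x, t) (y, s) <= lipschitz_extension (R * R) taxicab taxicab_refl taxicab_sym
  taxicab_triangle (fun z => F (fst z) (snd z)) (fun _ => 0) 1 1 Rle_0_1 Rabs_0_le_1 (x, t)).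
{ apply lipschitz_extension_ge. right. exists (y, s). auto. }
unfold taxicab in h at 1. simpl in h. lra.
Qed.

Lemma truncated_distance_ge x t rho : rho <= 1 ->
  (forall y s, F y s -> rho <= Rabs (x - y) + Rabs (t - s)) -> rho <= truncated_distance x t.
Proof.
intros r1 far. unfold truncated_distance. apply Ropp_le_cancel. rewrite Ropp_involutive.
apply lipschitz_extension_le. intros v [->|[[y s] [Fy ->]]]; [lra|].
specialize (far y s Fy). unfold taxicab. simpl. lra.
Qed.

Lemma truncated_distance_ge_0 x t : 0 <= truncated_distance x t.
Proof.
apply truncated_distance_ge; [lra|]. intros y s _. pose proof (Rabs_pos (x - y)). pose proof (Rabs_pos (t - s)). lra.
Qed.

Lemma truncated_distance_in x t : F x t -> truncated_distance x t = 0.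
Proof.
intros Fx. apply Rle_antisym; [|apply truncated_distance_ge_0].
apply Rle_trans with (1 := truncated_distance_le_taxicab x t x t Fx). rewrite !Rminus_diag, Rabs_R0. lra.
Qed.

Hypothesis closed_F : closed2 F.

Lemma truncated_distance_out x t : ~ F x t -> 0 < truncated_distance x t.
Proof.
intros nF. destruct (closed_F x t nF) as [rho [r0 h]].
apply Rlt_le_trans with (Rmin 1 rho); [apply Rmin_pos; lra|].
apply truncated_distance_ge; [apply Rmin_l|]. intros y s Fy. apply Rle_trans with (1 := Rmin_r 1 rho).
pose proof (Rabs_pos (x - y)). pose proof (Rabs_pos (t - s)).
destruct (Rle_lt_dec (Rabs (y - x)) rho) as [hx|hx]; rewrite Rabs_minus_sym in hx; [|lra].
destruct (Rle_lt_dec (Rabs (s - t)) rho) as [ht|ht]; rewrite (Rabs_minus_sym s t) in ht; [|lra].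
exfalso. apply (h y s); [rewrite Rabs_minus_sym; exact hx|rewrite Rabs_minus_sym; exact ht|exact Fy].
Qed.

Definition outside x t : R := if excluded_middle_informative (F x t) then 0 else 1.

Lemma outside_in x t : F x t -> outside x t = 0.
Proof. unfold outside. destruct excluded_middle_informative; [reflexivity|contradiction]. Qed.

Lemma outside_out x t : ~ F x t -> outside x t = 1.
Proof. unfold outside. destruct excluded_middle_informative; [contradiction|reflexivity]. Qed.

Lemma outside_bounds x t : 0 <= outside x t <= 1.
Proof. unfold outside. destruct excluded_middle_informative; lra. Qed.

Definition blurred_outside (k : R) x t : R := Rmin 1 (k * truncated_distance x t).

Lemma blurred_outside_bounds k x t : 0 <= k -> 0 <= blurred_outside k x t <= 1.
Proof.
intros k0. pose proof (truncated_distance_ge_0 x t). split; [|apply Rmin_l].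
apply Rmin_glb; [lra|]. apply Rmult_le_pos; assumption.
Qed.

Lemma bmeasurable2_blurred_outside k : 0 <= k -> bmeasurable2 (blurred_outside k).
Proof.
intros k0. apply (bmeasurable2_lipschitz (fun z => blurred_outside k (fst z) (snd z)) k 1).
- intros [x t] [y s]. apply Rle_trans with (Rabs (k * truncated_distance x t - k * truncated_distance y s)).
  + simpl. unfold blurred_outside, Rmin, Rabs. repeat destruct Rle_dec; repeat destruct Rcase_abs; lra.
  + rewrite <- Rmult_minus_distr_l, Rabs_mult, (Rabs_right k) by lra.
    apply Rmult_le_compat_l; [exact k0|apply truncated_distance_lipschitz].
- intros [x t]. apply Rabs_le. pose proof (blurred_outside_bounds k x t k0). simpl. lra.
Qed.

Lemma blurred_outside_lim (k : nat -> R) x t : cv_infty k -> Un_cv (fun n => blurred_outside (k n) x t) (outside x t).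
Proof.
intros ck. apply Un_cv_eventually_const. unfold blurred_outside.
destruct (classic (F x t)) as [h|h].
- rewrite outside_in, truncated_distance_in by exact h. exists 0%nat. intros n _. rewrite Rmult_0_r. apply Rmin_right.
  lra.
- rewrite outside_out by exact h. pose proof (truncated_distance_out x t h) as d0.
  destruct (ck (/ truncated_distance x t)) as [n0 hn]. exists n0. intros n le. specialize (hn n le).
  apply Rmin_left. apply Rmult_lt_compat_r with (r := truncated_distance x t) in hn; [|exact d0].
  rewrite Rinv_l in hn; lra.
Qed.

Lemma bmeasurable2_outside : bmeasurable2 outside.
Proof.
apply (bmeasurable2_lim (fun n => blurred_outside (INR n)) outside 1).
- intros n. apply bmeasurable2_blurred_outside, pos_INR.
- intros x t. apply blurred_outside_lim. intros K. destruct (INR_unbounded K) as [n0 hn0]. exists n0. intros n le.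
  apply le_INR in le. lra.
- intros x t. apply Rabs_le. pose proof (outside_bounds x t). lra.
Qed.
End TruncatedDistance.

(** * The divergence theorem for separately differentiable functions *)

Definition slopes_le N (f : R -> R) x : Prop := forall y, Rabs (f y - f x) <= N * Rabs (y - x).

Lemma slopes_le_bound_ge_0 N f x : slopes_le N f x -> 0 <= N.
Proof.
intros h. specialize (h (x + 1)). replace (x + 1 - x) with 1 in h by ring. rewrite Rabs_R1 in h.
pose proof (Rabs_pos (f (x + 1) - f x)). lra.
Qed.

Lemma slopes_le_quotient N f x h : slopes_le N f x -> 0 < h -> Rabs ((f (x + h) - f x) / h) <= N.
Proof.
intros sf h0. specialize (sf (x + h)). replace (x + h - x) with h in sf by ring. rewrite (Rabs_right h) in sf by lra.
rewrite Rabs_div, (Rabs_right h) by lra. apply Rle_div_l; lra.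
Qed.

Lemma slopes_le_derivative N f x l : slopes_le N f x -> derivable_pt_lim f x l -> Rabs l <= N.
Proof.
intros sf df. apply (@Rle_cv_lim (fun n => Rabs ((f (x + RinvN n) - f x) / RinvN n)) (fun _ => N)).
- intros n. apply slopes_le_quotient; [exact sf|apply cond_pos].
- apply cv_cvabs, derivable_pt_lim_seq; [exact df| |apply RinvN_cv]. intros n. apply Rgt_not_eq, cond_pos.
- apply Un_cv_const.
Qed.

Lemma slopes_le_of_derivative f x l M : (forall y, Rabs (f y) <= M) -> derivable_pt_lim f x l ->
  exists n0 : nat, forall n, (n0 <= n)%nat -> slopes_le (INR n) f x.
Proof.
intros fM df. destruct (df 1 ltac:(lra)) as [dl hdl]. pose proof (cond_pos dl) as d0.
destruct (INR_unbounded (Rabs l + 1 + 2 * M / dl)) as [n0 hn0]. exists n0. intros n le y. apply le_INR in le.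
assert (M0 : 0 <= 2 * M / dl).
{ pose proof (fM 0). pose proof (Rabs_pos (f 0)). apply Rdiv_le_0_compat; lra. }
pose proof (Rabs_pos l). destruct (Req_dec (y - x) 0) as [e|ne].
{ replace y with x by lra. rewrite !Rminus_diag, Rabs_R0. lra. }
pose proof (Rabs_pos_lt _ ne). destruct (Rlt_le_dec (Rabs (y - x)) dl) as [near|far].
- specialize (hdl (y - x) ne near). replace (x + (y - x)) with y in hdl by ring.
  pose proof (Rabs_triang_inv ((f y - f x) / (y - x)) l) as tr.
  rewrite Rabs_div in tr by exact ne.
  apply Rle_trans with ((Rabs l + 1) * Rabs (y - x)); [|nra]. apply Rle_div_l; lra.
- apply Rle_trans with (2 * M).
  + pose proof (fM y) as fy. pose proof (fM x) as fx. apply Rabs_le_between in fy, fx. apply Rabs_le. lra.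
  + apply Rle_trans with (2 * M / dl * Rabs (y - x)); [|nra].
    apply Rle_trans with (2 * M / dl * dl); [right; field; lra|]. apply Rmult_le_compat_l; assumption.
Qed.

Lemma closed2_slopes_le P N : (forall x, continuity (P x)) -> closed2 (fun x t => slopes_le N (fun y => P y t) x).
Proof.
intros cP. apply closed2_of_sequences. intros x t x0 t0 sP cx ct y.
apply (@Rle_cv_lim (fun n => Rabs (P y (t n) - P x0 (t n))) (fun n => N * Rabs (y - x n) + N * Rabs (x0 - x n))).
- intros n. pose proof (sP n y) as slope_y. pose proof (sP n x0) as slope_x0.
  replace (P y (t n) - P x0 (t n)) with (P y (t n) - P (x n) (t n) + - (P x0 (t n) - P (x n) (t n))) by ring.
  apply Rle_trans with (1 := Rabs_triang _ _). rewrite Rabs_Ropp. lra.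
- apply cv_cvabs, CV_minus; apply continuity_seq; auto; apply cP.
- replace (N * Rabs (y - x0)) with (N * Rabs (y - x0) + N * Rabs (x0 - x0)) by (rewrite Rminus_diag, Rabs_R0; ring).
  apply CV_plus; apply Un_cv_scal, cv_cvabs, CV_minus; auto; apply Un_cv_const.
Qed.

Section PartialDerivativeOnSubset.
Variables (G : R -> Prop) (chi f phi : R -> R) (N M a b : R).
Hypothesis bmeas_chi : bmeasurable chi.
Hypothesis chi_in : forall x, G x -> chi x = 0.
Hypothesis chi_out : forall x, ~ G x -> chi x = 1.
Hypothesis f_bounded : forall x, Rabs (f x) <= M.
Hypothesis f_slopes : forall x, G x -> slopes_le N f x.
Hypothesis bmeas_phi : bmeasurable phi.
Hypothesis phi_out : forall x, ~ G x -> phi x = 0.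
Hypothesis phi_derivative : forall x, G x -> derivable_pt_lim f x (phi x).
Hypothesis ab : a <= b.
Hypothesis G_meets : exists x, a <= x <= b /\ G x.

Let N_ge_0 : 0 <= N.
Proof. destruct G_meets as [x [_ Gx]]. exact (slopes_le_bound_ge_0 N f x (f_slopes x Gx)). Qed.

Lemma phi_bounded x : Rabs (phi x) <= N.
Proof.
destruct (classic (G x)) as [h|h].
- exact (slopes_le_derivative N f x _ (f_slopes x h) (phi_derivative x h)).
- rewrite phi_out, Rabs_R0 by exact h. exact N_ge_0.
Qed.

Lemma lipschitz_interpolation : exists k, lipschitz N k /\ (forall x, Rabs (k x) <= M) /\
  (forall x, G x -> k x = f x) /\ k a = f a /\ k b = f b.
Proof.
set (E := fun x => G x \/ x = a \/ x = b).
assert (f_lip : forall x y, E x -> E y -> f y - f x <= N * Rabs (x - y)).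
{ assert (from_G : forall x y, G x -> Rabs (f y - f x) <= N * Rabs (x - y)).
  { intros x y Gx. rewrite (Rabs_minus_sym x y). apply f_slopes, Gx. }
  intros x y Ex [Gy|ey].
  { pose proof (from_G y x Gy) as h. apply Rabs_le_between in h. rewrite (Rabs_minus_sym x y). lra. }
  destruct Ex as [Gx|ex].
  { pose proof (from_G x y Gx) as h. apply Rabs_le_between in h. lra. }
  destruct G_meets as [z [hz Gz]]. pose proof (from_G z a Gz) as za. pose proof (from_G z b Gz) as zb.
  rewrite (Rabs_right (z - a)) in za by lra. rewrite (Rabs_left1 (z - b)) in zb by lra.
  apply Rabs_le_between in za, zb.
  destruct ex as [->| ->], ey as [->| ->]; rewrite ?Rminus_diag, ?Rabs_R0; try lra.
  - rewrite Rabs_left1 by lra. nra.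
  - rewrite Rabs_right by lra. nra. }
set (k := lipschitz_extension R (fun x y => Rabs (x - y)) (fun x => eq_trans (f_equal Rabs (Rminus_diag x)) Rabs_R0)
  Rabs_minus_sym (fun x y z => Rdist_tri x z y) E f N M N_ge_0 f_bounded).
assert (k_eq : forall x, E x -> k x = f x) by (intros x Ex; apply lipschitz_extension_eq; auto).
exists k. split; [|split; [|split; [|split]]].
- intros x y. apply (lipschitz_extension_lipschitz R (fun x y => Rabs (x - y))).
- intros x. apply (lipschitz_extension_bounded R (fun x y => Rabs (x - y))).
- intros x Gx. apply k_eq. left. exact Gx.
- apply k_eq. right. left. reflexivity.
- apply k_eq. right. right. reflexivity.
Qed.

Let chi01 x : 0 <= chi x <= 1.
Proof. destruct (classic (G x)) as [h|h]; [rewrite chi_in by exact h|rewrite chi_out by exact h]; lra. Qed.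

Lemma integral_chi_shift_le h : 0 <= h -> integral a b (fun x => chi (x + h)) <= integral a b chi + h.
Proof.
intros h0. rewrite integral_shift by exact bmeas_chi.
pose proof (integral_Chasles a (a + h) (b + h) chi bmeas_chi ltac:(lra) ltac:(lra)).
pose proof (integral_Chasles a b (b + h) chi bmeas_chi ltac:(lra) ltac:(lra)).
assert (0 <= integral a (a + h) chi) by (apply integral_ge_0; [exact bmeas_chi|lra|intros; apply chi01]).
assert (integral b (b + h) chi <= 1 * (b + h - b)).
{ rewrite <- integral_const by lra. apply integral_le; [exact bmeas_chi|apply bmeasurable_const|intros; apply chi01]. }
lra.
Qed.

Section InterpolationQuotients.
Variables (k : R -> R) (h : nat -> R).
Hypothesis k_lip : lipschitz N k.
Hypothesis bmeas_k : bmeasurable k.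
Hypothesis k_eq : forall x, G x -> k x = f x.
Hypothesis h_gt_0 : forall n, 0 < h n.
Hypothesis h_cv_0 : Un_cv h 0.

Definition quotient n x : R := (k (x + h n) - k x) / h n.

Definition common_defect n x : R := (1 - chi x) * (1 - chi (x + h n)) * (quotient n x - phi x).

Lemma bmeasurable_quotient n : bmeasurable (quotient n).
Proof. unfold quotient, Rdiv. pose proof (bmeasurable_shift k (h n) bmeas_k). bmeas. Qed.

Lemma bmeasurable_common_defect n : bmeasurable (common_defect n).
Proof.
unfold common_defect. pose proof (bmeasurable_quotient n). pose proof (bmeasurable_shift chi (h n) bmeas_chi). bmeas.
Qed.

Lemma quotient_bounded n x : Rabs (quotient n x) <= N.
Proof. apply slopes_le_quotient; [intros y; apply k_lip|apply h_gt_0]. Qed.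

(* The difference quotients of [k] agree with those of [f] when [x] and [x + h n] are both in [G]. *)
Lemma common_defect_cv_0 x : Un_cv (fun n => common_defect n x) 0.
Proof.
destruct (classic (G x)) as [Gx|nG].
- apply (Un_cv_squeeze _ (fun n => Rabs ((f (x + h n) - f x) / h n - phi x))).
  + intros n. unfold common_defect, quotient. rewrite Rminus_0_r, chi_in by exact Gx.
    destruct (classic (G (x + h n))) as [Gy|nG].
    * rewrite chi_in, !k_eq by assumption. right. f_equal. ring.
    * rewrite chi_out by exact nG. rewrite Rminus_diag, Rmult_0_r, Rmult_0_l, Rabs_R0. apply Rabs_pos.
  + rewrite <- Rabs_R0, <- (Rminus_diag (phi x)). apply cv_cvabs, CV_minus; [|apply Un_cv_const].
    apply derivable_pt_lim_seq; [auto| |exact h_cv_0]. intros n. apply Rgt_not_eq, h_gt_0.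
- apply Un_cv_eventually_const. exists 0%nat. intros n _. unfold common_defect. rewrite chi_out by exact nG. ring.
Qed.

Lemma integral_common_defect_cv_0 : Un_cv (fun n => integral a b (common_defect n)) 0.
Proof.
replace 0 with (integral a b (fun _ => 0)) by (rewrite integral_const by exact ab; ring).
apply (integral_lim a b common_defect _ (2 * N)); [exact bmeasurable_common_defect|apply bmeasurable_const| |].
- intros n x _. unfold common_defect. replace (2 * N) with (1 * 1 * (2 * N)) by ring.
  pose proof (chi01 x). pose proof (chi01 (x + h n)).
  rewrite !Rabs_mult. repeat apply Rmult_le_compat; try apply Rmult_le_pos; try apply Rabs_pos; try (apply Rabs_le;
    lra).
  pose proof (quotient_bounded n x) as hq. pose proof (phi_bounded x) as hp. apply Rabs_le_between in hq, hp.
  apply Rabs_le. lra.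
- intros x _. apply common_defect_cv_0.
Qed.

Lemma quotient_minus_phi_le n : Rabs (integral a b (quotient n) - integral a b phi - integral a b (common_defect n))
  <= 3 * N * integral a b chi + 2 * N * h n.
Proof.
pose proof (h_gt_0 n) as h0. pose proof (bmeasurable_quotient n). pose proof (bmeasurable_common_defect n).
pose proof (bmeasurable_shift chi (h n) bmeas_chi). rewrite <- !integral_minus by bmeas.
apply Rle_trans with (integral a b (fun x => N * chi x + 2 * N * chi (x + h n))).
- apply integral_Rabs_le; [bmeas|bmeas|]. intros x _. unfold common_defect.
  pose proof (quotient_bounded n x) as hq. pose proof (phi_bounded x) as hp. apply Rabs_le_between in hq, hp.
  destruct (classic (G x)) as [Gx|nG].
  + rewrite (chi_in x Gx). destruct (classic (G (x + h n))) as [Gy|nG].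
    * rewrite chi_in by exact Gy. apply Rabs_le. lra.
    * rewrite chi_out by exact nG. apply Rabs_le. lra.
  + rewrite (chi_out x nG), (phi_out x nG). pose proof (chi01 (x + h n)). apply Rabs_le. nra.
- rewrite integral_plus, !integral_scal by bmeas. pose proof (integral_chi_shift_le (h n) ltac:(lra)) as hs.
  apply Rmult_le_compat_l with (r := 2 * N) in hs; lra.
Qed.
End InterpolationQuotients.

Lemma increment_minus_integral_le : Rabs (f b - f a - integral a b phi) <= 3 * N * integral a b chi.
Proof.
destruct lipschitz_interpolation as [k [k_lip [k_bounded [k_eq [ka kb]]]]].
pose proof (lipschitz_continuity N k k_lip) as ck. pose proof (bmeasurable_continuity k M ck k_bounded) as bk.
assert (h0 : forall n, 0 < RinvN n) by (intros n; apply cond_pos).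
apply (@Rle_cv_lim (fun n => Rabs (integral a b (quotient k RinvN n) - integral a b phi
    - integral a b (common_defect k RinvN n))) (fun n => 3 * N * integral a b chi + 2 * N * RinvN n)).
- intros n. apply quotient_minus_phi_le; assumption.
- rewrite <- (Rminus_0_r (f b - f a - integral a b phi)), <- ka, <- kb.
  apply cv_cvabs, CV_minus; [apply CV_minus; [|apply Un_cv_const]|].
  + apply integral_difference_quotient; try assumption. apply RinvN_cv.
  + apply integral_common_defect_cv_0; try assumption. apply RinvN_cv.
- rewrite <- (Rplus_0_r (3 * N * _)), <- (Rmult_0_r (2 * N)) at 1.
  apply CV_plus; [apply Un_cv_const|apply Un_cv_scal, RinvN_cv].
Qed.
End PartialDerivativeOnSubset.

Section FluxEstimate.
Variables (E : R -> R -> Prop) (P Px : R -> R -> R) (N M : R).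
Hypothesis closed_E : closed2 E.
Hypothesis bmeas_P : bmeasurable2 P.
Hypothesis P_bounded : forall x t, Rabs (P x t) <= M.
Hypothesis P_slopes1 : forall x t, E x t -> slopes_le N (fun y => P y t) x.
Hypothesis P_slopes2 : forall x t, E x t -> slopes_le N (P x) t.
Hypothesis P_derivative : forall x t, E x t -> derivable_pt_lim (fun y => P y t) x (Px x t).

Definition restricted x t : R := (1 - outside E x t) * Px x t.

Lemma restricted_in x t : E x t -> restricted x t = Px x t.
Proof. intros h. unfold restricted. rewrite outside_in by exact h. ring. Qed.

Lemma restricted_out x t : ~ E x t -> restricted x t = 0.
Proof. intros h. unfold restricted. rewrite outside_out by exact h. ring. Qed.

Let N_abs x t : Rabs (restricted x t) <= Rabs N.
Proof.
destruct (classic (E x t)) as [h|h].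
- rewrite restricted_in by exact h. apply Rle_trans with N; [|apply Rle_abs].
  exact (slopes_le_derivative N (fun y => P y t) x _ (P_slopes1 x t h) (P_derivative x t h)).
- rewrite restricted_out, Rabs_R0 by exact h. apply Rabs_pos.
Qed.

Lemma bmeasurable2_restricted : bmeasurable2 restricted.
Proof.
apply (bmeasurable2_lim (fun n x t => (1 - outside E x t) * ((P (x + RinvN n) t - P x t) * / RinvN n))
  restricted (Rabs N)).
- intros n. apply bmeasurable2_mult.
  + apply bmeasurable2_minus; [apply bmeasurable2_const|apply bmeasurable2_outside, closed_E].
  + apply bmeasurable2_mult; [|apply bmeasurable2_const].
    apply bmeasurable2_minus; [apply (bmeasurable2_shift P)|]; exact bmeas_P.
- intros x t. unfold restricted. destruct (classic (E x t)) as [h|h].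
  + apply CV_mult; [apply Un_cv_const|].
    apply (derivable_pt_lim_seq (fun y => P y t)); [auto| |apply RinvN_cv]. intros n. apply Rgt_not_eq, cond_pos.
  + rewrite outside_out by exact h. apply Un_cv_eventually_const. exists 0%nat. intros n _. ring.
- exact N_abs.
Qed.

Variables a b c d a' b' c' d' lam : R.
Hypothesis subrect1 : a <= a' /\ a' <= b' /\ b' <= b.
Hypothesis subrect2 : c <= c' /\ c' <= d' /\ d' <= d.
Hypothesis touch_left : projection E c d a'.
Hypothesis touch_right : projection E c d b'.
Hypothesis E_between : forall x t, a <= x <= b -> c <= t <= d -> E x t -> a' <= x <= b'.
Hypothesis lam_ge_1 : 1 <= lam.
Hypothesis aspect : d - c <= lam * (b - a).

Let N_ge_0 : 0 <= N.
Proof. destruct touch_left as [t [_ h]]. exact (slopes_le_bound_ge_0 N _ a' (P_slopes1 a' t h)). Qed.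

Lemma row_increment_le t : c' <= t <= d' ->
  Rabs (P b' t - P a' t - integral a' b' (fun x => restricted x t))
  <= 4 * N * lam * integral a b (fun x => outside E x t).
Proof.
intros ht. pose proof (bmeasurable2_section1 _ t (bmeasurable2_outside E closed_E)) as bchi.
pose proof (bmeasurable2_section1 _ t bmeasurable2_restricted) as bphi.
assert (chi0 : forall x, 0 <= outside E x t) by (intros; apply outside_bounds).
destruct (classic (exists x, a <= x <= b /\ E x t)) as [[x [hx Ex]]|empty].
- apply Rle_trans with (3 * N * integral a' b' (fun x => outside E x t)).
  + apply (increment_minus_integral_le (fun x => E x t) _ (fun x => P x t) (fun x => restricted x t) N M); auto.
    * intros y h. apply outside_in, h.
    * intros y h. apply outside_out, h.
    * intros y h. apply restricted_out, h.
    * intros y h. rewrite restricted_in by exact h. apply P_derivative, h.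
    * lra.
    * exists x. split; [apply (E_between x t); auto; lra|exact Ex].
  + pose proof (integral_le_subsegment a b a' b' _ bchi chi0 ltac:(lra) ltac:(lra) ltac:(lra)) as sub.
    pose proof (integral_ge_0 a' b' _ bchi ltac:(lra) (fun x _ => chi0 x)). pose proof N_ge_0.
    apply Rmult_le_compat; (assumption || nra).
- assert (zero : integral a' b' (fun x => restricted x t) = 0).
  { apply Rabs_eq_0. apply Rle_antisym; [|apply Rabs_pos]. rewrite <- (Rmult_0_l (b' - a')).
    apply integral_Rabs_le_const; [exact bphi|lra|]. intros x hx. rewrite restricted_out, Rabs_R0; [lra|].
    intros h. apply empty. exists x. split; [lra|exact h]. }
  assert (full : b - a <= integral a b (fun x => outside E x t)).
  { rewrite <- (Rmult_1_l (b - a)), <- (integral_const a b 1) by lra. apply integral_le; [bmeas|exact bchi|].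
    intros x hx. rewrite outside_out; [lra|]. intros h. apply empty. exists x. auto. }
  rewrite zero, Rminus_0_r. destruct touch_left as [ta [hta Ea]]. destruct touch_right as [tb [htb Eb]].
  assert (step : forall s s', c <= s <= d -> c <= s' <= d -> N * Rabs (s - s') <= N * (d - c)).
  { intros s s' hs hs'. apply Rmult_le_compat_l; [exact N_ge_0|]. apply Rabs_le. lra. }
  pose proof (P_slopes2 b' tb Eb t) as right_t. pose proof (P_slopes1 b' tb Eb a') as across.
  pose proof (P_slopes2 a' ta Ea tb) as left_tb. pose proof (P_slopes2 a' ta Ea t) as left_t.
  pose proof (step t tb ltac:(lra) htb). pose proof (step tb ta htb hta). pose proof (step t ta ltac:(lra) hta).
  assert (N * Rabs (a' - b') <= N * (b - a)) by (apply Rmult_le_compat_l; [exact N_ge_0|apply Rabs_le; lra]).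
  apply Rabs_le_between in right_t, across, left_tb, left_t.
  apply Rle_trans with (4 * N * lam * (b - a)).
  + apply Rabs_le. assert (N * (d - c) <= N * (lam * (b - a))) by (apply Rmult_le_compat_l; assumption).
    assert (N * (1 * (b - a)) <= N * (lam * (b - a)))
      by (apply Rmult_le_compat_l; [assumption|apply Rmult_le_compat_r; lra]).
    lra.
  + apply Rmult_le_compat_l; [apply Rmult_le_pos; lra|exact full].
Qed.

Lemma flux_minus_integral_le :
  Rabs (integral c' d' (fun t => P b' t - P a' t) - integral2 a' b' c' d' restricted)
  <= 4 * N * lam * integral2 a b c d (outside E).
Proof.
pose proof (bmeasurable2_outside E closed_E) as bchi. pose proof bmeasurable2_restricted as bphi.
pose proof (bmeasurable2_section2 P a' bmeas_P) as ba. pose proof (bmeasurable2_section2 P b' bmeas_P) as bb.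
pose proof (bmeasurable2_integral1 _ a' b' bphi) as bphi1. pose proof (bmeasurable2_integral1 _ a b bchi) as bchi1.
unfold integral2. rewrite <- integral_minus by bmeas.
apply Rle_trans with (integral c' d' (fun t => 4 * N * lam * integral a b (fun x => outside E x t))).
- apply integral_Rabs_le; [bmeas|bmeas|]. exact row_increment_le.
- rewrite integral_scal by exact bchi1. apply Rmult_le_compat_l; [pose proof N_ge_0; nra|].
  apply integral_le_subsegment; try lra; [exact bchi1|]. intros t.
  apply integral_ge_0; [apply (bmeasurable2_section1 _ t bchi)|lra|]. intros; apply outside_bounds.
Qed.
End FluxEstimate.

Lemma nested_segments (y r : nat -> R) : (forall n, 0 <= r n) ->
  (forall n, Rabs (y (S n) - y n) + r (S n) <= r n) -> exists x, forall n, Rabs (x - y n) <= r n.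
Proof.
intros r0 nest.
assert (mono : forall n k, y n - r n <= y (n + k)%nat - r (n + k)%nat /\ y (n + k)%nat + r (n + k)%nat <= y n + r n).
{ intros n k. induction k as [|k IH]; [rewrite Nat.add_0_r; lra|]. rewrite Nat.add_succ_r.
  assert (h : Rabs (y (S (n + k)) - y (n + k)%nat) <= r (n + k)%nat - r (S (n + k)))
    by (pose proof (nest (n + k)%nat); lra).
  apply Rabs_le_between in h. lra. }
assert (cross : forall n m, y n - r n <= y m + r m).
{ intros n m. pose proof (mono n m). pose proof (mono m n) as h. rewrite (Nat.add_comm m n) in h.
  pose proof (r0 (n + m)%nat). lra. }
destruct (completeness (fun v => exists n, v = y n - r n)) as [x [ub lub]].
- exists (y 0%nat + r 0%nat). intros v [n ->]. apply cross.
- exists (y 0%nat - r 0%nat), 0%nat. reflexivity.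
- exists x. intros n. apply Rabs_le.
  assert (y n - r n <= x) by (apply ub; exists n; reflexivity).
  assert (x <= y n + r n) by (apply lub; intros v [m ->]; apply cross). lra.
Qed.
Lemma cv_infty_pow_2_div K : 0 < K -> cv_infty (fun n => 2 ^ n / K).
Proof.
intros K0 x. destruct (Pow_x_infinity 2 ltac:(rewrite Rabs_right; lra) (x * K + 1)) as [n0 hn]. exists n0. intros n le.
specialize (hn n le). rewrite Rabs_right in hn by (apply Rle_ge, pow_le; lra). apply Rlt_div_r; lra.
Qed.

Lemma closed2_baire (F : R -> R -> Prop) (A : nat -> R -> R -> Prop) : closed2 F -> (forall n, closed2 (A n)) ->
  (forall x t, F x t -> exists n, A n x t) -> (exists x t, F x t) ->
  exists n x t rho, 0 < rho /\ F x t /\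
    forall y s, F y s -> Rabs (y - x) <= rho -> Rabs (s - t) <= rho -> A n y s.
Proof.
intros cF cA cover [x0 [t0 F0]]. apply NNPP. intros no_portion.
set (square := {z : R * R * R | F (fst (fst z)) (snd (fst z)) /\ 0 < snd z}).
set (x (z : square) := fst (fst (proj1_sig z))). set (t (z : square) := snd (fst (proj1_sig z))).
set (r (z : square) := snd (proj1_sig z)).
assert (Fz : forall z, F (x z) (t z)) by (intros z; apply (proj2_sig z)).
assert (r0 : forall z, 0 < r z) by (intros z; apply (proj2_sig z)).
assert (smaller : forall nz : nat * square, exists w, r w <= r (snd nz) / 2 /\
  Rabs (x w - x (snd nz)) + r w <= r (snd nz) /\ Rabs (t w - t (snd nz)) + r w <= r (snd nz) /\
  forall y s, Rabs (y - x w) <= r w -> Rabs (s - t w) <= r w -> ~ A (fst nz) y s).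
{ intros [n z]. simpl. pose proof (r0 z) as rz. apply NNPP. intros none. apply no_portion.
  exists n, (x z), (t z), (r z / 2). split; [lra|]. split; [apply Fz|]. intros y s Fy hy hs. apply NNPP. intros nA.
  destruct (cA n y s nA) as [rho [rho0 miss]]. apply none.
  assert (q0 : 0 < Rmin (r z / 2) rho) by (apply Rmin_pos; lra).
  exists (exist _ (y, s, Rmin (r z / 2) rho) (conj Fy q0)). unfold x, t, r in *. simpl.
  pose proof (Rmin_l (snd (proj1_sig z) / 2) rho). pose proof (Rmin_r (snd (proj1_sig z) / 2) rho).
  repeat split; try lra. intros y' s' hy' hs'. apply miss; lra. }
destruct (boolp.choice smaller) as [next hnext].
set (z := nat_rect (fun _ => square) (exist _ (x0, t0, 1) (conj F0 Rlt_0_1)) (fun n w => next (n, w))).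
assert (hz : forall n, r (z (S n)) <= r (z n) / 2 /\
  Rabs (x (z (S n)) - x (z n)) + r (z (S n)) <= r (z n) /\
  Rabs (t (z (S n)) - t (z n)) + r (z (S n)) <= r (z n) /\
  forall y s, Rabs (y - x (z (S n))) <= r (z (S n)) ->
    Rabs (s - t (z (S n))) <= r (z (S n)) -> ~ A n y s)
  by (intros n; exact (hnext (n, z n))).
destruct (nested_segments (fun n => x (z n)) (fun n => r (z n))) as [y hy]; [intros; left; apply r0|apply hz|].
destruct (nested_segments (fun n => t (z n)) (fun n => r (z n))) as [s hs]; [intros; left; apply r0|apply hz|].
assert (Fy : F y s).
{ apply NNPP. intros nF. destruct (cF y s nF) as [rho [rho0 miss]].
  assert (shrink : forall n, 2 ^ n * r (z n) <= 1).
  { induction n as [|n IH]; [simpl; unfold r; simpl; lra|]. pose proof (proj1 (hz n)) as h.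
    apply Rmult_le_compat_l with (r := 2 ^ n) in h; [|apply pow_le; lra]. simpl pow. lra. }
  destruct (cv_infty_pow_2_div 1 Rlt_0_1 (/ rho)) as [n hn]. specialize (hn n (Nat.le_refl n)). specialize (shrink n).
  apply (miss (x (z n)) (t (z n))); [| |apply Fz]; rewrite Rabs_minus_sym; [pose proof (hy n)|pose proof (hs n)];
    pose proof (r0 (z n)); assert (0 < / rho) by (apply Rinv_0_lt_compat, rho0);
    assert (rho * / rho = 1) by (apply Rinv_r; lra); rewrite Rdiv_1_r in hn; nra. }
destruct (cover y s Fy) as [n An]. apply (proj2 (proj2 (proj2 (hz n))) y s (hy _) (hs _) An).
Qed.

Definition flux_defect (P S g : R -> R -> R) a b c d : R :=
  integral c d (fun t => P b t - P a t) + integral a b (fun x => S x d - S x c) - integral2 a b c d g.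

Section FluxDefect.
Variables P S g : R -> R -> R.
Hypothesis bmeas_P : bmeasurable2 P.
Hypothesis bmeas_S : bmeasurable2 S.
Hypothesis bmeas_g : bmeasurable2 g.
Local Notation D := (flux_defect P S g).

Let bmeas_P_row x : bmeasurable (P x). Proof. apply bmeasurable2_section2, bmeas_P. Qed.

Let bmeas_S_row t : bmeasurable (fun x => S x t). Proof. apply bmeasurable2_section1, bmeas_S. Qed.

Lemma flux_defect_Chasles1 a m b c d : a <= m -> m <= b -> D a b c d = D a m c d + D m b c d.
Proof.
intros am mb. unfold flux_defect. rewrite (integral2_Chasles1 a m b) by assumption.
rewrite (integral_Chasles a m b) by (try assumption; apply bmeasurable_minus; apply bmeas_S_row).
rewrite !(integral_minus c d (P _)) by apply bmeas_P_row. ring.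
Qed.

Lemma flux_defect_Chasles2 a b c m d : c <= m -> m <= d -> D a b c d = D a b c m + D a b m d.
Proof.
intros cm md. unfold flux_defect. rewrite (integral2_Chasles2 a b c m d) by assumption.
rewrite (integral_Chasles c m d) by (try assumption; apply bmeasurable_minus; apply bmeas_P_row).
rewrite !(integral_minus a b (fun x => S x _)) by apply bmeas_S_row. ring.
Qed.

Lemma flux_defect_quarters a m b c s d : a <= m -> m <= b -> c <= s -> s <= d ->
  D a b c d = D a m c s + D a m s d + D m b c s + D m b s d.
Proof.
intros am mb cs sd. rewrite (flux_defect_Chasles1 a m b), (flux_defect_Chasles2 a m c s d) by assumption.
rewrite (flux_defect_Chasles2 m b c s d) by assumption. ring.
Qed.

Lemma flux_defect_transpose a b c d : D a b c d = flux_defect (transpose S) (transpose P) (transpose g) c d a b.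
Proof. unfold flux_defect, transpose. rewrite (integral2_swap a b c d g) by exact bmeas_g. ring. Qed.

Lemma flux_defect_flat1 a c d : D a a c d = 0.
Proof. pose proof (flux_defect_Chasles1 a a a c d ltac:(lra) ltac:(lra)). lra. Qed.

Lemma flux_defect_flat2 a b c : D a b c c = 0.
Proof. pose proof (flux_defect_Chasles2 a b c c c ltac:(lra) ltac:(lra)). lra. Qed.

Definition regular_point x t : Prop := exists rho, 0 < rho /\ forall a b c d,
  x - rho <= a -> a <= b -> b <= x + rho -> t - rho <= c -> c <= d -> d <= t + rho -> D a b c d = 0.

Definition singular_point x t : Prop := ~ regular_point x t.

Lemma closed2_singular_point : closed2 singular_point.
Proof.
intros x t n. apply NNPP in n. destruct n as [rho [r0 h]]. exists (rho / 2). split; [lra|].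
intros y s hy hs sing. apply sing. exists (rho / 2). split; [lra|].
apply Rabs_le_between in hy, hs. intros. apply h; lra.
Qed.

Lemma flux_defect_of_regular a b c d : a <= b -> c <= d ->
  (forall x t, a <= x <= b -> c <= t <= d -> regular_point x t) -> D a b c d = 0.
Proof.
intros ab cd reg.
set (thin_strip := fun x c d => exists rho, 0 < rho /\ forall a' b' c' d',
  x - rho <= a' -> a' <= b' -> b' <= x + rho -> c <= c' -> c' <= d' -> d' <= d -> D a' b' c' d' = 0).
assert (strip : forall x, a <= x <= b -> thin_strip x c d).
{ intros x hx. apply (segment_induction (thin_strip x)); [assumption| |].
  - intros p m q _ pm mq _ [r1 [r1_gt_0 below]] [r2 [r2_gt_0 above]]. exists (Rmin r1 r2).
    split; [apply Rmin_pos; assumption|]. pose proof (Rmin_l r1 r2). pose proof (Rmin_r r1 r2).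
    intros a' b' c' d' ? ? ? ? ? ?.
    destruct (Rle_dec d' m); [apply below; lra|]. destruct (Rle_dec m c'); [apply above; lra|].
    rewrite (flux_defect_Chasles2 a' b' c' m d'), below, above by lra. ring.
  - intros t ht. destruct (reg x t hx ht) as [rho [r0 h]]. exists rho. split; [assumption|].
    intros p q ? ? ? ? ? ?. exists rho. split; [assumption|]. intros. apply h; lra. }
apply (segment_induction (fun a b => D a b c d = 0)); [assumption| |].
- intros p m q _ pm mq _ left_part right_part. rewrite (flux_defect_Chasles1 p m q), left_part, right_part by lra. ring.
- intros x hx. destruct (strip x hx) as [rho [r0 h]]. exists rho. split; [assumption|]. intros. apply h; lra.
Qed.

Variable M : R.
Hypothesis P_continuous : forall t, continuity (fun x => P x t).
Hypothesis P_bounded : forall x t, Rabs (P x t) <= M.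
Hypothesis S_bounded : forall x t, Rabs (S x t) <= M.
Hypothesis g_bounded : forall x t, Rabs (g x t) <= M.

Lemma flux_defect_thin (p q : nat -> R) x c d : c <= d -> (forall n, p n <= q n) -> Un_cv p x -> Un_cv q x ->
  Un_cv (fun n => D (p n) (q n) c d) 0.
Proof.
intros cd pq cp cq.
assert (width : forall K, Un_cv (fun n => K * (q n - p n)) 0).
{ intros K. rewrite <- (Rmult_0_r K), <- (Rminus_diag x). apply Un_cv_scal, CV_minus; assumption. }
replace 0 with (0 + 0 - 0) by ring. apply CV_minus; [apply CV_plus|].
- replace 0 with (integral c d (fun _ => 0)) by (rewrite integral_const by exact cd; ring).
  apply (integral_lim c d (fun n t => P (q n) t - P (p n) t) _ (2 * M)).
  + intros n. apply bmeasurable_minus; apply bmeas_P_row.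
  + apply bmeasurable_const.
  + intros n t _. pose proof (P_bounded (q n) t) as Pq. pose proof (P_bounded (p n) t) as Pp.
    apply Rabs_le_between in Pq, Pp. apply Rabs_le. lra.
  + intros t _. rewrite <- (Rminus_diag (P x t)).
    apply CV_minus; apply (continuity_seq (fun x => P x t)); try assumption; apply P_continuous.
- apply (Un_cv_squeeze _ (fun n => 2 * M * (q n - p n))); [|apply width]. intros n. rewrite Rminus_0_r.
  apply integral_Rabs_le_const; [apply bmeasurable_minus; apply bmeas_S_row|apply pq|].
  intros y _. pose proof (S_bounded y d) as Sd. pose proof (S_bounded y c) as Sc.
  apply Rabs_le_between in Sd, Sc. apply Rabs_le. lra.
- apply (Un_cv_squeeze _ (fun n => M * (d - c) * (q n - p n))); [|apply width]. intros n. rewrite Rminus_0_r.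
  replace (M * (d - c) * (q n - p n)) with (M * (q n - p n) * (d - c)) by ring.
  apply integral_Rabs_le_const; [apply bmeasurable2_integral1, bmeas_g|exact cd|]. intros t _.
  apply integral_Rabs_le_const; [apply (bmeasurable2_section1 g t bmeas_g)|apply pq|]. intros y _. apply g_bounded.
Qed.

Lemma flux_defect_exhaust1 a b c d : a <= b -> c <= d ->
  (forall p q, a < p -> p <= q -> q < b -> D p q c d = 0) -> D a b c d = 0.
Proof.
intros ab cd inner. destruct (Req_dec a b) as [->|ne]; [apply flux_defect_flat1|].
set (e n := (b - a) / 2 * RinvN n).
assert (he : forall n, 0 < e n <= (b - a) / 2).
{ intros n. unfold e. pose proof (cond_pos (RinvN n)). assert (RinvN n <= 1).
  { simpl. rewrite <- Rinv_1. apply Rinv_le_contravar; [lra|]. pose proof (pos_INR n). lra. }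
  split; [apply Rmult_lt_0_compat; lra|]. rewrite <- (Rmult_1_r ((b - a) / 2)) at 2. apply Rmult_le_compat_l; lra. }
assert (ce : Un_cv e 0) by (rewrite <- (Rmult_0_r ((b - a) / 2)); apply Un_cv_scal, RinvN_cv).
apply (UL_sequence (fun n => D a (a + e n) c d + D (b - e n) b c d)).
- apply Un_cv_eventually_const. exists 0%nat. intros n _. specialize (he n).
  rewrite (flux_defect_Chasles1 a (a + e n) b), (flux_defect_Chasles1 (a + e n) (b - e n) b) by lra.
  rewrite (inner (a + e n) (b - e n)) by lra. ring.
- replace 0 with (0 + 0) by ring. apply CV_plus.
  + apply (flux_defect_thin (fun _ => a) (fun n => a + e n) a);
      [exact cd|intros n; specialize (he n); lra|apply Un_cv_const|].
    pose proof (CV_plus _ _ _ _ (Un_cv_const a) ce) as ca. rewrite Rplus_0_r in ca. exact ca.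
  + apply (flux_defect_thin (fun n => b - e n) (fun _ => b) b);
      [exact cd|intros n; specialize (he n); lra| |apply Un_cv_const].
    pose proof (CV_minus _ _ _ _ (Un_cv_const b) ce) as cb. rewrite Rminus_0_r in cb. exact cb.
Qed.
End FluxDefect.

Section DivergenceTheorem.
Variables P S g Px Pt Sx St : R -> R -> R.
Variable M : R.
Hypothesis P_bounded : forall x t, Rabs (P x t) <= M.
Hypothesis S_bounded : forall x t, Rabs (S x t) <= M.
Hypothesis g_bounded : forall x t, Rabs (g x t) <= M.
Hypothesis P_derivative1 : forall x t, derivable_pt_lim (fun x => P x t) x (Px x t).
Hypothesis P_derivative2 : forall x t, derivable_pt_lim (P x) t (Pt x t).
Hypothesis S_derivative1 : forall x t, derivable_pt_lim (fun x => S x t) x (Sx x t).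
Hypothesis S_derivative2 : forall x t, derivable_pt_lim (S x) t (St x t).
Hypothesis divergence : forall x t, Px x t + St x t = g x t.
Hypothesis g_continuous1 : forall t, continuity (fun x => g x t).
Hypothesis g_continuous2 : forall x, continuity (g x).

Let P_continuous1 t : continuity (fun x => P x t).
Proof. intros x. exact (derivable_pt_lim_continuity_pt _ _ _ (P_derivative1 x t)). Qed.

Let P_continuous2 x : continuity (P x).
Proof. intros t. exact (derivable_pt_lim_continuity_pt _ _ _ (P_derivative2 x t)). Qed.

Let S_continuous1 t : continuity (fun x => S x t).
Proof. intros x. exact (derivable_pt_lim_continuity_pt _ _ _ (S_derivative1 x t)). Qed.

Let S_continuous2 x : continuity (S x).
Proof. intros t. exact (derivable_pt_lim_continuity_pt _ _ _ (S_derivative2 x t)). Qed.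

Let bmeas_P : bmeasurable2 P. Proof. apply (bmeasurable2_separate_continuity P M); assumption. Qed.

Let bmeas_S : bmeasurable2 S. Proof. apply (bmeasurable2_separate_continuity S M); assumption. Qed.

Let bmeas_g : bmeasurable2 g. Proof. apply (bmeasurable2_separate_continuity g M); assumption. Qed.

Local Notation D := (flux_defect P S g).
Local Notation singular := (singular_point P S g).

Lemma flux_defect_of_interior_regular a b c d : a <= b -> c <= d ->
  (forall x t, a < x < b -> c < t < d -> ~ singular x t) -> D a b c d = 0.
Proof.
intros ab cd reg. apply (flux_defect_exhaust1 P S g bmeas_P bmeas_S bmeas_g M); auto.
intros p q ap pq qb. rewrite flux_defect_transpose by exact bmeas_g.
apply (flux_defect_exhaust1 _ _ _ (bmeasurable2_swap S bmeas_S) (bmeasurable2_swap P bmeas_P)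
  (bmeasurable2_swap g bmeas_g) M); unfold transpose; auto.
intros r s cr rs sd. change (flux_defect (transpose S) (transpose P) (transpose g) r s p q = 0).
rewrite <- flux_defect_transpose by exact bmeas_g.
apply flux_defect_of_regular; auto. intros x t hx ht. apply NNPP. apply reg; lra.
Qed.

Lemma flux_defect_shrink a b c d a' b' c' d' :
  a <= a' /\ a' <= b' /\ b' <= b -> c <= c' /\ c' <= d' /\ d' <= d ->
  (forall x t, a <= x <= b -> c <= t <= d -> singular x t -> a' <= x <= b' /\ c' <= t <= d') ->
  D a b c d = D a' b' c' d'.
Proof.
intros hx ht inside.
rewrite (flux_defect_Chasles1 P S g bmeas_P bmeas_S bmeas_g a a' b) by lra.
rewrite (flux_defect_Chasles1 P S g bmeas_P bmeas_S bmeas_g a' b' b) by lra.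
rewrite (flux_defect_Chasles2 P S g bmeas_P bmeas_S bmeas_g a' b' c c' d) by lra.
rewrite (flux_defect_Chasles2 P S g bmeas_P bmeas_S bmeas_g a' b' c' d' d) by lra.
rewrite (flux_defect_of_interior_regular a a'), (flux_defect_of_interior_regular b' b),
  (flux_defect_of_interior_regular a' b' c c'), (flux_defect_of_interior_regular a' b' d' d); try lra;
  intros x t xab tcd sing; destruct (inside x t ltac:(lra) ltac:(lra) sing); lra.
Qed.

Section NearPortion.
Variables (E : R -> R -> Prop) (N a0 b0 c0 d0 : R).
Hypothesis closed_E : closed2 E.
Hypothesis P_slopes1 : forall x t, E x t -> slopes_le N (fun y => P y t) x.
Hypothesis P_slopes2 : forall x t, E x t -> slopes_le N (P x) t.
Hypothesis S_slopes1 : forall x t, E x t -> slopes_le N (fun y => S y t) x.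
Hypothesis S_slopes2 : forall x t, E x t -> slopes_le N (S x) t.
Hypothesis singular_in_E : forall x t, a0 <= x <= b0 -> c0 <= t <= d0 -> singular x t -> E x t.

(* On [E] the partial derivatives satisfy the equation, so only the complement of [E] contributes. *)
Lemma flux_defect_le_outside lam a b c d : a0 <= a -> a <= b -> b <= b0 -> c0 <= c -> c <= d -> d <= d0 ->
  1 <= lam -> d - c <= lam * (b - a) -> b - a <= lam * (d - c) ->
  (exists x t, a <= x <= b /\ c <= t <= d /\ E x t) ->
  Rabs (D a b c d) <= (8 * N * lam + M) * integral2 a b c d (outside E).
Proof.
intros a0a ab bb0 c0c cd dd0 lam1 asp1 asp2 meets.
destruct (closed2_bounding_rectangle E a b c d closed_E ab cd meets)
  as [a' [b' [c' [d' [rx [rt [[ta [tb [tc td]]] inside]]]]]]].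
rewrite (flux_defect_shrink a b c d a' b' c' d' rx rt).
2:{ intros x t hx ht sing. apply inside; auto. apply singular_in_E; auto; lra. }
pose proof (bmeasurable2_outside E closed_E) as bchi.
set (phi := restricted E Px). set (psi := transpose (restricted (transpose E) (transpose St))).
pose proof (bmeasurable2_restricted E P Px N closed_E bmeas_P P_slopes1 (fun x t _ => P_derivative1 x t)) as bphi.
pose proof (bmeasurable2_swap _ (bmeasurable2_restricted (transpose E) (transpose S) (transpose St) N
  (closed2_transpose E closed_E) (bmeasurable2_swap S bmeas_S) (fun t x => S_slopes2 x t)
  (fun t x _ => S_derivative2 x t))) as bpsi.
assert (fluxP : Rabs (integral c' d' (fun t => P b' t - P a' t) - integral2 a' b' c' d' phi)
  <= 4 * N * lam * integral2 a b c d (outside E)).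
{ apply (flux_minus_integral_le E P Px N M); auto. intros x t hx ht Ex. apply (inside x t hx ht Ex). }
assert (fluxS : Rabs (integral a' b' (fun x => S x d' - S x c') - integral2 a' b' c' d' psi)
  <= 4 * N * lam * integral2 a b c d (outside E)).
{ rewrite (integral2_swap a' b' c' d' psi) by exact bpsi. rewrite (integral2_swap a b c d) by exact bchi.
  apply (flux_minus_integral_le (transpose E) (transpose S) (transpose St) N M); unfold transpose; auto.
  - apply closed2_transpose, closed_E.
  - apply bmeasurable2_swap, bmeas_S.
  - intros t x ht hx Ex. apply (inside x t hx ht Ex). }
assert (source : Rabs (integral2 a' b' c' d' (fun x t => phi x t + psi x t - g x t))
  <= M * integral2 a b c d (outside E)).
{ rewrite <- integral2_scal by exact bchi.
  assert (bM : bmeasurable2 (fun x t => M * outside E x t))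
    by (apply bmeasurable2_mult; [apply bmeasurable2_const|exact bchi]).
  assert (M0 : 0 <= M) by (pose proof (P_bounded 0 0); pose proof (Rabs_pos (P 0 0)); lra).
  apply Rle_trans with (integral2 a' b' c' d' (fun x t => M * outside E x t)).
  - apply integral2_Rabs_le; [apply bmeasurable2_minus; [apply bmeasurable2_plus|]; assumption|exact bM|].
    intros x t _ _. unfold phi, psi, transpose. destruct (classic (E x t)) as [h|h].
    + rewrite restricted_in, (restricted_in (fun t x => E x t)), outside_in by exact h.
      rewrite divergence, Rminus_diag, Rabs_R0. lra.
    + rewrite restricted_out, (restricted_out (fun t x => E x t)), outside_out by exact h.
      replace (0 + 0 - g x t) with (- g x t) by ring. rewrite Rabs_Ropp, Rmult_1_r. apply g_bounded.
  - apply integral2_le_subrectangle; try lra; [exact bM|]. intros x t. pose proof (outside_bounds E x t). nra. }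
rewrite integral2_minus, integral2_plus in source; try assumption; [|apply bmeasurable2_plus; assumption].
unfold flux_defect. apply Rabs_le_between in fluxP, fluxS, source. apply Rabs_le. lra.
Qed.

Let weight k x t := outside E x t - blurred_outside E k x t.

Let bmeas_weight k : 0 <= k -> bmeasurable2 (weight k).
Proof.
intros k0. apply bmeasurable2_minus; [apply bmeasurable2_outside, closed_E|apply bmeasurable2_blurred_outside, k0].
Qed.

Lemma outside_le_weight k a b c d : 0 <= k -> k * (b - a + (d - c)) <= / 2 ->
  (exists x t, a <= x <= b /\ c <= t <= d /\ E x t) ->
  forall x t, a <= x <= b -> c <= t <= d -> outside E x t <= 2 * weight k x t.
Proof.
intros k0 small [y [s [hy [hs Ey]]]] x t hx ht. unfold weight.
destruct (classic (E x t)) as [h|h].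
- rewrite outside_in by exact h. unfold blurred_outside.
  rewrite truncated_distance_in by exact h. rewrite Rmult_0_r, Rmin_right by lra. lra.
- rewrite outside_out by exact h.
  pose proof (truncated_distance_le_taxicab E x t y s Ey) as hd.
  assert (Rabs (x - y) <= b - a) by (apply Rabs_le; lra). assert (Rabs (t - s) <= d - c) by (apply Rabs_le; lra).
  assert (k * truncated_distance E x t <= k * (b - a + (d - c))) by (apply Rmult_le_compat_l; lra).
  pose proof (Rmin_r 1 (k * truncated_distance E x t)) as hr. unfold blurred_outside. lra.
Qed.

Lemma weight_ge_0 k x t : 0 <= k -> 0 <= weight k x t.
Proof.
intros k0. unfold weight. destruct (classic (E x t)) as [h|h].
- rewrite outside_in by exact h. unfold blurred_outside. rewrite truncated_distance_in by exact h.
  rewrite Rmult_0_r, Rmin_right; lra.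
- rewrite outside_out by exact h. pose proof (blurred_outside_bounds E k x t k0). lra.
Qed.

Let M_ge_0 : 0 <= M.
Proof. apply Rle_trans with (1 := Rabs_pos (P 0 0)), P_bounded. Qed.

Lemma flux_defect_le_weight_of_small lam k a b c d : 1 <= lam -> 0 <= N -> 0 <= k ->
  k * (b - a + (d - c)) <= / 2 -> a0 <= a -> a <= b -> b <= b0 -> c0 <= c -> c <= d -> d <= d0 ->
  d - c <= lam * (b - a) -> b - a <= lam * (d - c) ->
  Rabs (D a b c d) <= 2 * (8 * N * lam + M) * integral2 a b c d (weight k).
Proof.
intros lam1 N0 k0 small a0a ab bb0 c0c cd dd0 asp1 asp2. assert (K0 : 0 <= 8 * N * lam + M) by nra.
destruct (classic (exists x t, a <= x <= b /\ c <= t <= d /\ E x t)) as [meets|free].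
- apply Rle_trans with ((8 * N * lam + M) * integral2 a b c d (outside E)); [apply flux_defect_le_outside; assumption|].
  rewrite (Rmult_comm 2 (8 * N * lam + M)), (Rmult_assoc _ 2). apply Rmult_le_compat_l; [exact K0|].
  rewrite <- integral2_scal by (apply bmeas_weight, k0). apply integral2_le.
  + apply bmeasurable2_outside, closed_E.
  + apply bmeasurable2_mult; [apply bmeasurable2_const|apply bmeas_weight, k0].
  + apply outside_le_weight; assumption.
- rewrite flux_defect_of_interior_regular, Rabs_R0; try assumption.
  + apply Rmult_le_pos; [lra|]. apply integral2_ge_0; try assumption; [apply bmeas_weight, k0|].
    intros. apply weight_ge_0, k0.
  + intros x t hx ht sing. apply free. exists x, t. repeat split; try lra. apply singular_in_E; auto; lra.
Qed.

(* Bisection: the squares of side [2 ^ - n] that meet [E] lie within that distance of [E]. *)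
Lemma flux_defect_le_weight lam n : 1 <= lam -> 0 <= N -> forall a b c d,
  a0 <= a -> a < b -> b <= b0 -> c0 <= c -> c < d -> d <= d0 ->
  d - c <= lam * (b - a) -> b - a <= lam * (d - c) ->
  Rabs (D a b c d) <= 2 * (8 * N * lam + M) * integral2 a b c d (weight (2 ^ n / (2 * (b - a + (d - c))))).
Proof.
intros lam1 N0. induction n as [|n IH]; intros a b c d a0a ab bb0 c0c cd dd0 asp1 asp2.
- apply flux_defect_le_weight_of_small; try lra; [apply Rdiv_le_0_compat; simpl; lra|]. right. simpl. field. lra.
- set (f := weight (2 ^ Datatypes.S n / (2 * (b - a + (d - c))))).
  assert (bf : bmeasurable2 f) by (apply bmeas_weight, Rdiv_le_0_compat; [apply pow_le|]; lra).
  assert (quarter : forall a' b' c' d', a0 <= a' -> a' < b' -> b' <= b0 -> c0 <= c' -> c' < d' -> d' <= d0 ->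
    b' - a' = (b - a) / 2 -> d' - c' = (d - c) / 2 ->
    Rabs (D a' b' c' d') <= 2 * (8 * N * lam + M) * integral2 a' b' c' d' f).
  { intros a' b' c' d' a0a' ab' bb0' c0c' cd' dd0' width height.
    replace f with (weight (2 ^ n / (2 * (b' - a' + (d' - c'))))).
    - apply IH; auto; rewrite width, height; lra.
    - unfold f. f_equal. rewrite width, height. simpl. field. lra. }
  assert (exists m s, m = (a + b) / 2 /\ s = (c + d) / 2) as [m [s [em es]]] by eauto.
  rewrite (flux_defect_quarters P S g bmeas_P bmeas_S bmeas_g a m b c s d) by lra.
  rewrite (integral2_quarters a m b c s d f) by (assumption || lra).
  pose proof (quarter a m c s ltac:(lra) ltac:(lra) ltac:(lra)) as sw.
  pose proof (quarter a m s d ltac:(lra) ltac:(lra) ltac:(lra)) as nw.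
  pose proof (quarter m b c s ltac:(lra) ltac:(lra) ltac:(lra)) as se.
  pose proof (quarter m b s d ltac:(lra) ltac:(lra) ltac:(lra)) as ne.
  specialize (sw ltac:(lra) ltac:(lra) ltac:(lra) ltac:(lra) ltac:(lra)).
  specialize (nw ltac:(lra) ltac:(lra) ltac:(lra) ltac:(lra) ltac:(lra)).
  specialize (se ltac:(lra) ltac:(lra) ltac:(lra) ltac:(lra) ltac:(lra)).
  specialize (ne ltac:(lra) ltac:(lra) ltac:(lra) ltac:(lra) ltac:(lra)).
  apply Rabs_le_between in sw, nw, se, ne. apply Rabs_le. lra.
Qed.

Lemma flux_defect_near_portion a b c d : 0 <= N -> a0 <= a -> a <= b -> b <= b0 -> c0 <= c -> c <= d -> d <= d0 ->
  D a b c d = 0.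
Proof.
intros N0 a0a ab bb0 c0c cd dd0.
destruct (Req_dec a b) as [->|nab]; [apply flux_defect_flat1; assumption|].
destruct (Req_dec c d) as [->|ncd]; [apply flux_defect_flat2; assumption|].
set (lam := 1 + (d - c) / (b - a) + (b - a) / (d - c)).
assert (p1 : 0 < (d - c) / (b - a)) by (apply Rdiv_lt_0_compat; lra).
assert (p2 : 0 < (b - a) / (d - c)) by (apply Rdiv_lt_0_compat; lra).
assert (asp1 : d - c <= lam * (b - a)) by (apply Rle_div_l; [lra|]; unfold lam; lra).
assert (asp2 : b - a <= lam * (d - c)) by (apply Rle_div_l; [lra|]; unfold lam; lra).
set (k n := 2 ^ n / (2 * (b - a + (d - c)))).
assert (k0 : forall n, 0 <= k n) by (intros n; apply Rdiv_le_0_compat; [apply pow_le|]; lra).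
assert (lim : Un_cv (fun n => integral2 a b c d (weight (k n))) 0).
{ replace 0 with (integral2 a b c d (fun _ _ => 0)) by (rewrite integral2_const by lra; ring).
  apply (integral2_lim a b c d (fun n => weight (k n)) _ 1);
    [lra|intros; apply bmeas_weight, k0|apply bmeasurable2_const| |].
  - intros n x t. pose proof (weight_ge_0 (k n) x t (k0 n)). pose proof (outside_bounds E x t).
    pose proof (blurred_outside_bounds E (k n) x t (k0 n)). unfold weight in *. apply Rabs_le. lra.
  - intros x t. rewrite <- (Rminus_diag (outside E x t)). apply CV_minus; [apply Un_cv_const|].
    apply blurred_outside_lim; [exact closed_E|]. apply cv_infty_pow_2_div. lra. }
apply Rabs_eq_0, Rle_antisym; [|apply Rabs_pos].
apply (@Rle_cv_lim (fun _ => Rabs (D a b c d)) (fun n => 2 * (8 * N * lam + M) * integral2 a b c d (weight (k n)))).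
- intros n. apply flux_defect_le_weight; auto; try lra. unfold lam. lra.
- apply Un_cv_const.
- rewrite <- (Rmult_0_r (2 * (8 * N * lam + M))). apply Un_cv_scal, lim.
Qed.
End NearPortion.

Theorem divergence_theorem a b c d : a <= b -> c <= d -> flux_defect P S g a b c d = 0.
Proof.
intros ab cd. apply flux_defect_of_regular; try assumption. intros x0 t0 _ _. apply NNPP. intros sing.
set (A n x t := (slopes_le (INR n) (fun y => P y t) x /\ slopes_le (INR n) (P x) t) /\
                (slopes_le (INR n) (fun y => S y t) x /\ slopes_le (INR n) (S x) t)).
destruct (closed2_baire singular A) as [n [x [t [rho [r0 [sing_x portion]]]]]].
- apply closed2_singular_point.
- intros n. apply closed2_and; apply closed2_and.
  + apply closed2_slopes_le; assumption.
  + apply (closed2_transpose (fun t x => slopes_le (INR n) (P x) t)).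
    apply (closed2_slopes_le (transpose P) (INR n)); assumption.
  + apply closed2_slopes_le; assumption.
  + apply (closed2_transpose (fun t x => slopes_le (INR n) (S x) t)).
    apply (closed2_slopes_le (transpose S) (INR n)); assumption.
- intros x t _.
  destruct (slopes_le_of_derivative (fun y => P y t) x (Px x t) M) as [nP1 P_slopes_x]; auto.
  destruct (slopes_le_of_derivative (P x) t (Pt x t) M) as [nP2 P_slopes_t]; auto.
  destruct (slopes_le_of_derivative (fun y => S y t) x (Sx x t) M) as [nS1 S_slopes_x]; auto.
  destruct (slopes_le_of_derivative (S x) t (St x t) M) as [nS2 S_slopes_t]; auto.
  exists (nP1 + nP2 + nS1 + nS2)%nat.
  split; split; [apply P_slopes_x|apply P_slopes_t|apply S_slopes_x|apply S_slopes_t]; lia.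
- exists x0, t0. exact sing.
- apply sing_x. exists rho. split; [exact r0|]. intros.
  apply (flux_defect_near_portion (fun y s => singular y s /\ (Rabs (y - x) <= rho /\ Rabs (s - t) <= rho))
    (INR n) (x - rho) (x + rho) (t - rho) (t + rho)); try assumption.
  + apply closed2_and; [apply closed2_singular_point|apply closed2_square].
  + intros y s [sy [hy hs]]. apply (portion y s sy hy hs).
  + intros y s [sy [hy hs]]. apply (portion y s sy hy hs).
  + intros y s [sy [hy hs]]. apply (portion y s sy hy hs).
  + intros y s [sy [hy hs]]. apply (portion y s sy hy hs).
  + intros y s hy hs sy. split; [exact sy|]. split; apply Rabs_le; lra.
  + apply pos_INR.
Qed.
End DivergenceTheorem.

(** * Finite sums over integers *)

Fixpoint Rsum (l : list Z) (f : Z -> R) : R := match l with nil => 0 | k :: l => f k + Rsum l f end.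

Lemma Rsum_ext l f g : (forall k, In k l -> f k = g k) -> Rsum l f = Rsum l g.
Proof.
induction l as [|k l IH]; simpl; intros e; [reflexivity|]. rewrite e, IH by auto. reflexivity.
Qed.

Lemma Rsum_plus l f g : Rsum l (fun k => f k + g k) = Rsum l f + Rsum l g.
Proof. induction l as [|k l IH]; simpl; [|rewrite IH]; ring. Qed.

Lemma Rsum_scal l c f : Rsum l (fun k => c * f k) = c * Rsum l f.
Proof. induction l as [|k l IH]; simpl; [|rewrite IH]; ring. Qed.

Lemma Rsum_0 l : Rsum l (fun _ => 0) = 0.
Proof. induction l as [|k l IH]; simpl; [|rewrite IH]; ring. Qed.

Lemma Rsum_le l f g : (forall k, In k l -> f k <= g k) -> Rsum l f <= Rsum l g.
Proof.
induction l as [|k l IH]; simpl; intros fg; [lra|].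
apply Rplus_le_compat; [apply fg; left; reflexivity|apply IH; auto].
Qed.

Lemma Rsum_ge_0 l f : (forall k, In k l -> 0 <= f k) -> 0 <= Rsum l f.
Proof. intros f0. rewrite <- (Rsum_0 l). apply Rsum_le, f0. Qed.

Lemma Rsum_exchange l l' f : Rsum l (fun k => Rsum l' (fun j => f k j)) = Rsum l' (fun j => Rsum l (fun k => f k j)).
Proof. induction l as [|k l IH]; simpl; [rewrite Rsum_0|rewrite IH, <- Rsum_plus]; reflexivity. Qed.

Lemma Rsum_app l l' f : Rsum (l ++ l') f = Rsum l f + Rsum l' f.
Proof. induction l as [|k l IH]; simpl; [|rewrite IH]; ring. Qed.

Lemma Rsum_Permutation l l' f : Permutation l l' -> Rsum l f = Rsum l' f.
Proof. induction 1; simpl; lra. Qed.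

Lemma Rsum_map l g f : Rsum (map g l) f = Rsum l (fun k => f (g k)).
Proof. induction l as [|k l IH]; simpl; [|rewrite IH]; reflexivity. Qed.

Lemma Rsum_filter p l f : Rsum l f = Rsum (filter p l) f + Rsum (filter (fun k => negb (p k)) l) f.
Proof. induction l as [|k l IH]; simpl; [ring|]. rewrite IH. destruct (p k); simpl; ring. Qed.

Definition mem l (k : Z) : bool := if in_dec Z.eq_dec k l then true else false.

Lemma mem_In l k : mem l k = true <-> In k l.
Proof. unfold mem. destruct in_dec; split; auto; discriminate. Qed.

Definition list_diff l' l : list Z := filter (fun k => negb (mem l k)) l'.

Lemma In_list_diff l' l k : In k (list_diff l' l) <-> In k l' /\ ~ In k l.
Proof.
unfold list_diff. rewrite filter_In, <- (mem_In l k). destruct (mem l k); simpl; intuition discriminate.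
Qed.

Lemma Rsum_incl_split l l' f : NoDup l -> NoDup l' -> incl l l' -> Rsum l' f = Rsum l f + Rsum (list_diff l' l) f.
Proof.
intros nl nl' ll'. rewrite (Rsum_filter (mem l) l'). f_equal. apply Rsum_Permutation, NoDup_Permutation.
- apply NoDup_filter, nl'.
- exact nl.
- intros k. rewrite filter_In, mem_In. split; [tauto|]. intros h. split; [apply ll', h|exact h].
Qed.

Lemma Rsum_incl_le l l' f : NoDup l -> NoDup l' -> incl l l' -> (forall k, 0 <= f k) -> Rsum l f <= Rsum l' f.
Proof.
intros nl nl' ll' f0. rewrite (Rsum_incl_split l l' f nl nl' ll').
pose proof (Rsum_ge_0 (list_diff l' l) f (fun k _ => f0 k)). lra.
Qed.

Lemma Rsum_In_le l f k : (forall j, In j l -> 0 <= f j) -> In k l -> f k <= Rsum l f.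
Proof.
induction l as [|j l IH]; simpl; intros f0 hk; [contradiction|]. destruct hk as [->|hk].
- pose proof (Rsum_ge_0 l f (fun i hi => f0 i (or_intror hi))). lra.
- pose proof (f0 j (or_introl eq_refl)). specialize (IH (fun i hi => f0 i (or_intror hi)) hk). lra.
Qed.

Fixpoint Zball (n : nat) : list Z :=
  match n with O => [0%Z] | S m => Z.of_nat n :: (- Z.of_nat n)%Z :: Zball m end.

Lemma In_Zball n k : In k (Zball n) <-> (Z.abs k <= Z.of_nat n)%Z.
Proof. induction n as [|n IH]; cbn [Zball In]; [lia|]. rewrite IH. lia. Qed.

Lemma NoDup_Zball n : NoDup (Zball n).
Proof.
induction n as [|n IH]; cbn [Zball]; repeat constructor; try assumption; cbn [In]; rewrite ?In_Zball; lia.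
Qed.

Lemma incl_Zball l : exists n, forall m, (n <= m)%nat -> incl l (Zball m).
Proof.
induction l as [|k l [n IH]]; [exists 0%nat; intros m _ k []|]. exists (n + Z.abs_nat k)%nat. intros m le j [->|hj].
- apply In_Zball. lia.
- apply (IH m); [lia|exact hj].
Qed.

Lemma Rsum_Zball_opp n f : Rsum (Zball n) (fun k => f (- k)%Z) = Rsum (Zball n) f.
Proof. induction n as [|n IH]; cbn [Zball Rsum]; [|rewrite IH, Z.opp_involutive]; [reflexivity|ring]. Qed.

Lemma Rsum_Zball_1 n : Rsum (Zball n) (fun _ => 1) = 2 * INR n + 1.
Proof. induction n as [|n IH]; cbn [Zball Rsum]; [simpl; ring|]. rewrite IH, S_INR. ring. Qed.

Definition decay (k : Z) : R := / (1 + IZR k * IZR k).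

Lemma decay_gt_0 k : 0 < decay k.
Proof. apply Rinv_0_lt_compat. nra. Qed.

Lemma decay_le_telescoping n s : (1 <= n)%nat -> Rabs (IZR s) = INR n + 1 -> decay s <= / INR n - / (INR n + 1).
Proof.
intros n1 hs. apply (le_INR 1) in n1. simpl in n1.
replace (/ INR n - / (INR n + 1)) with (/ (INR n * (INR n + 1))) by (field; lra).
apply Rinv_le_contravar; [nra|]. pose proof (Rsqr_abs (IZR s)) as h. unfold Rsqr in h. rewrite h, hs. nra.
Qed.

Lemma Rsum_Zball_decay T m : (1 <= T)%nat ->
  Rsum (Zball (m + T)) decay <= Rsum (Zball T) decay + 2 * (/ INR T - / INR (m + T)).
Proof.
intros T1. induction m as [|m IH]; simpl plus; [lra|]. cbn [Zball Rsum]. rewrite S_INR.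
assert (e : IZR (Z.of_nat (S (m + T))) = INR (m + T) + 1) by (rewrite <- S_INR, INR_IZR_INZ; reflexivity).
pose proof (pos_INR (m + T)).
pose proof (decay_le_telescoping (m + T) (Z.of_nat (S (m + T))) ltac:(lia)) as decay_pos.
pose proof (decay_le_telescoping (m + T) (- Z.of_nat (S (m + T))) ltac:(lia)) as decay_neg.
rewrite opp_IZR, Rabs_Ropp, e, Rabs_right in decay_neg by lra. rewrite e, Rabs_right in decay_pos by lra.
specialize (decay_pos eq_refl). specialize (decay_neg eq_refl). lra.
Qed.

Lemma Rsum_decay_tail T l : (1 <= T)%nat -> NoDup l -> (forall k, In k l -> (Z.of_nat T < Z.abs k)%Z) ->
  Rsum l decay <= 2 / INR T.
Proof.
intros T1 nl far. destruct (incl_Zball l) as [n hn].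
pose proof (Rsum_Zball_decay T n T1) as h.
rewrite (Rsum_incl_split (Zball T) (Zball (n + T))) in h; [|apply NoDup_Zball|apply NoDup_Zball|].
2:{ intros k hk. apply In_Zball in hk. apply In_Zball. lia. }
assert (sub : Rsum l decay <= Rsum (list_diff (Zball (n + T)) (Zball T)) decay).
{ apply Rsum_incl_le; [exact nl|apply NoDup_filter, NoDup_Zball| |intros k; left; apply decay_gt_0].
  intros k hk. apply In_list_diff. split; [apply (hn (n + T)%nat); [lia|exact hk]|].
  intros b. apply In_Zball in b. specialize (far k hk). lia. }
assert (0 < / INR (n + T)) by (apply Rinv_0_lt_compat, lt_0_INR; lia). unfold Rdiv. lra.
Qed.

Lemma Rsum_decay_le l : NoDup l -> Rsum l decay <= 4.
Proof.
intros nl. rewrite (Rsum_filter (mem (Zball 1)) l).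
assert (near : Rsum (filter (mem (Zball 1)) l) decay <= Rsum (Zball 1) decay).
{ apply Rsum_incl_le; [apply NoDup_filter, nl|apply NoDup_Zball| |intros k; left; apply decay_gt_0].
  intros k hk. apply filter_In in hk. apply mem_In, hk. }
assert (far : Rsum (filter (fun k => negb (mem (Zball 1) k)) l) decay <= 2 / INR 1).
{ apply Rsum_decay_tail; [lia|apply NoDup_filter, nl|]. intros k hk. apply In_list_diff in hk.
  rewrite In_Zball in hk. lia. }
assert (ball : Rsum (Zball 1) decay = 2) by (unfold decay; simpl; field). change (INR 1) with 1 in far. lra.
Qed.

Definition Csum l (f : Z -> C) : C := (Rsum l (fun k => fst (f k)), Rsum l (fun k => snd (f k))).

Lemma Csum_cons k l f : Csum (k :: l) f = (f k + Csum l f)%C.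
Proof. reflexivity. Qed.

Lemma Csum_ext l f g : (forall k, In k l -> f k = g k) -> Csum l f = Csum l g.
Proof. intros e. unfold Csum. f_equal; apply Rsum_ext; intros k hk; rewrite e by exact hk; reflexivity. Qed.

Lemma Csum_scal l c f : Csum l (fun k => c * f k)%C = (c * Csum l f)%C.
Proof.
induction l as [|k l IH]; [apply injective_projections; simpl; ring|]. rewrite !Csum_cons, IH. ring.
Qed.

Lemma Csum_incl_split l l' f : NoDup l -> NoDup l' -> incl l l' -> Csum l' f = (Csum l f + Csum (list_diff l' l) f)%C.
Proof. intros nl nl' ll'. unfold Csum. rewrite !(Rsum_incl_split l l') by assumption. reflexivity. Qed.

Lemma Csum_map l g f : Csum (map g l) f = Csum l (fun k => f (g k)).
Proof. unfold Csum. rewrite !Rsum_map. reflexivity. Qed.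

Lemma Csum_Zball_opp n f : Csum (Zball n) (fun k => f (- k)%Z) = Csum (Zball n) f.
Proof.
unfold Csum. rewrite (Rsum_Zball_opp n (fun k => fst (f k))), (Rsum_Zball_opp n (fun k => snd (f k))). reflexivity.
Qed.

Lemma Cmod_Csum_le l f : Cmod (Csum l f) <= Rsum l (fun k => Cmod (f k)).
Proof.
induction l as [|k l IH]; [change (Csum [] f) with (RtoC 0); rewrite Cmod_0; apply Rle_refl|].
rewrite Csum_cons. apply Rle_trans with (1 := Cmod_triangle _ _). simpl. lra.
Qed.

(** * Complex-valued functions of a real variable *)

Definition sqnorm (z : C) : R := fst z * fst z + snd z * snd z.

Lemma sqnorm_ge_0 z : 0 <= sqnorm z.
Proof. unfold sqnorm. nra. Qed.

Lemma sqnorm_Cmod z : sqnorm z = Cmod z * Cmod z.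
Proof. unfold Cmod. rewrite sqrt_sqrt by nra. unfold sqnorm. ring. Qed.

Lemma sqnorm_eq_0 z : sqnorm z = 0 -> z = 0%C.
Proof. intros h. apply Cmod_eq_0, Rsqr_0_uniq. unfold Rsqr. rewrite <- sqnorm_Cmod. exact h. Qed.

Lemma Cmod_le_of_components z M : Rabs (fst z) <= M -> Rabs (snd z) <= M -> Cmod z <= 2 * M.
Proof.
intros re_le im_le. apply Rabs_le_between in re_le, im_le.
apply Rsqr_incr_0_var; [|lra]. unfold Rsqr. rewrite <- sqnorm_Cmod. unfold sqnorm. nra.
Qed.

Lemma Rabs_fst_le_Cmod z : Rabs (fst z) <= Cmod z.
Proof. exact (re_le_Cmod z). Qed.

Lemma Rabs_snd_le_Cmod z : Rabs (snd z) <= Cmod z.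
Proof. exact (Rle_trans _ _ _ (Rmax_r _ _) (Rmax_Cmod z)). Qed.

Lemma Cderiv_at_ext f g x d : (forall s, f s = g s) -> Cderiv_at f x d -> Cderiv_at g x d.
Proof. intros e. replace g with f; [tauto|]. extensionality s. apply e. Qed.

Lemma Cderiv_at_const z x : Cderiv_at (fun _ => z) x (RtoC 0).
Proof. split; apply derivable_pt_lim_const. Qed.

Lemma Cderiv_at_plus f g x d d' : Cderiv_at f x d -> Cderiv_at g x d' ->
  Cderiv_at (fun s => f s + g s)%C x (d + d')%C.
Proof. intros [f1 f2] [g1 g2]. split; apply derivable_pt_lim_plus; assumption. Qed.

Lemma Cderiv_at_mult f g x d d' : Cderiv_at f x d -> Cderiv_at g x d' ->
  Cderiv_at (fun s => f s * g s)%C x (d * g x + f x * d')%C.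
Proof.
intros [f1 f2] [g1 g2]. split; simpl.
- apply (derivable_pt_lim_eq _ _ (fst d * fst (g x) + fst (f x) * fst d' - (snd d * snd (g x) + snd (f x) * snd d')));
    [ring|].
  apply (derivable_pt_lim_minus (fun s => fst (f s) * fst (g s)) (fun s => snd (f s) * snd (g s)));
    apply (derivable_pt_lim_mult (fun s => _ (f s)) (fun s => _ (g s))); assumption.
- apply (derivable_pt_lim_eq _ _ (fst d * snd (g x) + fst (f x) * snd d' + (snd d * fst (g x) + snd (f x) * fst d')));
    [ring|].
  apply (derivable_pt_lim_plus (fun s => fst (f s) * snd (g s)) (fun s => snd (f s) * fst (g s)));
    apply (derivable_pt_lim_mult (fun s => _ (f s)) (fun s => _ (g s))); assumption.
Qed.

Lemma Cderiv_at_scal z f x d : Cderiv_at f x d -> Cderiv_at (fun s => z * f s)%C x (z * d)%C.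
Proof.
intros df. replace (z * d)%C with (0 * f x + z * d)%C by ring.
apply (Cderiv_at_mult (fun _ => z)); [apply Cderiv_at_const|exact df].
Qed.

Lemma Cderiv_at_scal_r f z x d : Cderiv_at f x d -> Cderiv_at (fun s => f s * z)%C x (d * z)%C.
Proof.
intros df. replace (d * z)%C with (d * z + f x * 0)%C by ring.
apply (Cderiv_at_mult f (fun _ => z)); [exact df|apply Cderiv_at_const].
Qed.

Lemma Cderiv_at_conj f x d : Cderiv_at f x d -> Cderiv_at (fun s => Cconj (f s)) x (Cconj d).
Proof. intros [f1 f2]. split; [exact f1|]. apply (derivable_pt_lim_opp (fun s => snd (f s))), f2. Qed.

Lemma Cderiv_at_comp h f x k d : derivable_pt_lim h x k -> Cderiv_at f (h x) d ->
  Cderiv_at (fun s => f (h s)) x (RtoC k * d)%C.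
Proof.
intros dh [f1 f2]. split; simpl.
- apply (derivable_pt_lim_eq _ _ (fst d * k)); [ring|].
  apply (derivable_pt_lim_comp h (fun s => fst (f s))); assumption.
- apply (derivable_pt_lim_eq _ _ (snd d * k)); [ring|].
  apply (derivable_pt_lim_comp h (fun s => snd (f s))); assumption.
Qed.

Lemma Cderiv_at_shift f h x d : Cderiv_at f (x + h) d -> Cderiv_at (fun s => f (s + h)) x d.
Proof.
intros df. replace d with (RtoC 1 * d)%C by apply Cmult_1_l. apply (Cderiv_at_comp (fun s => s + h) f); [|exact df].
apply (derivable_pt_lim_eq _ _ (1 + 0)); [ring|].
apply derivable_pt_lim_plus; [apply derivable_pt_lim_id|apply derivable_pt_lim_const].
Qed.

Lemma Cderiv_at_reflect f x d : Cderiv_at f (- x) d -> Cderiv_at (fun s => f (- s)) x (RtoC (-1) * d)%C.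
Proof. apply (Cderiv_at_comp Ropp), (derivable_pt_lim_opp id), derivable_pt_lim_id. Qed.

Lemma Cderiv_at_unique f x d d' : Cderiv_at f x d -> Cderiv_at f x d' -> d = d'.
Proof. intros [f1 f2] [g1 g2]. apply injective_projections; eapply uniqueness_limite; eassumption. Qed.

Lemma Cderiv_at_0_const f : (forall x, Cderiv_at f x (RtoC 0)) -> forall x y, f x = f y.
Proof.
intros df x y. apply injective_projections.
- apply (derivable_pt_lim_0_const (fun s => fst (f s))). intros s. apply (df s).
- apply (derivable_pt_lim_0_const (fun s => snd (f s))). intros s. apply (df s).
Qed.

Lemma derivable_pt_lim_sqnorm f x d : Cderiv_at f x d ->
  derivable_pt_lim (fun s => sqnorm (f s)) x (2 * fst (Cconj (f x) * d)%C).
Proof.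
intros [f1 f2]. unfold sqnorm.
apply (derivable_pt_lim_eq _ _ (fst d * fst (f x) + fst (f x) * fst d + (snd d * snd (f x) + snd (f x) * snd d)));
  [simpl; ring|].
apply (derivable_pt_lim_plus (fun s => fst (f s) * fst (f s)) (fun s => snd (f s) * snd (f s)));
  apply (derivable_pt_lim_mult (fun s => _ (f s)) (fun s => _ (f s))); assumption.
Qed.

Lemma Cderiv_at_Ccontinuous f f' : (forall x, Cderiv_at f x (f' x)) -> Ccontinuous f.
Proof. intros df. split; intros x; eapply derivable_pt_lim_continuity_pt; apply (df x). Qed.

Lemma Ccontinuous_const z : Ccontinuous (fun _ => z).
Proof. split; apply continuity_const; intros x y; reflexivity. Qed.

Lemma Ccontinuous_plus f g : Ccontinuous f -> Ccontinuous g -> Ccontinuous (fun x => f x + g x)%C.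
Proof. intros [f1 f2] [g1 g2]. split; apply (continuity_plus (fun x => _ (f x)) (fun x => _ (g x))); assumption. Qed.

Lemma Ccontinuous_mult f g : Ccontinuous f -> Ccontinuous g -> Ccontinuous (fun x => f x * g x)%C.
Proof.
intros [f1 f2] [g1 g2]. split; simpl.
- apply (continuity_minus (fun x => fst (f x) * fst (g x)) (fun x => snd (f x) * snd (g x)));
    apply (continuity_mult (fun x => _ (f x)) (fun x => _ (g x))); assumption.
- apply (continuity_plus (fun x => fst (f x) * snd (g x)) (fun x => snd (f x) * fst (g x)));
    apply (continuity_mult (fun x => _ (f x)) (fun x => _ (g x))); assumption.
Qed.

Lemma Ccontinuous_conj f : Ccontinuous f -> Ccontinuous (fun x => Cconj (f x)).
Proof. intros [f1 f2]. split; [exact f1|]. apply (continuity_opp (fun x => snd (f x))), f2. Qed.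

Definition Cbmeasurable (f : R -> C) : Prop := bmeasurable (fun x => fst (f x)) /\ bmeasurable (fun x => snd (f x)).

Lemma Cbmeasurable_const z : Cbmeasurable (fun _ => z).
Proof. split; apply bmeasurable_const. Qed.

Lemma Cbmeasurable_plus f g : Cbmeasurable f -> Cbmeasurable g -> Cbmeasurable (fun x => f x + g x)%C.
Proof. intros [f1 f2] [g1 g2]. split; simpl; bmeas. Qed.

Lemma Cbmeasurable_minus f g : Cbmeasurable f -> Cbmeasurable g -> Cbmeasurable (fun x => f x - g x)%C.
Proof. intros [f1 f2] [g1 g2]. split; [apply (bmeasurable_minus _ _ f1 g1)|apply (bmeasurable_minus _ _ f2 g2)]. Qed.

Lemma Cbmeasurable_mult f g : Cbmeasurable f -> Cbmeasurable g -> Cbmeasurable (fun x => f x * g x)%C.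
Proof. intros [f1 f2] [g1 g2]. split; simpl; bmeas. Qed.

Lemma Cbmeasurable_conj f : Cbmeasurable f -> Cbmeasurable (fun x => Cconj (f x)).
Proof. intros [f1 f2]. split; simpl; bmeas. Qed.

Lemma Cbmeasurable_continuous f M : Ccontinuous f -> (forall x, Cmod (f x) <= M) -> Cbmeasurable f.
Proof.
intros [f1 f2] fM. split; apply (bmeasurable_continuity _ M); try assumption; intros x; eapply Rle_trans; try apply fM.
- apply Rabs_fst_le_Cmod.
- apply Rabs_snd_le_Cmod.
Qed.

Lemma bmeasurable_sqnorm f : Cbmeasurable f -> bmeasurable (fun x => sqnorm (f x)).
Proof. intros [f1 f2]. unfold sqnorm. bmeas. Qed.

Lemma Cbmeasurable_Csum l (f : Z -> R -> C) : (forall k, Cbmeasurable (f k)) ->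
  Cbmeasurable (fun x => Csum l (fun k => f k x)).
Proof.
intros bf. induction l as [|k l IH]; [apply (Cbmeasurable_const 0%C)|].
apply (Cbmeasurable_plus (f k) (fun x => Csum l (fun k => f k x))); [apply bf|exact IH].
Qed.

Definition Cintegral a b (f : R -> C) : C := (integral a b (fun x => fst (f x)), integral a b (fun x => snd (f x))).

Lemma Cintegral_ext a b f g : (forall x, f x = g x) -> Cintegral a b f = Cintegral a b g.
Proof. intros e. unfold Cintegral. f_equal; apply integral_ext; intros x; rewrite e; reflexivity. Qed.

Lemma Cintegral_plus a b f g : Cbmeasurable f -> Cbmeasurable g ->
  Cintegral a b (fun x => f x + g x)%C = (Cintegral a b f + Cintegral a b g)%C.
Proof. intros [f1 f2] [g1 g2]. apply injective_projections; apply integral_plus; assumption. Qed.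

Lemma Cintegral_scal a b z f : Cbmeasurable f -> Cintegral a b (fun x => z * f x)%C = (z * Cintegral a b f)%C.
Proof.
intros [f1 f2]. apply injective_projections; simpl.
- rewrite integral_minus, !integral_scal by bmeas. reflexivity.
- rewrite integral_plus, !integral_scal by bmeas. reflexivity.
Qed.

Lemma Cintegral_conj a b f : Cbmeasurable f -> Cintegral a b (fun x => Cconj (f x)) = Cconj (Cintegral a b f).
Proof.
intros [f1 f2]. apply injective_projections; [reflexivity|]. simpl.
rewrite (integral_ext a b _ (fun x => -1 * snd (f x))), integral_scal by (bmeas || (intros; ring)). ring.
Qed.

Lemma Cintegral_const a b z : a <= b -> Cintegral a b (fun _ => z) = (RtoC (b - a) * z)%C.
Proof. intros ab. unfold Cintegral. rewrite !integral_const by exact ab. apply injective_projections; simpl; ring. Qed.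

(* Multiplying by the conjugate of the integral reduces the bound to real integrals. *)
Lemma Cmod_Cintegral_le a b f M : Cbmeasurable f -> a <= b -> (forall x, a <= x <= b -> Cmod (f x) <= M) ->
  Cmod (Cintegral a b f) <= M * (b - a).
Proof.
intros bf ab fM. set (z := Cintegral a b f).
assert (M0 : 0 <= M) by (pose proof (fM a ltac:(lra)); pose proof (Cmod_ge_0 (f a)); lra).
assert (h : Cmod z * Cmod z <= Cmod z * (M * (b - a))).
{ rewrite <- sqnorm_Cmod. replace (sqnorm z) with (fst (Cconj z * z)%C) by (unfold sqnorm; simpl; ring).
  unfold z at 2. rewrite <- Cintegral_scal by exact bf. apply Rle_trans with (1 := Rle_abs _).
  rewrite <- Rmult_assoc. apply integral_Rabs_le_const; [|exact ab|].
  - apply (Cbmeasurable_mult (fun _ => Cconj z) f); [apply Cbmeasurable_const|exact bf].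
  - intros x hx. apply Rle_trans with (1 := Rabs_fst_le_Cmod _). rewrite Cmod_mult, Cmod_conj.
    apply Rmult_le_compat_l; [apply Cmod_ge_0|apply fM, hx]. }
destruct (Cmod_ge_0 z) as [z0|z0].
- apply Rmult_le_reg_l with (Cmod z); assumption.
- rewrite <- z0. apply Rmult_le_pos; lra.
Qed.

Lemma Cintegral_FTC f F a b : Cbmeasurable f -> Ccontinuous f -> a <= b -> (forall x, Cderiv_at F x (f x)) ->
  Cintegral a b f = (F b - F a)%C.
Proof.
intros [b1 b2] [c1 c2] ab dF. apply injective_projections.
- exact (integral_FTC _ (fun x => fst (F x)) a b b1 c1 ab (fun x => proj1 (dF x))).
- exact (integral_FTC _ (fun x => snd (F x)) a b b2 c2 ab (fun x => proj2 (dF x))).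
Qed.

(** * Fourier series *)

Definition cis x : C := (cos x, sin x).

Lemma cis_0 : cis 0 = RtoC 1.
Proof. unfold cis. rewrite cos_0, sin_0. reflexivity. Qed.

Lemma cis_plus x y : cis (x + y) = (cis x * cis y)%C.
Proof. apply injective_projections; simpl; [apply cos_plus|]. rewrite sin_plus. ring. Qed.

Lemma cis_opp x : cis (- x) = Cconj (cis x).
Proof. unfold cis, Cconj. simpl. rewrite cos_neg, sin_neg. reflexivity. Qed.

Lemma sqnorm_cis x : sqnorm (cis x) = 1.
Proof. unfold sqnorm. simpl. pose proof (sin2_cos2 x) as h. unfold Rsqr in h. lra. Qed.

Lemma Cmod_cis x : Cmod (cis x) = 1.
Proof. unfold Cmod. rewrite <- sqrt_1, <- (sqnorm_cis x). f_equal. unfold sqnorm. ring. Qed.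

Lemma Cderiv_at_cis x : Cderiv_at cis x (Ci * cis x)%C.
Proof.
split; simpl.
- apply (derivable_pt_lim_eq _ _ (- sin x)); [ring|]. apply derivable_pt_lim_cos.
- apply (derivable_pt_lim_eq _ _ (cos x)); [ring|]. apply derivable_pt_lim_sin.
Qed.

Lemma periodic_cis : periodic cis.
Proof. intros x. rewrite cis_plus. unfold cis at 2. rewrite cos_2PI, sin_2PI. apply Cmult_1_r. Qed.

Lemma mult_cos_le_sin x : 0 <= x -> x <= PI / 2 -> x * cos x <= sin x.
Proof.
intros [x0|<-] xpi; [|rewrite sin_0; lra]. pose proof PI_RGT_0.
destruct (MVT_cor2 sin cos 0 x x0 (fun c _ => derivable_pt_lim_sin c)) as [c [e hc]]. rewrite sin_0 in e.
assert (cos x <= cos c) by (apply cos_decr_1; lra). nra.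
Qed.

Lemma Cmod_cis_minus_1_ge x : Rabs x <= PI -> Rabs x / 2 <= Cmod (cis x - 1)%C.
Proof.
intros hx. set (y := Rabs x / 4). pose proof (Rabs_pos x).
assert (y_small : cos y * cos y >= / 2).
{ pose proof (cos_2a_cos y). assert (0 <= cos (2 * y)) by (apply cos_ge_0; unfold y; lra). lra. }
assert (hs : y <= sin (2 * y)).
{ rewrite sin_2a. pose proof (mult_cos_le_sin y ltac:(unfold y; lra) ltac:(unfold y; lra)) as circle.
  assert (0 <= cos y) by (apply cos_ge_0; unfold y; lra). assert (0 <= y) by (unfold y; lra). nra. }
assert (hc : cos x = cos (2 * (2 * y))).
{ replace (2 * (2 * y)) with (Rabs x) by (unfold y; field). unfold Rabs.
  destruct Rcase_abs; rewrite ?cos_neg; reflexivity. }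
assert (e : sqnorm (cis x - 1)%C = (2 * sin (2 * y)) * (2 * sin (2 * y))).
{ pose proof (sqnorm_cis x) as circle. pose proof (cos_2a_sin (2 * y)) as double_angle. rewrite <- hc in double_angle.
  unfold sqnorm in *. simpl in *. nra. }
apply Rle_trans with (2 * sin (2 * y)); [unfold y in *; lra|].
apply Rsqr_incr_0_var; [|apply Cmod_ge_0]. unfold Rsqr. rewrite <- sqnorm_Cmod, e. apply Rle_refl.
Qed.

Section Periodicity.
Variables (T : Type) (f : R -> T).
Hypothesis f_periodic : forall t, f (t + 2 * PI) = f t.

Lemma periodic_Z k t : f (t + 2 * PI * IZR k) = f t.
Proof.
assert (natural : forall n t, f (t + 2 * PI * INR n) = f t).
{ induction n as [|n IH]; intros s; [simpl; f_equal; ring|]. rewrite S_INR.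
  replace (s + 2 * PI * (INR n + 1)) with (s + 2 * PI * INR n + 2 * PI) by ring. rewrite f_periodic. apply IH. }
destruct (Z.le_gt_cases 0 k) as [hk|hk].
- rewrite <- (Z2Nat.id k), <- INR_IZR_INZ by assumption. apply natural.
- rewrite <- (natural (Z.to_nat (- k)) (t + 2 * PI * IZR k)). f_equal. rewrite INR_IZR_INZ, Z2Nat.id, opp_IZR by lia.
  ring.
Qed.
End Periodicity.

Lemma exists_period_translate t c : exists k, c <= t + 2 * PI * IZR k <= c + 2 * PI.
Proof.
pose proof PI_RGT_0. set (y := (t - c) / (2 * PI)). destruct (archimed y) as [up_gt up_le].
exists (1 - up y)%Z. rewrite minus_IZR. replace t with (c + 2 * PI * y) by (unfold y; field; lra). split; nra.
Qed.

Lemma continuous_periodic_bounded f : continuity f -> (forall t, f (t + 2 * PI) = f t) ->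
  exists M, forall t, Rabs (f t) <= M.
Proof.
intros cf pf. pose proof PI_RGT_0.
destruct (continuity_ab_maj (fun t => Rabs (f t)) 0 (2 * PI) ltac:(lra)) as [m [hm _]].
{ intros t _. apply (continuity_pt_comp f Rabs); [apply cf|apply Rcontinuity_abs]. }
exists (Rabs (f m)). intros t. destruct (exists_period_translate t 0) as [k hk].
rewrite <- (periodic_Z R f pf k t). apply hm. lra.
Qed.

Lemma Ccontinuous_periodic_bounded f : Ccontinuous f -> periodic f -> exists M, forall t, Cmod (f t) <= M.
Proof.
intros [f1 f2] pf.
destruct (continuous_periodic_bounded (fun t => fst (f t)) f1) as [M1 fst_le]; [intros t; rewrite pf; reflexivity|].
destruct (continuous_periodic_bounded (fun t => snd (f t)) f2) as [M2 snd_le]; [intros t; rewrite pf; reflexivity|].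
exists (2 * Rmax M1 M2). intros t. apply Cmod_le_of_components.
- apply Rle_trans with (1 := fst_le t), Rmax_l.
- apply Rle_trans with (1 := snd_le t), Rmax_r.
Qed.

Lemma periodic_derivative f f' : (forall t, Cderiv_at f t (f' t)) -> periodic f -> periodic f'.
Proof.
intros df pf t. apply (Cderiv_at_unique f t); [|apply df].
apply (Cderiv_at_ext (fun s => f (s + 2 * PI))); [exact pf|]. apply Cderiv_at_shift, df.
Qed.

Definition mode (n : Z) t : C := cis (IZR n * t).

Lemma mode_0 t : mode 0 t = RtoC 1.
Proof. unfold mode. rewrite Rmult_0_l. apply cis_0. Qed.

Lemma mode_plus n m t : mode (n + m) t = (mode n t * mode m t)%C.
Proof. unfold mode. rewrite plus_IZR, Rmult_plus_distr_r. apply cis_plus. Qed.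

Lemma mode_opp n t : mode (- n) t = Cconj (mode n t).
Proof. unfold mode. rewrite opp_IZR, Ropp_mult_distr_l_reverse. apply cis_opp. Qed.

Lemma mode_minus n m t : mode (n - m) t = (mode n t * mode (- m) t)%C.
Proof. apply mode_plus. Qed.

Lemma Cmod_mode n t : Cmod (mode n t) = 1.
Proof. apply Cmod_cis. Qed.

Lemma Cderiv_at_mode n t : Cderiv_at (mode n) t (Ci * RtoC (IZR n) * mode n t)%C.
Proof.
replace (Ci * RtoC (IZR n) * mode n t)%C with (RtoC (IZR n) * (Ci * mode n t))%C by ring.
apply (Cderiv_at_comp (fun t => IZR n * t) cis); [|apply Cderiv_at_cis].
apply (derivable_pt_lim_eq _ _ (IZR n * 1)); [ring|]. apply derivable_pt_lim_scal, derivable_pt_lim_id.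
Qed.

Lemma Ccontinuous_mode n : Ccontinuous (mode n).
Proof. exact (Cderiv_at_Ccontinuous _ _ (Cderiv_at_mode n)). Qed.

Lemma Cbmeasurable_mode n : Cbmeasurable (mode n).
Proof. apply (Cbmeasurable_continuous _ 1); [apply Ccontinuous_mode|]. intros t. rewrite Cmod_mode. lra. Qed.

Lemma periodic_mode n : periodic (mode n).
Proof.
intros t. unfold mode. replace (IZR n * (t + 2 * PI)) with (IZR n * t + 2 * PI * IZR n) by ring.
apply periodic_Z, periodic_cis.
Qed.

Ltac Cbmeas := repeat first
  [ assumption | apply Cbmeasurable_mode | apply Cbmeasurable_const | apply Cbmeasurable_conj
  | apply Cbmeasurable_minus | apply Cbmeasurable_plus | apply Cbmeasurable_mult ].

Definition coef (f : R -> C) (n : Z) : C := (RtoC (/ (2 * PI)) * Cintegral 0 (2 * PI) (fun t => f t * mode (- n) t))%C.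

Lemma PI2_gt_0 : 0 < 2 * PI.
Proof. pose proof PI_RGT_0. lra. Qed.

Lemma coef_ext f g n : (forall t, f t = g t) -> coef f n = coef g n.
Proof. intros e. unfold coef. f_equal. apply Cintegral_ext. intros t. rewrite e. reflexivity. Qed.

Lemma coef_plus f g n : Cbmeasurable f -> Cbmeasurable g -> coef (fun t => f t + g t)%C n = (coef f n + coef g n)%C.
Proof.
intros bf bg. unfold coef.
rewrite (Cintegral_ext _ _ _ (fun t => f t * mode (- n) t + g t * mode (- n) t)%C) by (intros; ring).
rewrite Cintegral_plus by Cbmeas. ring.
Qed.

Lemma coef_scal z f n : Cbmeasurable f -> coef (fun t => z * f t)%C n = (z * coef f n)%C.
Proof.
intros bf. unfold coef. rewrite (Cintegral_ext _ _ _ (fun t => z * (f t * mode (- n) t))%C) by (intros; ring).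
rewrite Cintegral_scal by Cbmeas. ring.
Qed.

Lemma coef_minus f g n : Cbmeasurable f -> Cbmeasurable g -> coef (fun t => f t - g t)%C n = (coef f n - coef g n)%C.
Proof.
intros bf bg. rewrite (coef_ext _ (fun t => f t + RtoC (-1) * g t)%C) by (intros; ring).
rewrite coef_plus, coef_scal by Cbmeas. ring.
Qed.

Lemma coef_conj f n : Cbmeasurable f -> coef (fun t => Cconj (f t)) n = Cconj (coef f (- n)).
Proof.
intros bf. unfold coef. rewrite Cmult_conj, <- Cintegral_conj by Cbmeas.
replace (Cconj (RtoC (/ (2 * PI)))) with (RtoC (/ (2 * PI))) by (apply injective_projections; simpl; ring).
f_equal. apply Cintegral_ext. intros t. rewrite Cmult_conj, Z.opp_involutive, mode_opp. reflexivity.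
Qed.

Lemma coef_mult_mode f m n : coef (fun t => f t * mode m t)%C n = coef f (n - m).
Proof.
unfold coef. f_equal. apply Cintegral_ext. intros t. rewrite Z.opp_sub_distr, mode_plus. ring.
Qed.

Lemma Cmod_coef_le f n M : Cbmeasurable f -> (forall t, Cmod (f t) <= M) -> Cmod (coef f n) <= M.
Proof.
intros bf fM. pose proof PI2_gt_0. unfold coef. rewrite Cmod_mult, Cmod_R, Rabs_right.
2:{ left. apply Rinv_0_lt_compat. assumption. }
apply Rmult_le_reg_l with (2 * PI); [assumption|]. rewrite <- Rmult_assoc, Rinv_r, Rmult_1_l by lra.
replace (2 * PI * M) with (M * (2 * PI - 0)) by ring.
apply Cmod_Cintegral_le; [Cbmeas|lra|]. intros t _. rewrite Cmod_mult, Cmod_mode, Rmult_1_r. apply fM.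
Qed.

Lemma coef_derivative f f' n : (forall t, Cderiv_at f t (f' t)) -> Ccontinuous f' -> periodic f ->
  coef f' n = (Ci * RtoC (IZR n) * coef f n)%C.
Proof.
intros df cf' pf. pose proof PI2_gt_0. pose proof (Cderiv_at_Ccontinuous f f' df) as cf.
destruct (Ccontinuous_periodic_bounded f cf pf) as [M fM].
destruct (Ccontinuous_periodic_bounded f' cf' (periodic_derivative f f' df pf)) as [M' fM'].
pose proof (Cbmeasurable_continuous f M cf fM) as bf. pose proof (Cbmeasurable_continuous f' M' cf' fM') as bf'.
set (w := (Ci * RtoC (IZR (- n)))%C).
assert (parts : Cintegral 0 (2 * PI) (fun t => f' t * mode (- n) t + w * (f t * mode (- n) t))%C = RtoC 0).
{ rewrite (Cintegral_FTC _ (fun t => f t * mode (- n) t)%C).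
  - rewrite <- (Rplus_0_l (2 * PI)), pf, periodic_mode. apply Cplus_opp_r.
  - Cbmeas.
  - apply Ccontinuous_plus; repeat apply Ccontinuous_mult; try apply Ccontinuous_const;
      try apply Ccontinuous_mode; assumption.
  - lra.
  - intros t. replace (w * (f t * mode (- n) t))%C with (f t * (Ci * RtoC (IZR (- n)) * mode (- n) t))%C
      by (unfold w; ring).
    apply Cderiv_at_mult; [apply df|apply Cderiv_at_mode]. }
rewrite Cintegral_plus, Cintegral_scal in parts by Cbmeas. unfold coef.
replace (Cintegral 0 (2 * PI) (fun t => f' t * mode (- n) t)%C)
  with (RtoC 0 - w * Cintegral 0 (2 * PI) (fun t => f t * mode (- n) t))%C by (rewrite <- parts; ring).
unfold w. rewrite opp_IZR, RtoC_opp. ring.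
Qed.

Lemma coef_decay f f' f'' : (forall t, Cderiv_at f t (f' t)) -> (forall t, Cderiv_at f' t (f'' t)) -> Ccontinuous f'' ->
  periodic f -> exists K, forall n, Cmod (coef f n) <= K * decay n.
Proof.
intros df df' cf'' pf. pose proof (Cderiv_at_Ccontinuous f f' df) as cf.
pose proof (periodic_derivative f f' df pf) as pf'. pose proof (periodic_derivative f' f'' df' pf') as pf''.
destruct (Ccontinuous_periodic_bounded f cf pf) as [M fM].
destruct (Ccontinuous_periodic_bounded f'' cf'' pf'') as [M'' fM''].
exists (M + M''). intros n.
assert (e : (RtoC (1 + IZR n * IZR n) * coef f n)%C = (coef f n - coef f'' n)%C).
{ rewrite (coef_derivative f' f''), (coef_derivative f f')
    by (try exact (Cderiv_at_Ccontinuous f' f'' df'); assumption).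
  rewrite RtoC_plus, RtoC_mult. apply injective_projections; simpl; ring. }
apply Rmult_le_reg_l with (1 + IZR n * IZR n); [nra|].
replace ((1 + IZR n * IZR n) * ((M + M'') * decay n)) with (M + M'') by (unfold decay; field; nra).
rewrite <- (Rabs_right (1 + IZR n * IZR n)) by nra. rewrite <- Cmod_R, <- Cmod_mult, e.
apply Rle_trans with (1 := Cmod_triangle _ _). rewrite Cmod_opp.
apply Rplus_le_compat; apply Cmod_coef_le; try assumption; eapply Cbmeasurable_continuous; eassumption.
Qed.

Lemma coef_mode m n : coef (mode m) n = if Z.eq_dec m n then RtoC 1 else RtoC 0.
Proof.
pose proof PI2_gt_0. rewrite (coef_ext _ (fun t => RtoC 1 * mode m t)%C) by (intros; ring). rewrite coef_mult_mode.
destruct (Z.eq_dec m n) as [->|ne].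
- rewrite Z.sub_diag. unfold coef. rewrite (Cintegral_ext _ _ _ (fun _ => RtoC 1)).
  2:{ intros t. simpl Z.opp. rewrite mode_0. ring. }
  rewrite Cintegral_const, <- !RtoC_mult by lra. f_equal. field. lra.
- assert (h : (Ci * RtoC (IZR (n - m)) * coef (fun _ => RtoC 1) (n - m))%C = RtoC 0).
  { rewrite <- (coef_derivative _ (fun _ => RtoC 0)).
    - rewrite (coef_ext _ (fun _ => RtoC 0 * RtoC 0)%C) by (intros; ring).
      rewrite (coef_scal _ (fun _ => RtoC 0)) by Cbmeas. ring.
    - intros t. apply Cderiv_at_const.
    - apply Ccontinuous_const.
    - intros t. reflexivity. }
  destruct (Ceq_dec (coef (fun _ => RtoC 1) (n - m)) (RtoC 0)) as [e|e]; [exact e|].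
  exfalso. revert h. apply Cmult_neq_0; [|exact e]. apply Cmult_neq_0; [injection 1; lra|].
  intros h. apply RtoC_inj in h. apply eq_IZR in h. lia.
Qed.

Lemma coef_Csum_mode l (e : Z -> C) f n : Cbmeasurable f ->
  coef (fun t => Csum l (fun j => e j * mode j t) * f t)%C n = Csum l (fun j => e j * coef f (n - j))%C.
Proof.
intros bf. assert (b : forall l, Cbmeasurable (fun t => Csum l (fun j => e j * mode j t)%C)).
{ intros l'. apply (Cbmeasurable_Csum l' (fun j t => e j * mode j t)%C). intros j. Cbmeas. }
induction l as [|j l IH].
- rewrite (coef_ext _ (fun t => RtoC 0 * f t)%C) by reflexivity. rewrite coef_scal by exact bf. apply Cmult_0_l.
- rewrite (coef_ext _ (fun t => e j * (f t * mode j t) + Csum l (fun j => e j * mode j t) * f t)%C)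
    by (intros; rewrite Csum_cons; ring).
  specialize (b l). rewrite coef_plus, coef_scal, coef_mult_mode, IH by Cbmeas. reflexivity.
Qed.

Definition mean_square (f : R -> C) : R := / (2 * PI) * integral 0 (2 * PI) (fun t => sqnorm (f t)).

Lemma mean_square_ge_0 f : Cbmeasurable f -> 0 <= mean_square f.
Proof.
intros bf. pose proof PI2_gt_0. apply Rmult_le_pos; [left; apply Rinv_0_lt_compat; assumption|].
apply integral_ge_0; [apply bmeasurable_sqnorm, bf|lra|]. intros; apply sqnorm_ge_0.
Qed.

Lemma mean_square_remove_mode f n : Cbmeasurable f ->
  mean_square (fun t => f t - coef f n * mode n t)%C = mean_square f - sqnorm (coef f n).
Proof.
intros bf. pose proof PI2_gt_0. set (c := coef f n).
assert (bfm : Cbmeasurable (fun t => Cconj c * (f t * mode (- n) t))%C) by Cbmeas.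
unfold mean_square. rewrite (integral_ext _ _ _ (fun t =>
  sqnorm (f t) + (-2 * fst (Cconj c * (f t * mode (- n) t))%C + sqnorm c))).
2:{ intros t. pose proof (sqnorm_cis (IZR n * t)) as h. rewrite <- (Rmult_1_r (sqnorm c)), <- h.
    rewrite mode_opp. unfold mode, sqnorm, cis in *. simpl in *. ring. }
rewrite integral_plus, integral_plus, integral_scal, integral_const by
  first [lra | apply bmeasurable_sqnorm, bf | destruct bfm; bmeas].
replace (integral 0 (2 * PI) (fun t => fst (Cconj c * (f t * mode (- n) t))%C)) with (2 * PI * sqnorm c); [field; lra|].
change (2 * PI * sqnorm c = fst (Cintegral 0 (2 * PI) (fun t => Cconj c * (f t * mode (- n) t))%C)).
rewrite Cintegral_scal by Cbmeas.
replace (Cintegral 0 (2 * PI) (fun t => f t * mode (- n) t)%C) with (RtoC (2 * PI) * c)%C.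
- unfold sqnorm. simpl. ring.
- unfold c, coef. rewrite Cmult_assoc, <- RtoC_mult, Rinv_r by lra. apply Cmult_1_l.
Qed.

(* Bessel's inequality, removing one mode at a time. *)
Lemma Rsum_sqnorm_coef_le l : NoDup l -> forall f, Cbmeasurable f ->
  Rsum l (fun n => sqnorm (coef f n)) <= mean_square f.
Proof.
induction 1 as [|n l nin _ IH]; intros f bf; [apply mean_square_ge_0, bf|].
assert (bg : Cbmeasurable (fun t => f t - coef f n * mode n t)%C) by Cbmeas.
specialize (IH _ bg). rewrite mean_square_remove_mode in IH by exact bf. simpl.
rewrite (Rsum_ext l _ (fun k => sqnorm (coef (fun t => f t - coef f n * mode n t)%C k))); [lra|].
intros k hk. rewrite coef_minus, coef_scal, coef_mode by Cbmeas.
destruct (Z.eq_dec n k) as [e|ne]; [congruence|]. f_equal. ring.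
Qed.

Lemma Cmod_coef_cv_0 f (m : nat -> Z) : Cbmeasurable f -> (forall i j, m i = m j -> i = j) ->
  Un_cv (fun i => Cmod (coef f (m i))) 0.
Proof.
intros bf inj. set (u N := Rsum (map m (seq 0 N)) (fun n => sqnorm (coef f n))).
assert (u_S : forall N, u (S N) = u N + sqnorm (coef f (m N))).
{ intros N. unfold u. rewrite seq_S, map_app, Rsum_app. simpl. ring. }
destruct (growing_cv u) as [l hl].
- intros N. rewrite u_S. pose proof (sqnorm_ge_0 (coef f (m N))). lra.
- exists (mean_square f). intros y [N ->]. apply Rsum_sqnorm_coef_le; [|exact bf].
  apply FinFun.Injective_map_NoDup; [exact inj|apply seq_NoDup].
- pose proof (CV_minus _ _ _ _ (CV_shift' u 1 l hl) hl) as d. rewrite Rminus_diag in d.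
  intros eps e0. destruct (d (eps * eps) ltac:(nra)) as [N hN]. exists N. intros n le. specialize (hN n le).
  rewrite Nat.add_1_r, u_S in hN. unfold Rdist in *. rewrite Rminus_0_r in *.
  replace (u n + sqnorm (coef f (m n)) - u n) with (sqnorm (coef f (m n))) in hN by ring.
  pose proof (Cmod_ge_0 (coef f (m n))). rewrite sqnorm_Cmod in hN.
  rewrite Rabs_right in * by nra. nra.
Qed.

Lemma bmeasurable_div p q K : continuity p -> continuity q -> (forall t, 0 <= q t) ->
  (forall t, Rabs (p t) <= K * q t) ->
  bmeasurable (fun t => p t / q t).
Proof.
intros cp cq q0 pq. set (h n t := p t / (q t + RinvN n)).
assert (den : forall n t, 0 < q t + RinvN n) by (intros n t; pose proof (cond_pos (RinvN n)); specialize (q0 t); lra).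
assert (ch : forall n, continuity (h n)).
{ intros n. apply continuity_div; [exact cp| |].
  - apply (continuity_plus q); [exact cq|]. apply continuity_const. intros x y. reflexivity.
  - intros t. apply Rgt_not_eq, den. }
assert (p0 : forall t, q t = 0 -> p t = 0).
{ intros t e. specialize (pq t). rewrite e, Rmult_0_r in pq. apply Rabs_eq_0, Rle_antisym; [exact pq|apply Rabs_pos]. }
assert (K_bound : forall t d, 0 < d -> q t <= d -> Rabs (p t / d) <= Rabs K).
{ intros t d d0 qd. rewrite Rabs_div, (Rabs_right d) by lra. apply Rle_div_l; [exact d0|].
  pose proof (Rabs_pos K). pose proof (Rle_abs K). specialize (pq t). specialize (q0 t). nra. }
assert (h_bound : forall n t, Rabs (h n t) <= Rabs K).
{ intros n t. apply K_bound; [apply den|]. pose proof (cond_pos (RinvN n)). lra. }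
apply (bmeasurable2_section1 (fun t _ => p t / q t) 0), (bmeasurable2_lim (fun n t _ => h n t) _ (Rabs K)).
- intros n. apply (bmeasurable2_separate_continuity _ (Rabs K)); [intros _; apply ch| |intros; apply h_bound].
  intros t. apply continuity_const. intros x y. reflexivity.
- intros t _. destruct (q0 t) as [q1|q1].
  + unfold h, Rdiv. apply CV_mult; [apply Un_cv_const|].
    apply (continuity_seq (fun s => / s) (fun n => q t + RinvN n) (q t)).
    * apply (continuity_pt_inv id); [apply derivable_continuous_pt, derivable_pt_id|unfold id; lra].
    * pose proof (CV_plus _ _ _ _ (Un_cv_const (q t)) RinvN_cv) as cv. rewrite Rplus_0_r in cv. exact cv.
  + apply Un_cv_eventually_const. exists 0%nat. intros n _. unfold h. rewrite p0 by auto. unfold Rdiv. ring.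
- intros t _. destruct (q0 t) as [q1|q1]; [apply K_bound; lra|].
  rewrite p0 by auto. unfold Rdiv. rewrite Rmult_0_l, Rabs_R0. apply Rabs_pos.
Qed.

Lemma Cbmeasurable_div f g K : Ccontinuous f -> Ccontinuous g -> (forall t, Cmod (f t) <= K * Cmod (g t)) ->
  Cbmeasurable (fun t => f t / g t)%C.
Proof.
intros [f1 f2] [g1 g2] fg.
assert (cq : continuity (fun t => sqnorm (g t))).
{ apply (continuity_plus (fun t => fst (g t) * fst (g t)) (fun t => snd (g t) * snd (g t)));
    apply (continuity_mult (fun t => _ (g t)) (fun t => _ (g t))); assumption. }
assert (bound : forall t, Cmod (f t * Cconj (g t))%C <= K * sqnorm (g t)).
{ intros t. rewrite Cmod_mult, Cmod_conj, sqnorm_Cmod. pose proof (Cmod_ge_0 (g t)). specialize (fg t). nra. }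
assert (e : forall t,
  (f t / g t)%C = (fst (f t * Cconj (g t))%C / sqnorm (g t), snd (f t * Cconj (g t))%C / sqnorm (g t))).
{ intros t. unfold Cdiv, Cinv. replace (fst (g t) ^ 2 + snd (g t) ^ 2) with (sqnorm (g t)) by (unfold sqnorm; ring).
  apply injective_projections; simpl; unfold Rdiv; ring. }
replace (fun t => f t / g t)%C
  with (fun t => (fst (f t * Cconj (g t))%C / sqnorm (g t), snd (f t * Cconj (g t))%C / sqnorm (g t)) : C)
  by (extensionality t; rewrite e; reflexivity).
destruct (Ccontinuous_mult f (fun t => Cconj (g t)) (conj f1 f2) (Ccontinuous_conj g (conj g1 g2))) as [c1 c2].
split.
- apply (bmeasurable_div (fun t => fst (f t * Cconj (g t))%C) _ K); try assumption; [intros; apply sqnorm_ge_0|].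
  intros t. apply Rle_trans with (1 := Rabs_fst_le_Cmod _). apply bound.
- apply (bmeasurable_div (fun t => snd (f t * Cconj (g t))%C) _ K); try assumption; [intros; apply sqnorm_ge_0|].
  intros t. apply Rle_trans with (1 := Rabs_snd_le_Cmod _). apply bound.
Qed.

Lemma periodic_increment_le (f : R -> C) t0 d : Ccontinuous f -> periodic f -> Cderiv_at f t0 d ->
  exists K, forall t, Cmod (f t - f t0)%C <= K * Cmod (cis (t - t0) - 1)%C.
Proof.
intros cf pf [d1 d2]. destruct (Ccontinuous_periodic_bounded f cf pf) as [M fM].
destruct (slopes_le_of_derivative (fun t => fst (f t)) t0 (fst d) M) as [n1 fst_slopes];
  [intros t; apply Rle_trans with (1 := Rabs_fst_le_Cmod _), fM|exact d1|].
destruct (slopes_le_of_derivative (fun t => snd (f t)) t0 (snd d) M) as [n2 snd_slopes];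
  [intros t; apply Rle_trans with (1 := Rabs_snd_le_Cmod _), fM|exact d2|].
specialize (fst_slopes (n1 + n2)%nat ltac:(lia)). specialize (snd_slopes (n1 + n2)%nat ltac:(lia)).
set (N := INR (n1 + n2)) in *. exists (4 * N). intros t.
destruct (exists_period_translate t (t0 - PI)) as [k hk]. set (s := t + 2 * PI * IZR k) in *.
rewrite <- (periodic_Z _ f pf k t). fold s.
replace (cis (t - t0)) with (cis (s - t0)).
2:{ unfold s. replace (t + 2 * PI * IZR k - t0) with (t - t0 + 2 * PI * IZR k) by ring.
    apply periodic_Z, periodic_cis. }
pose proof (Cmod_cis_minus_1_ge (s - t0) ltac:(apply Rabs_le; lra)) as lower.
apply Rle_trans with (2 * (N * Rabs (s - t0))).
- apply Cmod_le_of_components; [apply fst_slopes|apply snd_slopes].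
- assert (0 <= N) by apply pos_INR. nra.
Qed.

Lemma fourier_sum_telescopes (f g : R -> C) t0 N : Cbmeasurable g ->
  (forall t, f t = (f t0 + g t * (cis (t - t0) - 1))%C) ->
  Csum (Zball N) (fun n => coef f n * mode n t0)%C
  = (f t0 + (coef g (- Z.of_nat N - 1) * mode (- Z.of_nat N - 1) t0 - coef g (Z.of_nat N) * mode (Z.of_nat N) t0))%C.
Proof.
intros bg fg. set (h n := (coef g n * mode n t0)%C).
assert (term : forall n, (coef f n * mode n t0)%C = ((if Z.eq_dec 0 n then f t0 else 0) + (h (n - 1)%Z - h n))%C).
{ intros n. rewrite (coef_ext f (fun t => f t0 * mode 0 t + (cis (- t0) * (g t * mode 1 t) - g t))%C).
  - rewrite coef_plus, coef_minus, !coef_scal, coef_mode, coef_mult_mode by Cbmeas. unfold h. rewrite mode_minus.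
    replace (mode (- (1)) t0) with (cis (- t0)) by (unfold mode; rewrite opp_IZR; f_equal; ring).
    destruct (Z.eq_dec 0 n) as [<-|_]; rewrite ?mode_0; ring.
  - intros t. rewrite fg, mode_0. unfold Rminus. rewrite cis_plus. unfold mode. rewrite Rmult_1_l. ring. }
induction N as [|N IH].
- cbn [Zball]. rewrite Csum_cons, term. unfold h. simpl. apply injective_projections; simpl; ring.
- cbn [Zball]. rewrite !Csum_cons, IH, !term.
  destruct (Z.eq_dec 0 _) as [e|_]; [lia|]. destruct (Z.eq_dec 0 _) as [e|_]; [lia|]. unfold h.
  replace (Z.of_nat (S N) - 1)%Z with (Z.of_nat N) by lia.
  replace (- Z.of_nat N - 1)%Z with (- Z.of_nat (S N))%Z by lia. ring.
Qed.

(* Chernoff's argument: dividing [f - f t0] by [cis (t - t0) - 1] makes the partial sums telescope. *)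
Lemma fourier_series_cv (f : R -> C) t0 d : Ccontinuous f -> periodic f -> Cderiv_at f t0 d ->
  Un_cv (fun N => Cmod (Csum (Zball N) (fun n => coef f n * mode n t0) - f t0)%C) 0.
Proof.
intros cf pf df. destruct (periodic_increment_le f t0 d cf pf df) as [K fK].
set (g t := ((f t - f t0) / (cis (t - t0) - 1))%C).
assert (bg : Cbmeasurable g).
{ apply (Cbmeasurable_div _ _ K); [| |exact fK].
  - apply (Ccontinuous_plus f); [exact cf|apply Ccontinuous_const].
  - apply (Ccontinuous_plus (fun t => cis (t - t0))); [|apply Ccontinuous_const].
    apply (Cderiv_at_Ccontinuous _ (fun t => Ci * cis (t - t0))%C). intros t.
    apply (Cderiv_at_shift cis (- t0)), Cderiv_at_cis. }
assert (fg : forall t, f t = (f t0 + g t * (cis (t - t0) - 1))%C).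
{ intros t. unfold g. specialize (fK t). destruct (Ceq_dec (cis (t - t0) - 1)%C (RtoC 0)) as [e|ne]; [|field; exact ne].
  rewrite e, Cmod_0, Rmult_0_r in fK.
  assert (z : (f t - f t0)%C = RtoC 0) by (apply Cmod_eq_0, Rle_antisym; [exact fK|apply Cmod_ge_0]).
  rewrite e. replace (f t) with (f t0 + (f t - f t0))%C at 1 by ring. rewrite z. ring. }
apply (Un_cv_squeeze _ (fun N => Cmod (coef g (- Z.of_nat N - 1)) + Cmod (coef g (Z.of_nat N)))).
- intros N. rewrite Rminus_0_r, Rabs_right by apply Rle_ge, Cmod_ge_0.
  rewrite (fourier_sum_telescopes f g) by assumption.
  match goal with |- Cmod (f t0 + ?z - f t0)%C <= _ => replace (f t0 + z - f t0)%C with z by ring end.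
  apply Rle_trans with (1 := Cmod_triangle _ _). rewrite Cmod_opp, !Cmod_mult, !Cmod_mode. lra.
- rewrite <- (Rplus_0_l 0). apply CV_plus; apply (Cmod_coef_cv_0 g); auto; intros i j; lia.
Qed.

Lemma eq_0_of_coef_0 (f f' : R -> C) : (forall t, Cderiv_at f t (f' t)) -> periodic f ->
  (forall n, coef f n = RtoC 0) ->
  forall t, f t = RtoC 0.
Proof.
intros df pf f0 t. pose proof (fourier_series_cv f t (f' t) (Cderiv_at_Ccontinuous f f' df) pf (df t)) as cv.
apply Cmod_eq_0. rewrite <- Cmod_opp. apply (UL_sequence _ _ _ (Un_cv_const _)).
revert cv. apply Un_cv_ext. intros N. f_equal. rewrite (Csum_ext _ _ (fun _ => RtoC 0 * RtoC 0)%C).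
- rewrite Csum_scal. ring.
- intros n _. rewrite f0. ring.
Qed.

Lemma fourier_remainder_le (f f' : R -> C) K : (forall t, Cderiv_at f t (f' t)) -> periodic f ->
  (forall n, Cmod (coef f n) <= K * decay n) -> forall T t, (1 <= T)%nat ->
  Cmod (f t - Csum (Zball T) (fun n => coef f n * mode n t))%C <= K * (2 / INR T).
Proof.
intros df pf fK T t T1. set (s N := Csum (Zball N) (fun n => coef f n * mode n t)%C).
pose proof (fourier_series_cv f t (f' t) (Cderiv_at_Ccontinuous f f' df) pf (df t)) as cv. fold s in cv.
assert (K0 : 0 <= K).
{ specialize (fK 0%Z). unfold decay in fK. rewrite Rmult_0_l, Rplus_0_r, Rinv_1 in fK.
  pose proof (Cmod_ge_0 (coef f 0)). lra. }
assert (tail : forall N, Cmod (s (N + T)%nat - s T)%C <= K * (2 / INR T)).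
{ intros N. unfold s. rewrite (Csum_incl_split (Zball T) (Zball (N + T))); [|apply NoDup_Zball|apply NoDup_Zball|].
  2:{ intros k hk. apply In_Zball in hk. apply In_Zball. lia. }
  match goal with |- Cmod (?u + ?v - ?u)%C <= _ => replace (u + v - u)%C with v by ring end.
  apply Rle_trans with (1 := Cmod_Csum_le _ _).
  apply Rle_trans with (Rsum (list_diff (Zball (N + T)) (Zball T)) (fun n => K * decay n)).
  - apply Rsum_le. intros n _. rewrite Cmod_mult, Cmod_mode, Rmult_1_r. apply fK.
  - rewrite Rsum_scal. apply Rmult_le_compat_l; [exact K0|].
    apply Rsum_decay_tail; [exact T1|apply NoDup_filter, NoDup_Zball|].
    intros k hk. apply In_list_diff in hk. rewrite !In_Zball in hk. lia. }
apply (@Rle_cv_lim (fun _ => Cmod (f t - s T)%C) (fun N => Cmod (s (N + T)%nat - f t)%C + K * (2 / INR T))).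
- intros N. rewrite <- (Cmod_opp (s (N + T)%nat - f t)).
  replace (f t - s T)%C with (- (s (N + T)%nat - f t) + (s (N + T)%nat - s T))%C by ring.
  apply Rle_trans with (1 := Cmod_triangle _ _). apply Rplus_le_compat_l, tail.
- apply Un_cv_const.
- rewrite <- (Rplus_0_l (K * (2 / INR T))) at 1.
  apply CV_plus; [apply (CV_shift' (fun N => Cmod (s N - f t)%C) T 0 cv)|apply Un_cv_const].
Qed.

(** * Energy estimates for mode systems *)

Lemma increment_ge_of_derivative f f' m p q : p <= q -> (forall x, p <= x <= q -> derivable_pt_lim f x (f' x)) ->
  (forall x, p <= x <= q -> m <= f' x) -> m * (q - p) <= f q - f p.
Proof.
intros [pq|<-] df fm; [|lra]. destruct (MVT_cor2 f f' p q pq df) as [c [-> hc]].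
apply Rmult_le_compat_r; [lra|]. apply fm. lra.
Qed.

Lemma exponential_growth f f' al p x : (forall x, derivable_pt_lim f x (f' x)) -> (forall x, al * f x <= f' x) ->
  p <= x -> f p * exp (al * (x - p)) <= f x.
Proof.
intros df grow px.
assert (dexp : forall y, derivable_pt_lim (fun y => exp (- al * y)) y (- al * exp (- al * y))).
{ intros y. apply (derivable_pt_lim_eq _ _ (exp (- al * y) * (- al * 1))); [ring|].
  apply (derivable_pt_lim_comp (fun y => - al * y) exp); [|apply derivable_pt_lim_exp].
  apply (derivable_pt_lim_scal id), derivable_pt_lim_id. }
pose proof (increment_ge_of_derivative (fun y => f y * exp (- al * y))
  (fun y => f' y * exp (- al * y) + f y * (- al * exp (- al * y))) 0 p x px) as incr.
rewrite Rmult_0_l in incr. apply Rmult_le_reg_r with (exp (- al * x)); [apply exp_pos|].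
rewrite Rmult_assoc, <- exp_plus. replace (al * (x - p) + - al * x) with (- al * p) by ring.
apply Rminus_le_0, incr.
- intros y _. apply (derivable_pt_lim_mult f (fun y => exp (- al * y))); [apply df|apply dexp].
- intros y _. pose proof (exp_pos (- al * y)). specialize (grow y). nra.
Qed.

Lemma bounded_above_growth_le_0 f f' al M : 0 < al -> (forall x, derivable_pt_lim f x (f' x)) ->
  (forall x, al * f x <= f' x) -> (forall x, f x <= M) -> forall x, f x <= 0.
Proof.
intros al0 df grow fM x. apply Rnot_lt_le. intros f0.
set (h := M / (al * f x)). assert (M0 : 0 < M) by (specialize (fM x); lra).
assert (h0 : 0 <= h) by (apply Rdiv_le_0_compat; [lra|apply Rmult_lt_0_compat; assumption]).
pose proof (exponential_growth f f' al x (x + h) df grow ltac:(lra)) as g. replace (x + h - x) with h in g by ring.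
pose proof (exp_ineq1_le (al * h)) as lin. specialize (fM (x + h)).
assert (e : f x * (al * h) = M) by (unfold h; field; lra). nra.
Qed.

Lemma sqnorm_le_of_linear_ode (v h : R -> C) al be K : al <> 0 ->
  (forall x, Cderiv_at v x ((al, be) * v x + h x)%C) -> (forall x, Cmod (v x) <= K) -> (forall x, Cmod (h x) <= K) ->
  forall x, sqnorm (v x) <= K * K / (al * al).
Proof.
assert (positive : forall (v h : R -> C) al be, 0 < al ->
  (forall x, Cderiv_at v x ((al, be) * v x + h x)%C) -> (forall x, Cmod (v x) <= K) -> (forall x, Cmod (h x) <= K) ->
  forall x, sqnorm (v x) <= K * K / (al * al)).
{ clear. intros v h al be al0 dv vK hK x. apply Rminus_le.
  apply (bounded_above_growth_le_0 (fun x => sqnorm (v x) - K * K / (al * al))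
    (fun x => 2 * fst (Cconj (v x) * ((al, be) * v x + h x))%C - 0) al (K * K) al0).
  - intros y. apply derivable_pt_lim_minus; [apply derivable_pt_lim_sqnorm, dv|apply derivable_pt_lim_const].
  - intros y. pose proof (Rabs_fst_le_Cmod (Cconj (v y) * h y)%C) as r.
    rewrite Cmod_mult, Cmod_conj in r. apply Rabs_le_between in r.
    assert (e : fst (Cconj (v y) * ((al, be) * v y + h y))%C = al * sqnorm (v y) + fst (Cconj (v y) * h y)%C)
      by (unfold sqnorm; simpl; ring).
    rewrite e. rewrite sqnorm_Cmod. specialize (hK y). pose proof (Cmod_ge_0 (v y)). pose proof (Cmod_ge_0 (h y)).
    assert (c : al * (K * K / (al * al)) = K * (K / al)) by (field; lra).
    assert (amgm : 2 * (Cmod (v y) * K) <= al * (Cmod (v y) * Cmod (v y)) + K * (K / al)).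
    { apply Rmult_le_reg_l with al; [exact al0|]. rewrite Rmult_plus_distr_l.
      replace (al * (K * (K / al))) with (K * K) by (field; lra).
      pose proof (Rle_0_sqr (al * Cmod (v y) - K)) as sq. unfold Rsqr in sq. lra. }
    assert (Cmod (v y) * Cmod (h y) <= Cmod (v y) * K) by (apply Rmult_le_compat_l; assumption). lra.
  - intros y. rewrite sqnorm_Cmod. specialize (vK y). pose proof (Cmod_ge_0 (v y)).
    assert (0 <= K * K / (al * al)) by (apply Rdiv_le_0_compat; nra). nra. }
intros al0 dv vK hK x. destruct (Rlt_le_dec 0 al) as [h0|h0]; [exact (positive v h al be h0 dv vK hK x)|].
replace (al * al) with (- al * - al) by ring. rewrite <- (Ropp_involutive x).
apply (positive (fun x => v (- x)) (fun x => - h (- x)%R)%C (- al) (- be)); [lra| |intros; apply vK|].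
- intros y. replace ((- al, - be)%R * v (- y)%R + - h (- y)%R)%C with (RtoC (-1) * ((al, be) * v (- y)%R + h (- y)%R))%C
    by (apply injective_projections; simpl; ring).
  apply Cderiv_at_reflect, dv.
- intros y. rewrite Cmod_opp. apply hK.
Qed.

Lemma derivable_pt_lim_Rsum l (f f' : Z -> R -> R) x : (forall n, derivable_pt_lim (f n) x (f' n x)) ->
  derivable_pt_lim (fun x => Rsum l (fun n => f n x)) x (Rsum l (fun n => f' n x)).
Proof.
intros df. induction l as [|n l IH]; [apply derivable_pt_lim_const|].
apply (derivable_pt_lim_plus (f n) (fun x => Rsum l (fun n => f n x))); [apply df|exact IH].
Qed.

Lemma weighted_amgm s w w' x y : 0 < w -> s * s <= w * w' -> 2 * s * (x * y) <= w * (x * x) + w' * (y * y).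
Proof.
intros w0 sw. apply Rmult_le_reg_l with w; [exact w0|].
pose proof (Rle_0_sqr (w * x - s * y)) as sq. unfold Rsqr in sq. pose proof (Rle_0_sqr y) as y2. unfold Rsqr in y2.
assert (s * s * (y * y) <= w * w' * (y * y)) by (apply Rmult_le_compat_r; assumption). nra.
Qed.

Definition mode_system (a b nu : R) (e : Z -> C) (V : Z -> R -> C) : Prop := exists (H : Z -> R -> C) (K : R),
  (forall n x, Cderiv_at (V n) x ((a, b) * RtoC (IZR n + nu) * V n x + H n x)%C) /\
  (forall n x, Cmod (V n x) <= K) /\ (forall n x, Cmod (H n x) <= K) /\
  (forall T n x, (1 <= T)%nat ->
     Cmod (H n x - Csum (Zball T) (fun j => e j * Cconj (V (j - n)%Z x)))%C <= K / INR T).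

Lemma mode_system_reflect a b nu e V : mode_system a b nu e V ->
  mode_system a b (- nu) (fun k => - e (- k)%Z)%C (fun n x => V (- n)%Z (- x)).
Proof.
intros [H [K [ode [VK [HK coupling]]]]]. exists (fun n x => - H (- n)%Z (- x)%R)%C, K.
split; [|split; [|split]].
- intros n x.
  replace ((a, b) * RtoC (IZR n + - nu) * V (- n)%Z (- x)%R + - H (- n)%Z (- x)%R)%C
    with (RtoC (-1) * ((a, b) * RtoC (IZR (- n) + nu) * V (- n)%Z (- x)%R + H (- n)%Z (- x)%R))%C
    by (rewrite opp_IZR; apply injective_projections; simpl; ring).
  apply (Cderiv_at_reflect (V (- n)%Z)), ode.
- intros n x. apply VK.
- intros n x. rewrite Cmod_opp. apply HK.
- intros T n x T1. rewrite <- (Csum_Zball_opp T). rewrite <- Cmod_opp.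
  replace (- (- H (- n)%Z (- x)%R - Csum (Zball T) (fun k => - e (- - k)%Z * Cconj (V (- (- k - n))%Z (- x)%R))))%C
    with (H (- n)%Z (- x)%R - Csum (Zball T) (fun j => e j * Cconj (V (j - - n)%Z (- x)%R)))%C; [apply coupling, T1|].
  rewrite (Csum_ext _ (fun k => - e (- - k)%Z * _)%C (fun j => RtoC (-1) * (e j * Cconj (V (j - - n)%Z (- x)%R)))%C).
  + rewrite Csum_scal. apply injective_projections; simpl; ring.
  + intros k _. replace (- - k)%Z with k by ring. replace (- (- k - n))%Z with (k - - n)%Z by ring.
    apply injective_projections; simpl; ring.
Qed.

Definition threshold_sign (N n : Z) : R := if Z_lt_dec N n then 1 else -1.

Definition signed_energy (N : Z) (V : Z -> R -> C) (L : nat) x : R :=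
  Rsum (Zball L) (fun n => threshold_sign N n * sqnorm (V n x)).

Section Energy.
Variables (a b nu : R) (e : Z -> C) (V H : Z -> R -> C) (Ce K : R).
Hypothesis a_gt_0 : 0 < a.
Hypothesis nu_small : Rabs nu < 1.
Hypothesis e_decay : forall k, Cmod (e k) <= Ce * decay k.
Hypothesis ode : forall n x, Cderiv_at (V n) x ((a, b) * RtoC (IZR n + nu) * V n x + H n x)%C.
Hypothesis V_bounded : forall n x, Cmod (V n x) <= K.
Hypothesis H_bounded : forall n x, Cmod (H n x) <= K.
Hypothesis H_coupling : forall T n x, (1 <= T)%nat ->
  Cmod (H n x - Csum (Zball T) (fun j => e j * Cconj (V (j - n)%Z x)))%C <= K / INR T.

Let K_ge_0 : 0 <= K.
Proof. apply Rle_trans with (1 := Cmod_ge_0 (V 0%Z 0)), V_bounded. Qed.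

Let Ce_ge_0 : 0 <= Ce.
Proof.
pose proof (e_decay 0) as h. unfold decay in h. rewrite Rmult_0_l, Rplus_0_r, Rinv_1 in h.
pose proof (Cmod_ge_0 (e 0%Z)). lra.
Qed.

Let gap := a * (1 - Rabs nu).

Let gap_gt_0 : 0 < gap. Proof. apply Rmult_lt_0_compat; lra. Qed.

Let mode_bound := K * K * (1 + 2 / (gap * gap)).

Let mode_bound_ge_0 : 0 <= mode_bound.
Proof. apply Rmult_le_pos; [nra|]. assert (0 < 2 / (gap * gap)) by (apply Rdiv_lt_0_compat; nra). lra. Qed.

Lemma sqnorm_mode_le n x : sqnorm (V n x) <= mode_bound * decay n.
Proof.
assert (d2 : 0 < 2 / (gap * gap)) by (apply Rdiv_lt_0_compat; nra).
destruct (Z.eq_dec n 0) as [->|n0].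
- unfold decay. rewrite Rmult_0_l, Rplus_0_r, Rinv_1, Rmult_1_r, sqnorm_Cmod.
  pose proof (V_bounded 0%Z x). pose proof (Cmod_ge_0 (V 0%Z x)). unfold mode_bound. nra.
- assert (n1 : 1 <= Rabs (IZR n)) by (rewrite <- abs_IZR; apply IZR_le; lia).
  assert (big : gap * Rabs (IZR n) <= Rabs (a * (IZR n + nu))).
  { rewrite Rabs_mult, (Rabs_right a) by lra. unfold gap. rewrite Rmult_assoc. apply Rmult_le_compat_l; [lra|].
    pose proof (Rabs_triang (IZR n + nu) (- nu)) as t. replace (IZR n + nu + - nu) with (IZR n) in t by ring.
    rewrite Rabs_Ropp in t. pose proof (Rabs_pos nu). nra. }
  assert (al0 : a * (IZR n + nu) <> 0) by (intros z; rewrite z, Rabs_R0 in big; nra).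
  apply Rle_trans with (K * K / (a * (IZR n + nu) * (a * (IZR n + nu)))).
  + apply (sqnorm_le_of_linear_ode (V n) (H n) _ (b * (IZR n + nu))); auto. intros y.
    replace ((a * (IZR n + nu), b * (IZR n + nu))%R * V n y)%C with ((a, b) * RtoC (IZR n + nu) * V n y)%C
      by (apply injective_projections; simpl; ring). apply ode.
  + unfold mode_bound, decay. pose proof (Rsqr_abs (a * (IZR n + nu))) as s. unfold Rsqr in s. rewrite s.
    pose proof (Rsqr_abs (IZR n)) as sn. unfold Rsqr in sn. rewrite sn. set (m := Rabs (IZR n)) in *.
    apply Rle_trans with (K * K * / (gap * gap * (1 + m * m) / 2)).
    * unfold Rdiv. apply Rmult_le_compat_l; [nra|]. apply Rinv_le_contravar; [nra|].
      assert (gap * m * (gap * m) <= Rabs (a * (IZR n + nu)) * Rabs (a * (IZR n + nu))) by (apply Rmult_le_compat; nra).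
      assert (gap * gap * (1 + m * m) <= gap * gap * (2 * (m * m))) by (apply Rmult_le_compat_l; nra). lra.
    * replace (/ (gap * gap * (1 + m * m) / 2)) with (2 / (gap * gap) * / (1 + m * m)) by (field; nra).
      rewrite (Rmult_assoc (K * K) (1 + _)). apply Rmult_le_compat_l; [nra|].
      apply Rmult_le_compat_r; [left; apply Rinv_0_lt_compat; nra|lra].
Qed.

Lemma Cmod_mode_le_outside L n x : (1 <= L)%nat -> (Z.of_nat L < Z.abs n)%Z -> Cmod (V n x) <= (1 + mode_bound) / INR L.
Proof.
intros L1 far. apply (le_INR 1) in L1. simpl in L1.
assert (hn : INR L <= Rabs (IZR n)) by (rewrite <- abs_IZR, INR_IZR_INZ; apply IZR_le; lia).
pose proof (Rsqr_abs (IZR n)) as sn. unfold Rsqr in sn.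
assert (d : decay n <= / (INR L * INR L)) by (apply Rinv_le_contravar; nra).
pose proof (sqnorm_mode_le n x) as h. rewrite sqnorm_Cmod in h.
apply Rsqr_incr_0_var; [|apply Rdiv_le_0_compat; lra]. unfold Rsqr.
replace ((1 + mode_bound) / INR L * ((1 + mode_bound) / INR L))
  with ((1 + mode_bound) * (1 + mode_bound) * / (INR L * INR L)) by (field; lra).
apply Rle_trans with (1 := h).
apply Rle_trans with (mode_bound * / (INR L * INR L)); [apply Rmult_le_compat_l; assumption|].
apply Rmult_le_compat_r; [left; apply Rinv_0_lt_compat|]; nra.
Qed.

Let coupling_bound := K + 4 * Ce * (1 + mode_bound).

Lemma box_coupling L n x : (1 <= L)%nat -> (Z.abs n <= Z.of_nat L)%Z ->
  Cmod (H n x - Csum (Zball L) (fun m => e (n + m)%Z * Cconj (V m x)))%C <= coupling_bound / INR L.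
Proof.
intros L1 nL. set (f j := (e j * Cconj (V (j - n)%Z x))%C). set (box := map (Z.add n) (Zball L)).
assert (nbox : NoDup box) by (apply FinFun.Injective_map_NoDup; [intros i j; lia|apply NoDup_Zball]).
assert (split_sum : Csum (Zball (2 * L)) f
  = (Csum (Zball L) (fun m => e (n + m)%Z * Cconj (V m x)) + Csum (list_diff (Zball (2 * L)) box) f)%C).
{ rewrite (Csum_incl_split box (Zball (2 * L))); [|exact nbox|apply NoDup_Zball|].
  2:{ intros k hk. apply in_map_iff in hk. destruct hk as [m [<- hm]]. rewrite In_Zball in *. lia. }
  unfold box at 1. rewrite Csum_map. f_equal. apply Csum_ext. intros m _. unfold f.
  replace (n + m - n)%Z with m by ring. reflexivity. }
assert (rest : Cmod (Csum (list_diff (Zball (2 * L)) box) f) <= 4 * Ce * (1 + mode_bound) / INR L).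
{ apply Rle_trans with (1 := Cmod_Csum_le _ _).
  apply Rle_trans with (Rsum (list_diff (Zball (2 * L)) box) (fun j => (1 + mode_bound) / INR L * Ce * decay j)).
  - apply Rsum_le. intros j hj. apply In_list_diff in hj. destruct hj as [_ out]. unfold f.
    rewrite Cmod_mult, Cmod_conj, Rmult_comm, Rmult_assoc. apply Rmult_le_compat; try apply Cmod_ge_0; [|apply e_decay].
    apply Cmod_mode_le_outside; [exact L1|]. apply Z.lt_nge. intros h. apply out, in_map_iff. exists (j - n)%Z.
    rewrite In_Zball. split; [ring|exact h].
  - rewrite Rsum_scal. replace (4 * Ce * (1 + mode_bound) / INR L) with ((1 + mode_bound) / INR L * Ce * 4)
      by (unfold Rdiv; ring).
    apply Rmult_le_compat_l; [|apply Rsum_decay_le, NoDup_filter, NoDup_Zball].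
    apply Rmult_le_pos; [apply Rdiv_le_0_compat; [lra|apply lt_0_INR; lia]|exact Ce_ge_0]. }
pose proof (H_coupling (2 * L) n x ltac:(lia)) as main. fold f in main. rewrite split_sum in main.
assert (half : K / INR (2 * L) <= K / INR L).
{ unfold Rdiv. apply Rmult_le_compat_l; [exact K_ge_0|].
  apply Rinv_le_contravar; [apply lt_0_INR; lia|apply le_INR; lia]. }
set (s := Csum (Zball L) _) in *. set (r := Csum (list_diff _ _) f) in *.
replace (H n x - s)%C with (H n x - (s + r) + r)%C by ring.
apply Rle_trans with (1 := Cmod_triangle _ _). unfold coupling_bound. rewrite Rdiv_plus_distr. lra.
Qed.

Variable T : nat.
Hypothesis T_ge_1 : (1 <= T)%nat.
Hypothesis T_large : 48 * Ce <= a * INR T.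

Let N := Z.of_nat (T * T).

Let weight (n : Z) : R := Rabs (2 * IZR n - 2 * IZR N - 1).

Let sign_weight n : threshold_sign N n * (2 * IZR n - 2 * IZR N - 1) = weight n /\ 1 <= weight n.
Proof.
unfold threshold_sign, weight. destruct (Z_lt_dec N n) as [h|h].
- assert (IZR N + 1 <= IZR n) by (rewrite <- plus_IZR; apply IZR_le; lia). rewrite Rabs_right by lra. lra.
- assert (IZR n <= IZR N) by (apply IZR_le; lia). rewrite Rabs_left by lra. lra.
Qed.

Let weight_ge_1 n : 1 <= weight n. Proof. apply sign_weight. Qed.

Let rate := a * (2 * IZR N + 1 + 2 * nu).

Let pair_decay (k : Z) : R := Ce * decay k * (if Z_le_dec (Z.abs k) (Z.of_nat T) then / INR T else 1).

Let INR_T_ge_1 : 1 <= INR T. Proof. apply (le_INR 1), T_ge_1. Qed.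

Let rate_gt_0 : 0 < rate.
Proof.
apply Rmult_lt_0_compat; [exact a_gt_0|]. apply Rabs_def2 in nu_small.
assert (1 <= IZR N) by (apply IZR_le; unfold N; nia). lra.
Qed.

Lemma weight_product_ge n m : threshold_sign N n = threshold_sign N m -> (Z.abs (n + m) <= Z.of_nat T)%Z ->
  INR T * INR T <= weight n * weight m.
Proof.
intros same near. pose proof (sign_weight n) as [wn wn1]. pose proof (sign_weight m) as [wm wm1].
assert (eN : IZR N = INR T * INR T) by (unfold N; rewrite <- INR_IZR_INZ; apply mult_INR).
assert (IZR (n + m) <= INR T) as le by (rewrite INR_IZR_INZ; apply IZR_le; lia). rewrite plus_IZR in le.
unfold threshold_sign in *. destruct (Z_lt_dec N n), (Z_lt_dec N m); try lra.
- exfalso. assert (Z.of_nat T <= N)%Z by (unfold N; nia). lia.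
- assert ((weight n - 1) * (weight m - 1) >= 0) by nra. nra.
Qed.

(* Modes on the same side of the threshold have indices with a large sum or large weights. *)
Lemma pair_coupling_ge n m x :
  (threshold_sign N n + threshold_sign N m) * fst (e (n + m)%Z * Cconj (V n x) * Cconj (V m x))%C
  >= - (pair_decay (n + m) * (weight n * sqnorm (V n x) + weight m * sqnorm (V m x))).
Proof.
set (p := (e (n + m)%Z * Cconj (V n x) * Cconj (V m x))%C).
assert (pd0 : 0 <= pair_decay (n + m)).
{ unfold pair_decay. pose proof (decay_gt_0 (n + m)). apply Rmult_le_pos; [apply Rmult_le_pos; lra|].
  destruct Z_le_dec; [left; apply Rinv_0_lt_compat|]; lra. }
pose proof (weight_ge_1 n) as wn. pose proof (weight_ge_1 m) as wm.
pose proof (sqnorm_ge_0 (V n x)). pose proof (sqnorm_ge_0 (V m x)).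
assert (mono : 0 <= pair_decay (n + m) * (weight n * sqnorm (V n x) + weight m * sqnorm (V m x)))
  by (apply Rmult_le_pos; nra).
destruct (Req_dec (threshold_sign N n) (threshold_sign N m)) as [same|opposite].
2:{ replace (threshold_sign N n + threshold_sign N m) with 0; [lra|].
    unfold threshold_sign in *. destruct Z_lt_dec, Z_lt_dec; lra. }
assert (pb : 2 * Cmod p <= pair_decay (n + m) * (weight n * sqnorm (V n x) + weight m * sqnorm (V m x))).
{ unfold p. rewrite !Cmod_mult, !Cmod_conj, !sqnorm_Cmod. pose proof (e_decay (n + m)) as ed.
  set (y := Cmod (V n x)) in *. set (z := Cmod (V m x)) in *.
  assert (0 <= y) by apply Cmod_ge_0. assert (0 <= z) by apply Cmod_ge_0.
  apply Rle_trans with (Ce * decay (n + m) * (2 * (y * z))); [assert (0 <= y * z) by nra; nra|].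
  unfold pair_decay. rewrite (Rmult_assoc (Ce * decay (n + m))).
  apply Rmult_le_compat_l; [pose proof (decay_gt_0 (n + m)); nra|]. destruct Z_le_dec as [near|far].
  - apply Rmult_le_reg_l with (INR T); [lra|]. rewrite <- (Rmult_assoc (INR T) (/ INR T)), Rinv_r, Rmult_1_l by lra.
    replace (INR T * (2 * (y * z))) with (2 * INR T * (y * z)) by ring.
    apply weighted_amgm; [lra|]. apply weight_product_ge; assumption.
  - pose proof (weighted_amgm 1 1 1 y z ltac:(lra) ltac:(lra)). nra. }
assert (range : Rabs (fst p) <= Cmod p) by apply Rabs_fst_le_Cmod. apply Rabs_le_between in range.
unfold threshold_sign in *. destruct Z_lt_dec, Z_lt_dec; lra.
Qed.

Let error := 12 * (coupling_bound * coupling_bound) / a.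

Section Truncation.
Variable L : nat.
Hypothesis L_ge_1 : (1 <= L)%nat.

Let weighted_energy x : R := Rsum (Zball L) (fun n => weight n * sqnorm (V n x)).

Lemma Rsum_pair_decay_le n : Rsum (Zball L) (fun m => pair_decay (n + m)) <= 6 * Ce / INR T.
Proof.
rewrite <- (Rsum_map (Zball L) (Z.add n) pair_decay). set (box := map (Z.add n) (Zball L)).
assert (nbox : NoDup box) by (apply FinFun.Injective_map_NoDup; [intros i j; lia|apply NoDup_Zball]).
set (near k := if Z_le_dec (Z.abs k) (Z.of_nat T) then true else false).
rewrite (Rsum_filter near box).
rewrite (Rsum_ext (filter near box) _ (fun k => Ce * / INR T * decay k)).
2:{ intros k hk. apply filter_In in hk. destruct hk as [_ hk]. unfold pair_decay, near in *.
    destruct Z_le_dec; [ring|discriminate]. }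
rewrite (Rsum_ext (filter (fun k => negb (near k)) box) _ (fun k => Ce * decay k)).
2:{ intros k hk. apply filter_In in hk. destruct hk as [_ hk]. unfold pair_decay, near in *.
    destruct Z_le_dec; [discriminate|ring]. }
rewrite !Rsum_scal. replace (6 * Ce / INR T) with (Ce * / INR T * 4 + Ce * (2 / INR T)) by (unfold Rdiv; ring).
apply Rplus_le_compat.
- apply Rmult_le_compat_l; [|apply Rsum_decay_le, NoDup_filter, nbox].
  apply Rmult_le_pos; [exact Ce_ge_0|left; apply Rinv_0_lt_compat; lra].
- apply Rmult_le_compat_l; [exact Ce_ge_0|]. apply Rsum_decay_tail; [exact T_ge_1|apply NoDup_filter, nbox|].
  intros k hk. apply filter_In in hk. destruct hk as [_ hk]. unfold near in hk. destruct Z_le_dec; [discriminate|lia].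
Qed.

(* Exchanging the two indices cancels the terms with indices on opposite sides of the threshold. *)
Lemma coupling_energy_ge x :
  Rsum (Zball L) (fun n => threshold_sign N n *
    (2 * fst (Cconj (V n x) * Csum (Zball L) (fun m => e (n + m)%Z * Cconj (V m x)))%C))
  >= - (a / 4 * weighted_energy x).
Proof.
set (p n m := fst (e (n + m)%Z * Cconj (V n x) * Cconj (V m x))%C).
assert (p_sym : forall n m, p n m = p m n) by (intros n m; unfold p; rewrite (Z.add_comm n m); simpl; ring).
set (S := Rsum (Zball L) (fun n => Rsum (Zball L) (fun m => threshold_sign N n * p n m))).
assert (expand : Rsum (Zball L) (fun n => threshold_sign N n *
    (2 * fst (Cconj (V n x) * Csum (Zball L) (fun m => e (n + m)%Z * Cconj (V m x)))%C)) = 2 * S).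
{ unfold S. rewrite <- Rsum_scal. apply Rsum_ext. intros n _. rewrite Rsum_scal, <- Csum_scal.
  unfold Csum. cbn [fst].
  rewrite (Rsum_ext _ _ (p n)) by (intros m _; unfold p; simpl; ring). ring. }
assert (symmetrized : 2 * S = Rsum (Zball L) (fun n => Rsum (Zball L) (fun m =>
    (threshold_sign N n + threshold_sign N m) * p n m))).
{ replace (2 * S) with (S + S) by ring. unfold S at 2. rewrite Rsum_exchange. unfold S. rewrite <- Rsum_plus.
  apply Rsum_ext. intros n _. rewrite <- Rsum_plus. apply Rsum_ext. intros m _. rewrite (p_sym m n). ring. }
rewrite expand, symmetrized. set (y n := weight n * sqnorm (V n x)).
assert (y0 : forall n, 0 <= y n).
{ intros n. unfold y. pose proof (weight_ge_1 n). pose proof (sqnorm_ge_0 (V n x)). nra. }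
apply Rle_ge. rewrite Ropp_mult_distr_l.
apply Rle_trans with (Rsum (Zball L) (fun n => Rsum (Zball L) (fun m => -1 * (pair_decay (n + m) * (y n + y m))))).
2:{ apply Rsum_le. intros n _. apply Rsum_le. intros m _. pose proof (pair_coupling_ge n m x). unfold y, p. lra. }
assert (row : Rsum (Zball L) (fun n => Rsum (Zball L) (fun m => pair_decay (n + m) * y n))
  <= 6 * Ce / INR T * weighted_energy x).
{ unfold weighted_energy. rewrite <- Rsum_scal. apply Rsum_le. intros n _.
  rewrite (Rsum_ext _ _ (fun m => y n * pair_decay (n + m))), Rsum_scal by (intros; ring). rewrite Rmult_comm.
  apply Rmult_le_compat_r; [apply y0|apply Rsum_pair_decay_le]. }
rewrite (Rsum_ext _ _ (fun n => -1 * (Rsum (Zball L) (fun m => pair_decay (n + m) * y n) +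
  Rsum (Zball L) (fun m => pair_decay (m + n) * y m)))).
2:{ intros n _. rewrite Rsum_scal, <- Rsum_plus. f_equal. apply Rsum_ext. intros m _. rewrite (Z.add_comm m n). ring. }
rewrite Rsum_scal, Rsum_plus, (Rsum_exchange _ _ (fun n m => pair_decay (m + n) * y m)).
assert (0 <= weighted_energy x) by (apply Rsum_ge_0; intros; apply y0).
assert (small : 6 * Ce / INR T <= a / 8) by (apply Rle_div_l; lra).
assert (6 * Ce / INR T * weighted_energy x <= a / 8 * weighted_energy x) by (apply Rmult_le_compat_r; assumption).
lra.
Qed.

Let signed_energy' x : R := Rsum (Zball L) (fun n => threshold_sign N n *
  (2 * fst (Cconj (V n x) * ((a, b) * RtoC (IZR n + nu) * V n x + H n x))%C)).

Lemma derivable_pt_lim_signed_energy x : derivable_pt_lim (signed_energy N V L) x (signed_energy' x).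
Proof.
apply (derivable_pt_lim_Rsum _ (fun n x => threshold_sign N n * sqnorm (V n x)) (fun n x => threshold_sign N n *
  (2 * fst (Cconj (V n x) * ((a, b) * RtoC (IZR n + nu) * V n x + H n x))%C))).
intros n. apply (derivable_pt_lim_scal (fun x => sqnorm (V n x))), derivable_pt_lim_sqnorm, ode.
Qed.

Lemma coupling_error_ge n x : (Z.abs n <= Z.of_nat L)%Z ->
  threshold_sign N n * (2 * fst (Cconj (V n x) * (H n x - Csum (Zball L) (fun m => e (n + m)%Z * Cconj (V m x))))%C)
  >= - (a / 4 * (weight n * sqnorm (V n x)) + 4 * (coupling_bound * coupling_bound) / a / (INR L * INR L)).
Proof.
intros nL. pose proof (box_coupling L n x L_ge_1 nL) as bc.
set (d := (H n x - Csum (Zball L) (fun m => e (n + m)%Z * Cconj (V m x)))%C) in *.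
pose proof (Rabs_fst_le_Cmod (Cconj (V n x) * d)%C) as range. rewrite Cmod_mult, Cmod_conj in range.
apply Rabs_le_between in range. assert (L1 : 1 <= INR L) by apply (le_INR 1), L_ge_1.
rewrite sqnorm_Cmod. set (y := Cmod (V n x)) in *. assert (y0 : 0 <= y) by apply Cmod_ge_0.
pose proof (weight_ge_1 n) as wn.
assert (amgm : 2 * 1 * (y * (coupling_bound / INR L))
    <= a / 4 * (y * y) + 4 / a * (coupling_bound / INR L * (coupling_bound / INR L)))
  by (apply weighted_amgm; [lra|right; field; lra]).
replace (4 * (coupling_bound * coupling_bound) / a / (INR L * INR L))
  with (4 / a * (coupling_bound / INR L * (coupling_bound / INR L))) by (field; lra).
assert (y * Cmod d <= y * (coupling_bound / INR L)) by (apply Rmult_le_compat_l; assumption).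
assert (a / 4 * (y * y) <= a / 4 * (weight n * (y * y))) by (apply Rmult_le_compat_l; nra).
unfold threshold_sign. destruct Z_lt_dec; lra.
Qed.

Lemma signed_energy_growth x :
  rate * signed_energy N V L x + a / 2 * weighted_energy x - error / INR L <= signed_energy' x.
Proof.
assert (L1 : 1 <= INR L) by apply (le_INR 1), L_ge_1.
set (E n := fst (Cconj (V n x) * (H n x - Csum (Zball L) (fun m => e (n + m)%Z * Cconj (V m x))))%C).
assert (decompose : signed_energy' x = rate * signed_energy N V L x + a * weighted_energy x
  + Rsum (Zball L) (fun n => threshold_sign N n *
      (2 * fst (Cconj (V n x) * Csum (Zball L) (fun m => e (n + m)%Z * Cconj (V m x)))%C))
  + Rsum (Zball L) (fun n => threshold_sign N n * (2 * E n))).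
{ unfold signed_energy, weighted_energy, signed_energy'. rewrite <- !Rsum_scal, <- !Rsum_plus. apply Rsum_ext.
  intros n _. rewrite <- (proj1 (sign_weight n)). unfold E, rate, sqnorm. simpl. ring. }
assert (errors : Rsum (Zball L) (fun n => threshold_sign N n * (2 * E n))
  >= - (a / 4 * weighted_energy x) - error / INR L).
{ apply Rle_ge. apply Rle_trans with (Rsum (Zball L) (fun n =>
    -1 * (a / 4 * (weight n * sqnorm (V n x)) + 4 * (coupling_bound * coupling_bound) / a / (INR L * INR L) * 1))).
  - rewrite Rsum_scal, Rsum_plus, !Rsum_scal, Rsum_Zball_1. fold (weighted_energy x). unfold error.
    assert (4 * (coupling_bound * coupling_bound) / a / (INR L * INR L) * (2 * INR L + 1)
      <= 12 * (coupling_bound * coupling_bound) / a / INR L); [|lra].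
    replace (12 * (coupling_bound * coupling_bound) / a / INR L)
      with (4 * (coupling_bound * coupling_bound) / a / (INR L * INR L) * (3 * INR L)) by (field; lra).
    apply Rmult_le_compat_l; [|lra]. apply Rdiv_le_0_compat; [apply Rdiv_le_0_compat; nra|nra].
  - apply Rsum_le. intros n hn. apply In_Zball in hn. pose proof (coupling_error_ge n x hn). unfold E. lra. }
pose proof (coupling_energy_ge x). lra.
Qed.

Lemma weighted_energy_ge n x : (Z.abs n <= Z.of_nat L)%Z -> sqnorm (V n x) <= weighted_energy x.
Proof.
intros nL. assert (y0 : forall n, sqnorm (V n x) <= weight n * sqnorm (V n x)).
{ intros k. pose proof (weight_ge_1 k). pose proof (sqnorm_ge_0 (V k x)). nra. }
apply Rle_trans with (1 := y0 n). apply (Rsum_In_le _ (fun n => weight n * sqnorm (V n x))); [|apply In_Zball, nL].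
intros k _. apply Rle_trans with (1 := sqnorm_ge_0 (V k x)), y0.
Qed.

Lemma signed_energy_le x : signed_energy N V L x <= error / rate / INR L.
Proof.
assert (L1 : 1 <= INR L) by apply (le_INR 1), L_ge_1. apply Rminus_le.
assert (error0 : 0 <= error / rate / INR L).
{ unfold error. repeat apply Rdiv_le_0_compat; try lra. nra. }
assert (W0 : forall x, 0 <= weighted_energy x).
{ intros y. apply Rle_trans with (1 := sqnorm_ge_0 (V 0%Z y)), weighted_energy_ge. lia. }
apply (bounded_above_growth_le_0 (fun x => signed_energy N V L x - error / rate / INR L)
  (fun x => signed_energy' x - 0) rate (mode_bound * 4) rate_gt_0).
- intros y. apply derivable_pt_lim_minus; [apply derivable_pt_lim_signed_energy|apply derivable_pt_lim_const].
- intros y. pose proof (signed_energy_growth y). specialize (W0 y).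
  replace (rate * (signed_energy N V L y - error / rate / INR L)) with (rate * signed_energy N V L y - error / INR L)
    by (field; lra).
  nra.
- intros y. assert (le : signed_energy N V L y <= Rsum (Zball L) (fun n => mode_bound * decay n)).
  { apply Rsum_le. intros n _. pose proof (sqnorm_mode_le n y). pose proof (sqnorm_ge_0 (V n y)).
    unfold threshold_sign. destruct Z_lt_dec; lra. }
  rewrite Rsum_scal in le. pose proof (Rsum_decay_le (Zball L) (NoDup_Zball L)). nra.
Qed.

Lemma sqnorm_segment_le n c x h m : (Z.abs n <= Z.of_nat L)%Z -> - (c / INR L) <= signed_energy N V L 0 ->
  0 <= x -> 0 <= h -> (forall y, x <= y <= x + h -> m <= sqnorm (V n y)) ->
  a / 2 * m * h <= (c + error / rate) * exp (rate * (x + h)) * (1 + rate * h) / INR L.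
Proof.
intros nL start x0 h0 ym. assert (L1 : 1 <= INR L) by apply (le_INR 1), L_ge_1.
set (z x := signed_energy N V L x - error / rate / INR L). set (G := c + error / rate). set (E := exp (rate * (x + h))).
assert (z_le_0 : forall y, z y <= 0) by (intros y; unfold z; pose proof (signed_energy_le y); lra).
assert (dz : forall y, derivable_pt_lim z y (signed_energy' y - 0)).
{ intros y. apply derivable_pt_lim_minus; [apply derivable_pt_lim_signed_energy|apply derivable_pt_lim_const]. }
assert (growth : forall y, rate * z y + a / 2 * weighted_energy y <= signed_energy' y - 0).
{ intros y. pose proof (signed_energy_growth y) as g. unfold z.
  replace (rate * (signed_energy N V L y - error / rate / INR L)) with (rate * signed_energy N V L y - error / INR L)
    by (field; lra).
  lra. }
assert (W0 : forall n y, (Z.abs n <= Z.of_nat L)%Z -> 0 <= sqnorm (V n y) <= weighted_energy y).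
{ intros k y kL. split; [apply sqnorm_ge_0|apply weighted_energy_ge, kL]. }
assert (G0 : - (G / INR L) <= z 0) by (unfold z, G; unfold Rdiv in *; lra).
assert (lower : forall y, 0 <= y -> y <= x + h -> - (G / INR L * E) <= z y).
{ intros y y0 yx. pose proof (exponential_growth z _ rate 0 y dz) as g. rewrite Rminus_0_r in g.
  specialize (g ltac:(intros s; pose proof (growth s); pose proof (W0 n s nL); nra) y0).
  apply Rle_trans with (2 := g). apply Rle_trans with (- (G / INR L) * exp (rate * y));
    [|apply Rmult_le_compat_r; [left; apply exp_pos|exact G0]].
  rewrite Ropp_mult_distr_l_reverse. apply Ropp_le_contravar, Rmult_le_compat_l; [pose proof (z_le_0 0); lra|].
  destruct yx as [yx| ->]; [|apply Rle_refl]. left. apply exp_increasing, Rmult_lt_compat_l; assumption. }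
pose proof (increment_ge_of_derivative z _ (a / 2 * m - rate * (G / INR L * E)) x (x + h) ltac:(lra) (fun y _ => dz y))
  as incr.
assert (slope : forall y, x <= y <= x + h -> a / 2 * m - rate * (G / INR L * E) <= signed_energy' y - 0).
{ intros y hy. apply Rle_trans with (2 := growth y). pose proof (lower y ltac:(lra) ltac:(lra)) as lo.
  pose proof (W0 n y nL).
  specialize (ym y hy). assert (a / 2 * m <= a / 2 * weighted_energy y) by (apply Rmult_le_compat_l; lra).
  apply Rmult_le_compat_l with (r := rate) in lo; lra. }
specialize (incr slope). pose proof (z_le_0 (x + h)). pose proof (lower x x0 ltac:(lra)).
replace (G * E * (1 + rate * h) / INR L) with (G / INR L * E + rate * (G / INR L * E) * h) by (field; lra). lra.
Qed.
End Truncation.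

Lemma modes_vanish_on_half_line c : (forall L, (1 <= L)%nat -> - (c / INR L) <= signed_energy N V L 0) ->
  forall n x, 0 <= x -> V n x = RtoC 0.
Proof.
intros start n x x0. apply sqnorm_eq_0. destruct (sqnorm_ge_0 (V n x)) as [pos|<-]; [exfalso|reflexivity].
set (m := sqnorm (V n x) / 2).
destruct (continuity_pt_delta (fun x => sqnorm (V n x)) x m) as [h [h0 near]].
{ eapply derivable_pt_lim_continuity_pt, derivable_pt_lim_sqnorm, ode. }
{ unfold m. lra. }
set (Q := (c + error / rate) * exp (rate * (x + h / 2)) * (1 + rate * (h / 2))).
destruct (INR_unbounded (Q / (a / 2 * m * (h / 2)))) as [L0 large]. set (L := (L0 + Z.to_nat (Z.abs n) + 1)%nat).
assert (gain_gt_0 : 0 < a / 2 * m * (h / 2)) by (repeat apply Rmult_lt_0_compat; unfold m; lra).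
assert (L1 : INR L0 < INR L) by (apply lt_INR; lia).
pose proof (sqnorm_segment_le L ltac:(lia) n c x (h / 2) m ltac:(lia) (start L ltac:(lia)) x0 ltac:(lra)) as seg.
apply Rlt_div_l in large; [|exact gain_gt_0]. fold Q in seg.
apply Rle_not_lt with (1 := seg ltac:(intros y hy; specialize (near y ltac:(apply Rabs_def1; lra));
  apply Rabs_def2 in near; unfold m in *; lra)).
apply Rlt_div_l; [pose proof (pos_INR L0); lra|]. rewrite Rmult_comm. nra.
Qed.
End Energy.

Lemma mode_system_finitely_determined a b nu e Ce : 0 < a -> Rabs nu < 1 -> (forall k, Cmod (e k) <= Ce * decay k) ->
  exists N, forall V, mode_system a b nu e V -> (forall n, (Z.abs n <= N)%Z -> V n 0 = RtoC 0) ->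
    forall n x, V n x = RtoC 0.
Proof.
intros a0 nu1 eCe. destruct (INR_unbounded (48 * Ce / a)) as [T hT]. apply Rlt_div_l in hT; [|exact a0].
assert (T_large : 48 * Ce <= a * INR (S T)) by (rewrite S_INR; nra).
assert (nu1' : Rabs (- nu) < 1) by (rewrite Rabs_Ropp; exact nu1).
assert (eCe' : forall k, Cmod (- e (- k)%Z)%C <= Ce * decay k).
{ intros k. rewrite Cmod_opp. replace (decay k) with (decay (- k)) by (unfold decay; rewrite opp_IZR; f_equal; ring).
  apply eCe. }
set (T' := S T) in *. exists (Z.of_nat (T' * T')). intros V sys start. set (U n x := V (- n)%Z (- x)).
assert (opposite : forall L, signed_energy (Z.of_nat (T' * T')) V L 0 = - signed_energy (Z.of_nat (T' * T')) U L 0).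
{ intros L. unfold signed_energy, U.
  rewrite <- (Rsum_Zball_opp L (fun n => threshold_sign _ n * sqnorm (V n 0))).
  apply Rminus_diag_uniq. unfold Rminus.
  rewrite Ropp_involutive, <- Rsum_plus, (Rsum_ext _ _ (fun _ => 0)); [apply Rsum_0|].
  intros n _. rewrite Ropp_0. destruct (Z_le_gt_dec (Z.abs n) (Z.of_nat (T' * T'))) as [h|h].
  - rewrite (start (- n)%Z) by lia. unfold sqnorm. simpl. ring.
  - unfold threshold_sign. destruct Z_lt_dec, Z_lt_dec; try lia; ring. }
pose proof (mode_system_reflect a b nu e V sys) as [H' [K' [ode' [VK' [HK' coupling']]]]].
destruct sys as [H [K [ode [VK [HK coupling]]]]].
assert (T1 : (1 <= T')%nat) by (unfold T'; lia).
assert (V0 : forall n x, 0 <= x -> V n x = RtoC 0).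
{ eapply (modes_vanish_on_half_line a b nu e V H Ce K a0 nu1 eCe ode VK HK coupling T' T1 T_large).
  intros L L1. rewrite opposite.
  pose proof (signed_energy_le a b (- nu) _ U H' Ce K' a0 nu1' eCe' ode' VK' HK' coupling' T' T1 T_large L L1 0) as le.
  apply Ropp_le_contravar in le. exact le. }
assert (U0 : forall n x, 0 <= x -> U n x = RtoC 0).
{ eapply (modes_vanish_on_half_line a b (- nu) _ U H' Ce K' a0 nu1' eCe' ode' VK' HK' coupling' T' T1 T_large).
  intros L L1. rewrite <- (Ropp_involutive (signed_energy _ U _ _)), <- opposite.
  pose proof (signed_energy_le a b nu e V H Ce K a0 nu1 eCe ode VK HK coupling T' T1 T_large L L1 0) as le.
  apply Ropp_le_contravar in le. exact le. }
intros n x. destruct (Rle_lt_dec 0 x) as [h|h]; [apply V0, h|].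
specialize (U0 (- n)%Z (- x) ltac:(lra)). unfold U in U0. rewrite Z.opp_involutive, Ropp_involutive in U0. exact U0.
Qed.

(** * Fourier modes of a bounded solution on the strip *)

Lemma continuity_pt_of_sequences f x : (forall u, Un_cv u x -> Un_cv (fun n => f (u n)) (f x)) -> continuity_pt f x.
Proof.
intros seqf eps e0. apply NNPP. intros none.
assert (far : forall n, exists y, Rabs (y - x) <= RinvN n /\ eps <= Rabs (f y - f x)).
{ intros n. apply NNPP. intros near. apply none. exists (RinvN n). split; [apply cond_pos|]. intros y [_ hy].
  simpl in hy. unfold Rdist in *. apply Rnot_le_lt. intros h. apply near. exists y. split; [left; exact hy|exact h]. }
destruct (boolp.choice far) as [u hu].
destruct (seqf u (Un_cv_squeeze u RinvN x (fun n => proj1 (hu n)) RinvN_cv) eps e0) as [n hn].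
specialize (hn n (Nat.le_refl n)). apply (Rlt_not_le _ _ hn), hu.
Qed.

Lemma continuity_integral g M c d : (forall t, continuity (fun x => g x t)) -> (forall x, continuity (g x)) ->
  (forall x t, Rabs (g x t) <= M) -> continuity (fun x => integral c d (g x)).
Proof.
intros g1 g2 gM x. apply continuity_pt_of_sequences. intros u ux.
apply (integral_lim c d (fun n => g (u n)) (g x) M); auto.
- intros n. apply (bmeasurable_continuity _ M); auto.
- apply (bmeasurable_continuity _ M); auto.
- intros t _. apply (continuity_seq (fun x => g x t)); [apply g1|exact ux].
Qed.

Lemma derivable_pt_lim_integral_flux P S g Px Pt Sx St M c d :
  (forall x t, Rabs (P x t) <= M) -> (forall x t, Rabs (S x t) <= M) -> (forall x t, Rabs (g x t) <= M) ->
  (forall x t, derivable_pt_lim (fun x => P x t) x (Px x t)) -> (forall x t, derivable_pt_lim (P x) t (Pt x t)) ->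
  (forall x t, derivable_pt_lim (fun x => S x t) x (Sx x t)) -> (forall x t, derivable_pt_lim (S x) t (St x t)) ->
  (forall x t, Px x t + St x t = g x t) -> (forall t, continuity (fun x => g x t)) -> (forall x, continuity (g x)) ->
  c <= d -> (forall x, S x d = S x c) ->
  forall x, derivable_pt_lim (fun x => integral c d (P x)) x (integral c d (g x)).
Proof.
intros PM SM gM dP1 dP2 dS1 dS2 div g1 g2 cd closed.
pose proof (bmeasurable2_separate_continuity g M g1 g2 gM) as bg.
assert (bP : forall x, bmeasurable (P x)).
{ intros x. apply (bmeasurable_continuity _ M); [|apply PM]. intros t.
  exact (derivable_pt_lim_continuity_pt _ _ _ (dP2 x t)). }
apply derivable_pt_lim_of_integral.
- apply bmeasurable2_integral2, bg.
- apply (continuity_integral g M); assumption.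
- intros x y xy. pose proof (divergence_theorem P S g Px Pt Sx St M PM SM gM dP1 dP2 dS1 dS2 div g1 g2 x y c d xy cd)
    as zero.
  unfold flux_defect in zero. rewrite integral_minus, integral2_swap in zero by auto.
  rewrite (integral_ext x y _ (fun _ => 0)) in zero by (intros s; rewrite closed; ring).
  rewrite integral_const, Rmult_0_l, Rplus_0_r in zero by exact xy. apply Rminus_diag_uniq. exact zero.
Qed.

Lemma Cderiv_at_Cintegral_flux P S g Px Pt Sx St M c d :
  (forall x t, Cmod (P x t) <= M) -> (forall x t, Cmod (S x t) <= M) -> (forall x t, Cmod (g x t) <= M) ->
  (forall x t, Cderiv_at (fun x => P x t) x (Px x t)) -> (forall x t, Cderiv_at (P x) t (Pt x t)) ->
  (forall x t, Cderiv_at (fun x => S x t) x (Sx x t)) -> (forall x t, Cderiv_at (S x) t (St x t)) ->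
  (forall x t, (Px x t + St x t)%C = g x t) -> (forall t, Ccontinuous (fun x => g x t)) ->
  (forall x, Ccontinuous (g x)) ->
  c <= d -> (forall x, S x d = S x c) ->
  forall x, Cderiv_at (fun x => Cintegral c d (P x)) x (Cintegral c d (g x)).
Proof.
intros PM SM gM dP1 dP2 dS1 dS2 div g1 g2 cd closed.
assert (component : forall pr : C -> R, (forall z, Rabs (pr z) <= Cmod z) -> (forall z w, pr (z + w)%C = pr z + pr w) ->
  (forall f x l, Cderiv_at f x l -> derivable_pt_lim (fun s => pr (f s)) x (pr l)) ->
  (forall f, Ccontinuous f -> continuity (fun s => pr (f s))) ->
  forall x, derivable_pt_lim (fun x => integral c d (fun t => pr (P x t))) x (integral c d (fun t => pr (g x t)))).
{ intros pr pr_le pr_plus pr_deriv pr_cont.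
  assert (bound : forall f : R -> R -> C, (forall x t, Cmod (f x t) <= M) -> forall x t, Rabs (pr (f x t)) <= M)
    by (intros f fM x t; apply Rle_trans with (1 := pr_le _), fM).
  apply (derivable_pt_lim_integral_flux (fun x t => pr (P x t)) (fun x t => pr (S x t)) (fun x t => pr (g x t))
    (fun x t => pr (Px x t)) (fun x t => pr (Pt x t)) (fun x t => pr (Sx x t)) (fun x t => pr (St x t)) M);
      try (apply bound; assumption); try assumption.
  - intros x t. apply (pr_deriv (fun x => P x t)), dP1.
  - intros x t. apply (pr_deriv (P x)), dP2.
  - intros x t. apply (pr_deriv (fun x => S x t)), dS1.
  - intros x t. apply (pr_deriv (S x)), dS2.
  - intros x t. rewrite <- div, pr_plus. reflexivity.
  - intros t. apply (pr_cont (fun x => g x t)), g1.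
  - intros x. apply (pr_cont (g x)), g2.
  - intros x. rewrite closed. reflexivity. }
intros x. split; apply component; first [exact Rabs_fst_le_Cmod | exact Rabs_snd_le_Cmod | reflexivity | idtac];
  first [intros f y l df; apply df | intros f cf; apply cf].
Qed.

(* The equation [L u = 0] in the variable [x = ln r], with [e = i c]. *)
Definition strip_solution (lam : C) (nu : R) (e : R -> C) (v : R -> R -> C) : Prop :=
  (forall x, periodic (v x)) /\ (exists M, forall x t, Cmod (v x t) <= M) /\
  exists vx vt : R -> R -> C, forall x t, Cderiv_at (fun x => v x t) x (vx x t) /\ Cderiv_at (v x) t (vt x t) /\
    vx x t = (- (Ci * lam * vt x t) + lam * RtoC nu * v x t + e t * Cconj (v x t))%C.

Section StripModes.
Variables (lam : C) (nu : R) (e e' : R -> C) (Ce : R).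
Hypothesis e_derivative : forall t, Cderiv_at e t (e' t).
Hypothesis e_periodic : periodic e.
Hypothesis e_decay : forall n, Cmod (coef e n) <= Ce * decay n.

Let e_continuous : Ccontinuous e. Proof. exact (Cderiv_at_Ccontinuous e e' e_derivative). Qed.

Variables (Me M : R) (v vx vt : R -> R -> C).
Hypothesis e_bounded : forall t, Cmod (e t) <= Me.
Hypothesis v_bounded : forall x t, Cmod (v x t) <= M.
Hypothesis v_periodic : forall x, periodic (v x).
Hypothesis v_derivative1 : forall x t, Cderiv_at (fun x => v x t) x (vx x t).
Hypothesis v_derivative2 : forall x t, Cderiv_at (v x) t (vt x t).
Hypothesis equation : forall x t,
  vx x t = (- (Ci * lam * vt x t) + lam * RtoC nu * v x t + e t * Cconj (v x t))%C.

Let v_continuous1 t : Ccontinuous (fun x => v x t).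
Proof. exact (Cderiv_at_Ccontinuous _ _ (fun x => v_derivative1 x t)). Qed.

Let v_continuous2 x : Ccontinuous (v x). Proof. exact (Cderiv_at_Ccontinuous _ _ (v_derivative2 x)). Qed.

Let bmeas_v x : Cbmeasurable (v x). Proof. apply (Cbmeasurable_continuous _ M); auto. Qed.

Let bmeas_e : Cbmeasurable e. Proof. apply (Cbmeasurable_continuous _ Me); auto. Qed.

Let Me_ge_0 : 0 <= Me. Proof. apply Rle_trans with (1 := Cmod_ge_0 (e 0)), e_bounded. Qed.

Let M_ge_0 : 0 <= M. Proof. apply Rle_trans with (1 := Cmod_ge_0 (v 0 0)), v_bounded. Qed.

Definition forcing n x : C := coef (fun t => e t * Cconj (v x t))%C n.

Let mu n : C := (lam * RtoC (IZR n + nu))%C.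

Let flux_divergence n x t : C := ((mu n * v x t + e t * Cconj (v x t)) * mode (- n) t)%C.

(* Multiplied by a mode the equation is in divergence form, with flux [(v mode, i lam v mode)]. *)
Lemma mode_divergence n x t :
  (vx x t * mode (- n) t
   + Ci * lam * (vt x t * mode (- n) t + v x t * (Ci * RtoC (IZR (- n)) * mode (- n) t)))%C = flux_divergence n x t.
Proof.
unfold flux_divergence, mu. rewrite equation, opp_IZR, RtoC_opp, RtoC_plus.
assert (i2 : (Ci * Ci)%C = (- RtoC 1)%C) by (apply injective_projections; simpl; ring).
match goal with |- ?l = ?r =>
  replace l with (r - (Ci * Ci + RtoC 1) * lam * RtoC (IZR n) * v x t * mode (- n) t)%C by ring
end.
rewrite i2. ring.
Qed.

Lemma Cmod_flux_divergence_le n x t : Cmod (flux_divergence n x t) <= Cmod (mu n) * M + Me * M.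
Proof.
unfold flux_divergence. rewrite Cmod_mult, Cmod_mode, Rmult_1_r. apply Rle_trans with (1 := Cmod_triangle _ _).
rewrite (Cmod_mult (mu n)), (Cmod_mult (e t)), Cmod_conj.
apply Rplus_le_compat; apply Rmult_le_compat; try apply Cmod_ge_0; auto. apply Rle_refl.
Qed.

Lemma mode_ode n x : Cderiv_at (fun x => coef (v x) n) x (lam * RtoC (IZR n + nu) * coef (v x) n + forcing n x)%C.
Proof.
pose proof PI2_gt_0. pose proof (bmeas_v x) as bv. fold (mu n).
replace (mu n * coef (v x) n + forcing n x)%C
  with (RtoC (/ (2 * PI)) * Cintegral 0 (2 * PI) (flux_divergence n x))%C.
2:{ unfold forcing. rewrite <- coef_scal, <- coef_plus by Cbmeas. reflexivity. }
apply Cderiv_at_scal. set (F x t := (v x t * mode (- n) t)%C). set (Fx x t := (vx x t * mode (- n) t)%C).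
set (Ft x t := (vt x t * mode (- n) t + v x t * (Ci * RtoC (IZR (- n)) * mode (- n) t))%C).
assert (dF1 : forall x t, Cderiv_at (fun x => F x t) x (Fx x t)).
{ intros y t. apply (Cderiv_at_scal_r (fun x => v x t)), v_derivative1. }
assert (dF2 : forall x t, Cderiv_at (F x) t (Ft x t)).
{ intros y t. apply Cderiv_at_mult; [apply v_derivative2|apply Cderiv_at_mode]. }
assert (F_bounded : forall x t, Cmod (F x t) <= M).
{ intros y t. unfold F. rewrite Cmod_mult, Cmod_mode, Rmult_1_r. apply v_bounded. }
assert (mu0 : 0 <= Cmod (mu n) * M + Me * M)
  by exact (Rle_trans _ _ _ (Cmod_ge_0 _) (Cmod_flux_divergence_le n 0 0)).
assert (lam0 : 0 <= Cmod (Ci * lam)%C * M) by (apply Rmult_le_pos; [apply Cmod_ge_0|exact M_ge_0]).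
apply (Cderiv_at_Cintegral_flux F (fun x t => Ci * lam * F x t)%C (flux_divergence n) Fx Ft
  (fun x t => Ci * lam * Fx x t)%C (fun x t => Ci * lam * Ft x t)%C
  (M + Cmod (Ci * lam)%C * M + (Cmod (mu n) * M + Me * M))).
- intros y t. pose proof (F_bounded y t). lra.
- intros y t. rewrite (Cmod_mult (Ci * lam)).
  pose proof (Rmult_le_compat_l _ _ _ (Cmod_ge_0 (Ci * lam)) (F_bounded y t)). lra.
- intros y t. pose proof (Cmod_flux_divergence_le n y t). lra.
- exact dF1.
- exact dF2.
- intros y t. apply Cderiv_at_scal, dF1.
- intros y t. apply Cderiv_at_scal, dF2.
- exact (mode_divergence n).
- intros t. repeat apply Ccontinuous_mult; try apply Ccontinuous_const. apply Ccontinuous_plus; apply Ccontinuous_mult;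
    try apply Ccontinuous_const; try apply (Ccontinuous_conj (fun x => v x t)); apply v_continuous1.
- intros y. apply Ccontinuous_mult; [|apply Ccontinuous_mode]. apply Ccontinuous_plus; apply Ccontinuous_mult;
    try apply Ccontinuous_const; try apply Ccontinuous_conj; auto.
- lra.
- intros y. unfold F. rewrite <- (Rplus_0_l (2 * PI)), v_periodic, periodic_mode. reflexivity.
Qed.

Lemma forcing_coupling T n x : (1 <= T)%nat ->
  Cmod (forcing n x - Csum (Zball T) (fun j => coef e j * Cconj (coef (v x) (j - n)))%C)%C <= Ce * (2 / INR T) * M.
Proof.
intros T1. pose proof (bmeas_v x) as bv.
rewrite (Csum_ext _ _ (fun j => coef e j * coef (fun t => Cconj (v x t)) (n - j))%C).
2:{ intros j _. rewrite coef_conj by Cbmeas. do 3 f_equal. ring. }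
assert (b : Cbmeasurable (fun t => Csum (Zball T) (fun j => coef e j * mode j t)%C)).
{ apply (Cbmeasurable_Csum _ (fun j t => coef e j * mode j t)%C). intros j. Cbmeas. }
unfold forcing. rewrite <- coef_Csum_mode, <- coef_minus by Cbmeas. apply Cmod_coef_le; [Cbmeas|]. intros t.
replace (e t * Cconj (v x t) - Csum (Zball T) (fun j => coef e j * mode j t) * Cconj (v x t))%C
  with ((e t - Csum (Zball T) (fun j => coef e j * mode j t)) * Cconj (v x t))%C by ring.
rewrite Cmod_mult, Cmod_conj. apply Rmult_le_compat; try apply Cmod_ge_0; [|apply v_bounded].
apply (fourier_remainder_le e e'); assumption.
Qed.

Lemma mode_system_of_strip : mode_system (fst lam) (snd lam) nu (coef e) (fun n x => coef (v x) n).
Proof.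
pose proof (Rle_trans _ _ _ (Cmod_ge_0 _) (e_decay 0)) as Ce0. unfold decay in Ce0.
rewrite Rmult_0_l, Rplus_0_r, Rinv_1, Rmult_1_r in Ce0.
exists forcing, (M + Me * M + 2 * Ce * M). assert (0 <= Me * M) by nra. assert (0 <= 2 * Ce * M) by nra.
split; [|split; [|split]].
- intros n x. rewrite <- surjective_pairing. apply mode_ode.
- intros n x. apply Rle_trans with M; [|lra]. apply Cmod_coef_le; [apply bmeas_v|apply v_bounded].
- intros n x. pose proof (bmeas_v x) as bv. apply Rle_trans with (Me * M); [|lra]. apply Cmod_coef_le; [Cbmeas|].
  intros t.
  rewrite Cmod_mult, Cmod_conj. apply Rmult_le_compat; try apply Cmod_ge_0; auto.
- intros T n x T1. apply Rle_trans with (1 := forcing_coupling T n x T1).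
  assert (0 < / INR T) by (apply Rinv_0_lt_compat, lt_0_INR; lia). unfold Rdiv. nra.
Qed.
End StripModes.

Lemma strip_solution_finitely_determined (lam : C) nu e e' e'' : 0 < fst lam -> Rabs nu < 1 ->
  (forall t, Cderiv_at e t (e' t)) -> (forall t, Cderiv_at e' t (e'' t)) -> Ccontinuous e'' -> periodic e ->
  exists N, forall v, strip_solution lam nu e v -> (forall n, (Z.abs n <= N)%Z -> coef (v 0) n = RtoC 0) ->
    forall x t, v x t = RtoC 0.
Proof.
intros a0 nu1 de de' ce'' pe. destruct (coef_decay e e' e'' de de' ce'' pe) as [Ce eCe].
destruct (Ccontinuous_periodic_bounded e (Cderiv_at_Ccontinuous e e' de) pe) as [Me eMe].
destruct (mode_system_finitely_determined (fst lam) (snd lam) nu (coef e) Ce a0 nu1 eCe) as [N hN].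
exists N. intros v [pv [[M vM] [vx [vt h]]]] start x.
apply (eq_0_of_coef_0 (v x) (vt x)); [intros t; apply h|apply pv|]. intros n.
refine (hN (fun n x => coef (v x) n) _ start n x).
apply (mode_system_of_strip lam nu e e' Ce de pe eCe Me M v vx vt eMe vM pv); intros y t; apply h.
Qed.

(** * Finite-dimensional spaces of functions *)

Section FunctionSpaces.
Variable X : Type.
Implicit Types (B : (X -> C) -> Prop) (u v w : X -> C) (L : list (X * (X -> C))).

Definition subspace B : Prop :=
  B (fun _ => RtoC 0) /\ forall k v w, B v -> B w -> B (fun x => v x + k * w x)%C.

Definition linear_on B (l : (X -> C) -> C) : Prop :=
  forall k v w, B v -> B w -> l (fun x => v x + k * w x)%C = (l v + k * l w)%C.

Fixpoint interpolate L v x : C :=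
  match L with nil => RtoC 0 | (p, b) :: L => (v p * b x + interpolate L v x)%C end.

Lemma interpolate_linear L k v w x :
  interpolate L (fun x => v x + k * w x)%C x = (interpolate L v x + k * interpolate L w x)%C.
Proof. induction L as [|[p b] L IH]; simpl; [|rewrite IH]; ring. Qed.

Lemma subspace_scal B k v : subspace B -> B v -> B (fun x => k * v x)%C.
Proof.
intros [B0 BL] Bv. replace (fun x => k * v x)%C with (fun x => RtoC 0 + k * v x)%C by (extensionality x; ring).
apply BL; assumption.
Qed.

Lemma subspace_interpolate B L v : subspace B -> (forall p b, In (p, b) L -> B b) -> B (interpolate L v).
Proof.
intros sB. induction L as [|[p b] L IH]; intros BL; [apply sB|].
replace (interpolate ((p, b) :: L) v) with (fun x => interpolate L v x + v p * b x)%C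
  by (extensionality x; simpl; ring).
apply sB; [apply IH; intros q c h; apply (BL q c); right; exact h|apply (BL p b); left; reflexivity].
Qed.

Lemma separated_by_tail B l ls v0 : subspace B -> (forall l', In l' (l :: ls) -> linear_on B l') ->
  (forall v, B v -> (forall l', In l' (l :: ls) -> l' v = RtoC 0) -> forall x, v x = RtoC 0) ->
  B v0 -> (forall l', In l' ls -> l' v0 = RtoC 0) -> forall p, v0 p <> RtoC 0 ->
  forall w, B w -> w p = RtoC 0 -> (forall l', In l' ls -> l' w = RtoC 0) -> forall x, w x = RtoC 0.
Proof.
intros sB lin sep Bv0 lv0 p vp w Bw wp lw.
assert (lv : l v0 <> RtoC 0).
{ intros z. apply vp, (sep v0 Bv0). intros l' [<-|h]; [exact z|apply lv0, h]. }
set (k := (- (l w / l v0))%C).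
assert (zero : forall x, (w x + k * v0 x)%C = RtoC 0).
{ apply (sep (fun x => w x + k * v0 x)%C); [apply sB; assumption|]. intros l' h. rewrite (lin l' h k w v0 Bw Bv0).
  destruct h as [<-|h]; [unfold k; field; exact lv|]. rewrite lw, lv0 by exact h. ring. }
assert (k0 : k = RtoC 0).
{ pose proof (zero p) as z. rewrite wp, Cplus_0_l in z. destruct (Ceq_dec k (RtoC 0)) as [e|e]; [exact e|].
  exfalso. exact (Cmult_neq_0 _ _ e vp z). }
intros x. specialize (zero x). rewrite k0, Cmult_0_l, Cplus_0_r in zero. exact zero.
Qed.

Lemma exists_interpolation (ls : list ((X -> C) -> C)) : forall B, subspace B -> (forall l, In l ls -> linear_on B l) ->
  (forall v, B v -> (forall l, In l ls -> l v = RtoC 0) -> forall x, v x = RtoC 0) ->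
  exists L, (forall p b, In (p, b) L -> B b) /\ forall v, B v -> forall x, v x = interpolate L v x.
Proof.
induction ls as [|l ls IH]; intros B sB lin sep.
{ exists []. split; [intros p b []|]. intros v Bv. apply sep; [exact Bv|intros l []]. }
destruct (classic (exists v0 p, B v0 /\ (forall l', In l' ls -> l' v0 = RtoC 0) /\ v0 p <> RtoC 0))
  as [[v0 [p [Bv0 [lv0 vp]]]]|none].
2:{ apply IH; [exact sB|intros l' h; apply lin; right; exact h|]. intros v Bv lv x. apply NNPP. intros vx.
    apply none. exists v, x. auto. }
set (Bp w := B w /\ w p = RtoC 0).
destruct (IH Bp) as [L [BL interp]].
- split; [split; [apply sB|reflexivity]|]. intros k v w [Bv zv] [Bw zw]. split; [apply sB; assumption|].
  rewrite zv, zw. ring.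
- intros l' h k v w [Bv _] [Bw _]. apply lin; [right; exact h|assumption|assumption].
- intros w [Bw wp] lw. exact (separated_by_tail B l ls v0 sB lin sep Bv0 lv0 p vp w Bw wp lw).
- assert (BL' : forall q b, In (q, b) L -> B b) by (intros q b h; apply (BL q b h)).
  set (b0 x := (/ v0 p * (v0 x + - RtoC 1 * interpolate L v0 x))%C).
  exists ((p, b0) :: L). split.
  + intros q b [e|h]; [injection e as _ <-|exact (BL' q b h)].
    apply (subspace_scal B _ (fun x => v0 x + - RtoC 1 * interpolate L v0 x)%C sB), sB; [exact Bv0|].
    apply subspace_interpolate; assumption.
  + intros v Bv x. set (k := (- (v p / v0 p))%C).
    assert (e : Bp (fun x => v x + k * v0 x)%C) by (split; [apply sB; assumption|unfold k; field; exact vp]).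
    apply interp with (x := x) in e. rewrite interpolate_linear in e. simpl. unfold b0.
    replace (v x) with (v x + k * v0 x - k * v0 x)%C by ring. rewrite e. unfold k. field. exact vp.
Qed.

Lemma subspace_closed B L (s : nat -> X -> C) u : subspace B -> (forall p b, In (p, b) L -> B b) ->
  (forall v, B v -> forall x, v x = interpolate L v x) -> (forall n, B (s n)) ->
  (forall x, Un_cv (fun n => fst (s n x)) (fst (u x)) /\ Un_cv (fun n => snd (s n x)) (snd (u x))) -> B u.
Proof.
intros sB BL interp Bs cv.
assert (cv_interp : forall x, Un_cv (fun n => fst (interpolate L (s n) x)) (fst (interpolate L u x)) /\
  Un_cv (fun n => snd (interpolate L (s n) x)) (snd (interpolate L u x))).
{ intros x. clear BL interp. induction L as [|[p b] L [IH1 IH2]]; simpl; [split; apply Un_cv_const|].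
  destruct (cv p) as [c1 c2]. split.
  - apply CV_plus; [|exact IH1]. apply CV_minus; apply CV_mult; try assumption; apply Un_cv_const.
  - apply CV_plus; [|exact IH2]. apply CV_plus; apply CV_mult; try assumption; apply Un_cv_const. }
replace u with (interpolate L u); [apply subspace_interpolate; assumption|]. extensionality x.
destruct (cv x) as [c1 c2], (cv_interp x) as [i1 i2]. apply injective_projections.
- apply (UL_sequence _ _ _ i1). revert c1. apply Un_cv_ext. intros n. rewrite <- interp by apply Bs. reflexivity.
- apply (UL_sequence _ _ _ i2). revert c2. apply Un_cv_ext. intros n. rewrite <- interp by apply Bs. reflexivity.
Qed.
End FunctionSpaces.
Arguments subspace {X}. Arguments linear_on {X}. Arguments interpolate {X}.

Fixpoint shift_product (zs : list C) (s : nat -> C) : C :=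
  match zs with nil => s 0%nat | z :: zs => shift_product zs (fun k => s (S k) - z * s k)%C end.

Module Recurrence.
Import all_boot all_order all_algebra complex Rstruct.
Import GRing.Theory Num.Theory.
Local Open Scope ring_scope.

Definition to_complex (z : Coquelicot.Complex.C) : complex R := Complex (fst z) (snd z).

Definition poly_apply (p : {poly complex R}) (s : nat -> complex R) : complex R := \sum_(i < size p) p`_i * s i.

Lemma poly_apply_widen (p : {poly complex R}) s n : (size p <= n)%N -> poly_apply p s = \sum_(i < n) p`_i * s i.
Proof.
move=> le; rewrite /poly_apply (big_ord_widen n (fun i => p`_i * s i) le) big_mkcond /=.
by apply: eq_bigr => i _; case: ltnP => // h; rewrite nth_default ?mul0r.
Qed.

Lemma poly_apply_XsubC (z : complex R) (q : {poly complex R}) s :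
  poly_apply (('X - z%:P) * q) s = poly_apply q (fun i => s i.+1 - z * s i).
Proof.
have size_le : (size (('X - z%:P) * q)%R <= (size q).+1)%N.
  by apply: leq_trans (size_polyMleq _ _) _; rewrite size_XsubC.
rewrite (poly_apply_widen _ _ _ size_le) (poly_apply_widen q _ _ (leqnn _)).
under eq_bigr => i _ do rewrite mulrBl coefB mulrBl.
rewrite big_split /= big_ord_recl coefXM eqxx mul0r add0r.
rewrite big_ord_recr /= coefCM (nth_default 0 (leqnn (size q))) mulr0 mul0r oppr0 addr0 -big_split /=.
by apply: eq_bigr => i _; rewrite coefXM coefCM /= mulrBr mulrCA mulrA.
Qed.

Lemma to_complex_shift_product zs s :
  to_complex (shift_product zs s) = poly_apply (\prod_(z <- zs) ('X - (to_complex z)%:P)) (to_complex \o s).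
Proof.
elim: zs s => [|z zs IH] s; first by rewrite big_nil /poly_apply size_poly1 big_ord1 coef1 mul1r.
by rewrite big_cons poly_apply_XsubC /= IH.
Qed.

Lemma exists_annihilating_poly (d : nat) (s : nat -> nat -> complex R) :
  exists2 p : {poly complex R}, p != 0 & forall j, (j < d)%N -> poly_apply p (s j) = 0.
Proof.
pose A : 'M[complex R]_(d.+1, d) := \matrix_(i, j) s j i.
have ker0 : kermx A != 0 by rewrite -mxrank_eq0 mxrank_ker -lt0n subn_gt0 ltnS rank_leq_col.
pose c := nz_row (kermx A); have cA : c *m A = 0 by apply/sub_kermxP/nz_row_sub.
exists (rVpoly c) => [|j jd].
  by apply: contra ker0 => /eqP z; rewrite -nz_row_eq0 -/c -(rVpolyK c) z linear0.
rewrite (poly_apply_widen _ _ d.+1) ?size_poly //.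
transitivity ((c *m A) 0 (Ordinal jd)); last by rewrite cA mxE.
by rewrite mxE; apply: eq_bigr => i _; rewrite mxE coef_rVpoly_ord.
Qed.

Lemma exists_shift_product_eq0 (d : nat) (s : nat -> nat -> Coquelicot.Complex.C) :
  exists zs, forall j, (j < d)%coq_nat -> shift_product zs (s j) = RtoC (IZR Z0).
Proof.
have [p p0 ps] := exists_annihilating_poly d (fun j => to_complex \o s j).
have [rs prs] := closed_field_poly_normal p.
exists [seq (complex.Re z, complex.Im z) | z <- rs] => j /ltP jd.
have e : to_complex (shift_product [seq (complex.Re z, complex.Im z) | z <- rs] (s j)) = 0.
  rewrite to_complex_shift_product big_map.
  have -> : \prod_(z <- rs) ('X - (to_complex (complex.Re z, complex.Im z))%:P) = (lead_coef p)^-1 *: p.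
    rewrite [X in _ *: X]prs scalerA mulVf ?lead_coef_eq0 // scale1r.
    by apply: eq_bigr => z _; case: z.
  rewrite (poly_apply_widen _ _ (size p)) ?size_scale_leq //.
  transitivity ((lead_coef p)^-1 * poly_apply p (to_complex \o s j)); last by rewrite ps // mulr0.
  by rewrite /poly_apply big_distrr /=; apply: eq_bigr => i _; rewrite coefZ mulrA.
by case: (shift_product _ _) e => x y [-> ->].
Qed.
End Recurrence.

(** * Bounded functions in finite-dimensional flow-invariant spaces *)

Lemma bounded_exponential_eq_0 (f : R -> C) z M : fst z <> 0 -> (forall s, Cderiv_at f s (z * f s)%C) ->
  (forall s, Cmod (f s) <= M) -> forall s, f s = RtoC 0.
Proof.
assert (positive : forall (f : R -> C) z, 0 < fst z -> (forall s, Cderiv_at f s (z * f s)%C) ->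
  (forall s, Cmod (f s) <= M) -> forall s, f s = RtoC 0).
{ clear. intros f z z0 df fM s. apply sqnorm_eq_0, Rle_antisym; [|apply sqnorm_ge_0].
  apply (bounded_above_growth_le_0 (fun s => sqnorm (f s)) (fun s => 2 * fst (Cconj (f s) * (z * f s))%C) (2 * fst z)
    (M * M)).
  - lra.
  - intros r. apply derivable_pt_lim_sqnorm, df.
  - intros r. right. unfold sqnorm. simpl. ring.
  - intros r. rewrite sqnorm_Cmod. pose proof (Cmod_ge_0 (f r)). apply Rmult_le_compat; auto. }
intros z0 df fM s. destruct (Rlt_le_dec 0 (fst z)) as [h|h]; [exact (positive f z h df fM s)|].
rewrite <- (Ropp_involutive s). apply (positive (fun s => f (- s)) (- z)%C); [simpl; lra| |intros; apply fM].
intros r. replace (- z * f (- r)%R)%C with (RtoC (-1) * (z * f (- r)%R))%C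
  by (apply injective_projections; simpl; ring).
apply Cderiv_at_reflect, df.
Qed.

Lemma bounded_constant_derivative_eq_0 f k M : (forall s, derivable_pt_lim f s k) -> (forall s, Rabs (f s) <= M) ->
  k = 0.
Proof.
intros df fM. destruct (Req_dec k 0) as [e|k0]; [exact e|exfalso].
assert (M0 : 0 <= M) by (apply Rle_trans with (1 := Rabs_pos (f 0)), fM).
assert (big : f ((2 * M + 1) / k) - f 0 = 2 * M + 1).
{ assert (c : forall x y, f x - k * x = f y - k * y).
  { apply (derivable_pt_lim_0_const (fun x => f x - k * x)). intros x.
    apply (derivable_pt_lim_eq _ _ (k - k * 1)); [ring|].
    apply derivable_pt_lim_minus; [apply df|]. apply (derivable_pt_lim_scal id), derivable_pt_lim_id. }
  specialize (c ((2 * M + 1) / k) 0). replace (k * ((2 * M + 1) / k)) with (2 * M + 1) in c by (field; exact k0). lra. }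
pose proof (fM ((2 * M + 1) / k)) as far. pose proof (fM 0) as near. apply Rabs_le_between in far, near. lra.
Qed.

Lemma Cderiv_at_untwist (f : R -> C) d z s : fst z = 0 -> Cderiv_at f s (z * f s + d)%C ->
  Cderiv_at (fun s => cis (- snd z * s) * f s)%C s (cis (- snd z * s) * d)%C.
Proof.
intros z0 df. set (m := - snd z).
replace (cis (m * s) * d)%C with (RtoC m * (Ci * cis (m * s)) * f s + cis (m * s) * (z * f s + d))%C.
- apply (Cderiv_at_mult (fun s => cis (m * s))); [|exact df].
  apply (Cderiv_at_comp (fun s => m * s) cis); [|apply Cderiv_at_cis].
  apply (derivable_pt_lim_eq _ _ (m * 1)); [ring|]. apply (derivable_pt_lim_scal id), derivable_pt_lim_id.
- replace z with (RtoC (- m) * Ci)%C by (apply injective_projections; simpl; unfold m; lra). rewrite RtoC_opp. ring.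
Qed.

Lemma bounded_resonance_eq_0 (f g : R -> C) z M : fst z = 0 -> (forall s, Cderiv_at f s (z * f s + g s)%C) ->
  (forall s, Cderiv_at g s (z * g s)%C) -> (forall s, Cmod (f s) <= M) -> forall s, g s = RtoC 0.
Proof.
intros z0 df dg fM. set (q s := (cis (- snd z * s) * g s)%C).
assert (q_const : forall s s', q s = q s').
{ apply Cderiv_at_0_const. intros s. rewrite <- (Cmult_0_r (cis (- snd z * s))). apply Cderiv_at_untwist; [exact z0|].
  rewrite Cplus_0_r. apply dg. }
assert (dh : forall s, Cderiv_at (fun s => cis (- snd z * s) * f s)%C s (q 0)).
{ intros s. rewrite (q_const 0 s). apply Cderiv_at_untwist; [exact z0|apply df]. }
assert (hM : forall s, Cmod (cis (- snd z * s) * f s)%C <= M)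
  by (intros s; rewrite Cmod_mult, Cmod_cis, Rmult_1_l; apply fM).
assert (q0 : q 0 = RtoC 0).
{ apply injective_projections.
  - apply (bounded_constant_derivative_eq_0 (fun s => fst (cis (- snd z * s) * f s)%C) _ M); [intros s; apply dh|].
    intros s. apply Rle_trans with (1 := Rabs_fst_le_Cmod _), hM.
  - apply (bounded_constant_derivative_eq_0 (fun s => snd (cis (- snd z * s) * f s)%C) _ M); [intros s; apply dh|].
    intros s. apply Rle_trans with (1 := Rabs_snd_le_Cmod _), hM. }
intros s. apply Cmod_eq_0. rewrite <- (Rmult_1_l (Cmod (g s))), <- (Cmod_cis (- snd z * s)), <- Cmod_mult.
change (Cmod (q s) = 0). rewrite (q_const s 0), q0. apply Cmod_0.
Qed.

Section FlowInvariantSpace.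
Variables (X : Type) (flow : R -> X -> X) (B : (X -> C) -> Prop) (L : list (X * (X -> C))).
Hypothesis flow_0 : forall x, flow 0 x = x.
Hypothesis flow_plus : forall s r x, flow (s + r) x = flow s (flow r x).
Hypothesis subspace_B : subspace B.
Hypothesis B_flow : forall s v, B v -> B (fun x => v (flow s x)).
Hypothesis B_bounded : forall v, B v -> exists M, forall x, Cmod (v x) <= M.
Hypothesis B_differentiable : forall v, B v -> exists d : X -> C, forall x, Cderiv_at (fun s => v (flow s x)) 0 (d x).
Hypothesis L_in_B : forall p b, In (p, b) L -> B b.
Hypothesis L_interpolates : forall v, B v -> forall x, v x = interpolate L v x.

Definition generator (v : X -> C) : X -> C :=
  epsilon (inhabits v) (fun d => forall x, Cderiv_at (fun s => v (flow s x)) 0 (d x)).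

Lemma generator_spec0 v : B v -> forall x, Cderiv_at (fun s => v (flow s x)) 0 (generator v x).
Proof. intros Bv. exact (epsilon_spec (inhabits v) _ (B_differentiable v Bv)). Qed.

Lemma generator_unique v d : B v -> (forall x, Cderiv_at (fun s => v (flow s x)) 0 (d x)) -> generator v = d.
Proof. intros Bv dv. extensionality x. exact (Cderiv_at_unique _ _ _ _ (generator_spec0 v Bv x) (dv x)). Qed.

Lemma generator_spec v : B v -> forall x r, Cderiv_at (fun s => v (flow s x)) r (generator v (flow r x)).
Proof.
intros Bv x r. apply (Cderiv_at_ext (fun s => v (flow (s - r) (flow r x)))).
- intros s. rewrite <- flow_plus. do 2 f_equal. ring.
- apply (Cderiv_at_shift (fun s => v (flow s (flow r x))) (- r)). rewrite Rplus_opp_r. apply generator_spec0, Bv.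
Qed.

Lemma generator_linear k v w : B v -> B w ->
  generator (fun x => v x + k * w x)%C = (fun x => generator v x + k * generator w x)%C.
Proof.
intros Bv Bw. apply generator_unique; [apply subspace_B; assumption|]. intros x.
apply Cderiv_at_plus; [|apply Cderiv_at_scal]; apply generator_spec0; assumption.
Qed.

Lemma B_generator v : B v -> B (generator v).
Proof.
intros Bv. set (q n := (fun x => RtoC (/ RinvN n) * (v (flow (RinvN n) x) + - RtoC 1 * v x))%C).
apply (subspace_closed X B L q); try assumption.
- intros n. apply (subspace_scal X B _ (fun x => v (flow (RinvN n) x) + - RtoC 1 * v x)%C subspace_B).
  apply subspace_B; [apply B_flow|]; exact Bv.
- intros x. destruct (generator_spec0 v Bv x) as [d1 d2].
  assert (h0 : forall n, (RinvN n : R) <> 0) by (intros n; apply Rgt_not_eq, cond_pos). split.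
  + apply (Un_cv_ext (fun n => (fst (v (flow (0 + RinvN n) x)) - fst (v (flow 0 x))) / RinvN n)).
    * intros n. rewrite Rplus_0_l, flow_0. unfold q. simpl. unfold Rdiv. ring.
    * apply (derivable_pt_lim_seq (fun s => fst (v (flow s x))) 0); [exact d1|exact h0|apply RinvN_cv].
  + apply (Un_cv_ext (fun n => (snd (v (flow (0 + RinvN n) x)) - snd (v (flow 0 x))) / RinvN n)).
    * intros n. rewrite Rplus_0_l, flow_0. unfold q. simpl. unfold Rdiv. ring.
    * apply (derivable_pt_lim_seq (fun s => snd (v (flow s x))) 0); [exact d2|exact h0|apply RinvN_cv].
Qed.

Definition eigenfunction (z : C) (v : X -> C) : Prop := B v /\ forall x, generator v x = (z * v x)%C.

Lemma eigenfunction_linear z k v w : eigenfunction z v -> eigenfunction z w ->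
  eigenfunction z (fun x => v x + k * w x)%C.
Proof.
intros [Bv ev] [Bw ew]. split; [apply subspace_B; assumption|]. intros x.
rewrite generator_linear, ev, ew by assumption. ring.
Qed.

Lemma eigenfunction_0 z : eigenfunction z (fun _ => RtoC 0).
Proof.
split; [apply subspace_B|]. intros x. rewrite Cmult_0_r.
rewrite (generator_unique _ (fun _ => RtoC 0)); [reflexivity|apply subspace_B|]. intros y. apply Cderiv_at_const.
Qed.

Lemma eigenfunction_flow tau v x s : eigenfunction (0, tau) v -> v (flow s x) = (cis (tau * s) * v x)%C.
Proof.
intros [Bv ev].
assert (const : forall r, Cderiv_at (fun s => cis (- tau * s) * v (flow s x))%C r (RtoC 0)).
{ intros r. rewrite <- (Cmult_0_r (cis (- tau * r))). apply (Cderiv_at_untwist _ _ (0, tau)); [reflexivity|].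
  rewrite Cplus_0_r, <- ev. apply generator_spec, Bv. }
pose proof (Cderiv_at_0_const _ const s 0) as e. simpl in e.
rewrite Rmult_0_r, cis_0, flow_0, Cmult_1_l in e. rewrite <- e, Cmult_assoc, <- cis_plus.
replace (tau * s + - tau * s) with 0 by ring. rewrite cis_0. symmetry. apply Cmult_1_l.
Qed.

Definition mode_sum (l : list (R * (X -> C))) x : C := fold_right (fun m acc => snd m x + acc)%C (RtoC 0) l.

Definition sum_of_eigenfunctions (v : X -> C) : Prop := exists l,
  (forall tau w, In (tau, w) l -> eigenfunction (0, tau) w) /\ forall x, v x = mode_sum l x.

(* Boundedness excludes exponents off the imaginary axis and polynomial growth. *)
Lemma sum_of_eigenfunctions_resonant v w z : B v -> eigenfunction z w ->
  (forall x, generator v x = (z * v x + w x)%C) -> sum_of_eigenfunctions v.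
Proof.
intros Bv [Bw ew] ev. destruct (B_bounded v Bv) as [M vM]. destruct (B_bounded w Bw) as [M' wM'].
assert (dv : forall x s, Cderiv_at (fun s => v (flow s x)) s (z * v (flow s x) + w (flow s x))%C)
  by (intros x s; rewrite <- ev; apply generator_spec, Bv).
assert (dw : forall x s, Cderiv_at (fun s => w (flow s x)) s (z * w (flow s x))%C)
  by (intros x s; rewrite <- ew; apply generator_spec, Bw).
destruct (Req_dec (fst z) 0) as [z0|z0].
- assert (w0 : forall x, w x = RtoC 0).
  { intros x. rewrite <- (flow_0 x).
    apply (bounded_resonance_eq_0 (fun s => v (flow s x)) (fun s => w (flow s x)) z M z0 (dv x) (dw x)).
    intros; apply vM. }
  exists [(snd z, v)]. split.
  + intros tau v' [e|[]]. injection e as <- <-. split; [exact Bv|]. intros x.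
    rewrite ev, w0, (surjective_pairing z), z0. apply Cplus_0_r.
  + intros x. simpl. ring.
- assert (w0 : forall x, w x = RtoC 0).
  { intros x. rewrite <- (flow_0 x). apply (bounded_exponential_eq_0 (fun s => w (flow s x)) z M' z0 (dw x)).
    intros; apply wM'. }
  exists []. split; [intros tau v' []|]. intros x. rewrite <- (flow_0 x). simpl.
  apply (bounded_exponential_eq_0 (fun s => v (flow s x)) z M z0); [|intros; apply vM].
  intros s. rewrite <- (Cplus_0_r (z * v (flow s x))), <- (w0 (flow s x)). apply dv.
Qed.

Lemma sum_of_eigenfunctions_resolve z l : (forall tau w, In (tau, w) l -> eigenfunction (0, tau) w) ->
  forall v w, B v -> eigenfunction z w -> (forall x, generator v x = (z * v x + w x + mode_sum l x)%C) ->
  sum_of_eigenfunctions v.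
Proof.
induction l as [|[tau w1] l IH]; intros hl v w Bv ew ev.
{ apply (sum_of_eigenfunctions_resonant v w z Bv ew). intros x. rewrite ev. apply Cplus_0_r. }
assert (ew1 : eigenfunction (0, tau) w1) by (apply hl; left; reflexivity).
specialize (IH (fun t w' h => hl t w' (or_intror h))).
destruct (Ceq_dec z (0, tau)) as [e|ne].
{ subst z. apply (IH v (fun x => w x + RtoC 1 * w1 x)%C Bv).
  - apply eigenfunction_linear; assumption.
  - intros x. rewrite ev. simpl. ring. }
set (k := (/ ((0, tau) - z))%C).
assert (k_inv : (k * ((0, tau) - z))%C = RtoC 1).
{ apply Cinv_l. intros h. apply ne. replace z with ((0, tau) - ((0, tau) - z))%C by ring. rewrite h. ring. }
pose proof ew1 as [Bw1 e1].
destruct (IH (fun x => v x + - k * w1 x)%C w) as [l' [hl' el']].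
- apply subspace_B; assumption.
- exact ew.
- intros x. rewrite generator_linear, ev, e1 by assumption. simpl.
  replace (z * v x + w x + (w1 x + mode_sum l x) + - k * ((0, tau) * w1 x))%C
    with (z * (v x + - k * w1 x) + w x + mode_sum l x + (RtoC 1 - k * ((0, tau) - z)) * w1 x)%C by ring.
  rewrite k_inv. ring.
- exists ((tau, fun x => RtoC 0 + k * w1 x)%C :: l'). split.
  + intros t w' [e|h]; [|apply hl', h]. injection e as <- <-.
    apply eigenfunction_linear; [apply eigenfunction_0|exact ew1].
  + intros x. simpl. rewrite <- el'. ring.
Qed.

Fixpoint generator_product (zs : list C) (v : X -> C) : X -> C :=
  match zs with nil => v | z :: zs => generator_product zs (fun x => generator v x + - z * v x)%C end.

Lemma B_factor z v : B v -> B (fun x => generator v x + - z * v x)%C.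
Proof. intros Bv. apply subspace_B; [apply B_generator|]; exact Bv. Qed.

Lemma sum_of_eigenfunctions_of_annihilated zs : forall v, B v -> (forall x, generator_product zs v x = RtoC 0) ->
  sum_of_eigenfunctions v.
Proof.
induction zs as [|z zs IH]; intros v Bv zero.
- exists []. split; [intros tau w []|exact zero].
- destruct (IH _ (B_factor z v Bv) zero) as [l [hl el]].
  apply (sum_of_eigenfunctions_resolve z l hl v (fun _ => RtoC 0) Bv (eigenfunction_0 z)). intros x. rewrite <- el.
  ring.
Qed.

Fixpoint jet (v : X -> C) (k : nat) : X -> C :=
  match k with O => v | S k => generator (jet v k) end.

Lemma B_jet v k : B v -> B (jet v k).
Proof. intros Bv. induction k as [|k IH]; [exact Bv|apply B_generator, IH]. Qed.

Lemma jet_factor z v k : B v ->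
  jet (fun x => generator v x + - z * v x)%C k = (fun x => jet v (S k) x + - z * jet v k x)%C.
Proof.
intros Bv. induction k as [|k IH]; [reflexivity|]. simpl jet at 1. rewrite IH.
apply generator_linear; [apply B_generator|]; apply B_jet, Bv.
Qed.

Lemma generator_product_jet zs x : forall v, B v -> generator_product zs v x = shift_product zs (fun k => jet v k x).
Proof.
induction zs as [|z zs IH]; intros v Bv; [reflexivity|]. simpl. rewrite IH by (apply B_factor, Bv). f_equal.
extensionality k. rewrite jet_factor by exact Bv. simpl. ring.
Qed.

Lemma B_generator_product zs : forall v, B v -> B (generator_product zs v).
Proof. induction zs as [|z zs IH]; intros v Bv; [exact Bv|apply IH, B_factor, Bv]. Qed.

Lemma interpolate_eq_0 l (v : X -> C) x : (forall p b, In (p, b) l -> v p = RtoC 0) -> interpolate l v x = RtoC 0.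
Proof.
induction l as [|[p b] l IH]; intros vl; [reflexivity|]. simpl. rewrite (vl p b (or_introl eq_refl)), IH; [ring|].
intros q c h. apply (vl q c). right. exact h.
Qed.

Theorem bounded_sum_of_eigenfunctions v : B v -> sum_of_eigenfunctions v.
Proof.
intros Bv. destruct (classic (exists x : X, True)) as [[x0 _]|empty].
2:{ exists []. split; [intros tau w []|]. intros x. exfalso. apply empty. exists x. exact I. }
destruct (Recurrence.exists_shift_product_eq0 (length L) (fun j k => jet v k (fst (nth j L (x0, v))))) as [zs hzs].
apply (sum_of_eigenfunctions_of_annihilated zs v Bv). intros x.
rewrite L_interpolates by (apply B_generator_product, Bv). apply interpolate_eq_0. intros p b h.
destruct (In_nth L (p, b) (x0, v) h) as [j [lj ej]].
rewrite generator_product_jet by exact Bv. specialize (hzs j lj). rewrite ej in hzs. exact hzs.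
Qed.
End FlowInvariantSpace.
Arguments mode_sum {X}.

(** * The complexified system *)

Definition strip_shift (s : R) (y : R * R * bool) : R * R * bool := (fst (fst y) + s, snd (fst y), snd y).

(* The equation for [v] and its conjugate, as a complex-linear system for the pair of [w (_, _, true)]
   and [w (_, _, false)]. *)
Definition pair_solution (lam : C) (nu : R) (e : R -> C) (w : R * R * bool -> C) : Prop :=
  (forall x t i, w (x, t + 2 * PI, i) = w (x, t, i)) /\ (exists M, forall y, Cmod (w y) <= M) /\
  exists wx wt : R * R * bool -> C, forall x t,
    (forall i, Cderiv_at (fun x => w (x, t, i)) x (wx (x, t, i)) /\
               Cderiv_at (fun t => w (x, t, i)) t (wt (x, t, i))) /\
    wx (x, t, true) = (- (Ci * lam * wt (x, t, true)) + lam * RtoC nu * w (x, t, true) + e t * w (x, t, false))%C /\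
    wx (x, t, false) = (Ci * Cconj lam * wt (x, t, false) + Cconj lam * RtoC nu * w (x, t, false)
                        + Cconj (e t) * w (x, t, true))%C.

Definition conj_pair (v : R -> R -> C) (y : R * R * bool) : C :=
  let z := v (fst (fst y)) (snd (fst y)) in if snd y then z else Cconj z.

Definition real_sum (w : R * R * bool -> C) (x t : R) : C := (w (x, t, true) + Cconj (w (x, t, false)))%C.

Section PairSolutions.
Variables (lam : C) (nu : R) (e : R -> C).
Local Notation B := (pair_solution lam nu e).

Lemma pair_solution_subspace : subspace B.
Proof.
split.
- split; [reflexivity|split].
  + exists 0. intros y. rewrite Cmod_0. lra.
  + exists (fun _ => RtoC 0), (fun _ => RtoC 0). intros x t.
    split; [intros i; split; apply Cderiv_at_const|split; ring].
- intros k v w [pv [[M vM] [vx [vt hv]]]] [pw [[M' wM'] [wx [wt hw]]]]. split; [|split].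
  + intros x t i. rewrite pv, pw. reflexivity.
  + exists (M + Cmod k * M'). intros y. apply Rle_trans with (1 := Cmod_triangle _ _). rewrite Cmod_mult.
    apply Rplus_le_compat; [apply vM|]. apply Rmult_le_compat_l; [apply Cmod_ge_0|apply wM'].
  + exists (fun y => vx y + k * wx y)%C, (fun y => vt y + k * wt y)%C. intros x t.
    destruct (hv x t) as [dv [ev1 ev2]]. destruct (hw x t) as [dw [ew1 ew2]]. split; [|split].
    * intros i. split; (apply Cderiv_at_plus; [|apply Cderiv_at_scal]); apply dv || apply dw.
    * rewrite ev1, ew1. ring.
    * rewrite ev2, ew2. ring.
Qed.

Lemma pair_solution_shift s w : B w -> B (fun y => w (strip_shift s y)).
Proof.
intros [pw [[M wM] [wx [wt h]]]]. split; [|split].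
- intros x t i. apply pw.
- exists M. intros y. apply wM.
- exists (fun y => wx (strip_shift s y)), (fun y => wt (strip_shift s y)). intros x t.
  destruct (h (x + s) t) as [d eqs]. split; [|exact eqs]. intros i. destruct (d i) as [dx dt].
  split; [exact (Cderiv_at_shift (fun x => w (x, t, i)) s x _ dx)|exact dt].
Qed.

Lemma pair_solution_differentiable w : B w -> exists d, forall y, Cderiv_at (fun s => w (strip_shift s y)) 0 (d y).
Proof.
intros [_ [_ [wx [wt h]]]]. exists wx. intros [[x t] i]. unfold strip_shift. simpl.
apply (Cderiv_at_ext (fun s => w (s + x, t, i))); [intros s; rewrite Rplus_comm; reflexivity|].
apply (Cderiv_at_shift (fun x => w (x, t, i))). rewrite Rplus_0_l. apply h.
Qed.

Lemma pair_solution_conj_pair v : strip_solution lam nu e v -> B (conj_pair v).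
Proof.
intros [pv [[M vM] [vx [vt h]]]]. split; [|split].
- intros x t i. unfold conj_pair. simpl. rewrite pv. reflexivity.
- exists M. intros [[x t] i]. unfold conj_pair. simpl. destruct i; [|rewrite Cmod_conj]; apply vM.
- exists (conj_pair vx), (conj_pair vt). intros x t. destruct (h x t) as [dx [dt eq]]. split; [|split].
  + intros i. unfold conj_pair. simpl.
    destruct i; split; try apply (Cderiv_at_conj (fun x => v x t)); try apply (Cderiv_at_conj (v x)); assumption.
  + exact eq.
  + unfold conj_pair. simpl. rewrite eq. apply injective_projections; simpl; ring.
Qed.

Lemma strip_solution_real_sum w : B w -> strip_solution lam nu e (real_sum w).
Proof.
intros [pw [[M wM] [wx [wt h]]]]. split; [|split].
- intros x t. unfold real_sum. rewrite !pw. reflexivity.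
- exists (M + M). intros x t. apply Rle_trans with (1 := Cmod_triangle _ _). rewrite Cmod_conj.
  apply Rplus_le_compat; apply wM.
- exists (real_sum wx), (real_sum wt). intros x t. destruct (h x t) as [d [eq1 eq2]]. split; [|split].
  + apply Cderiv_at_plus; [|apply (Cderiv_at_conj (fun x => w (x, t, false)))]; apply d.
  + apply Cderiv_at_plus; [|apply (Cderiv_at_conj (fun t => w (x, t, false)))]; apply d.
  + unfold real_sum. rewrite eq1, eq2. apply injective_projections; simpl; ring.
Qed.

Lemma eq_0_of_real_sums w : (forall x t, real_sum w x t = RtoC 0) ->
  (forall x t, real_sum (fun y => Ci * w y)%C x t = RtoC 0) ->
  forall y, w y = RtoC 0.
Proof.
intros re im [[x t] i]. specialize (re x t). specialize (im x t). unfold real_sum in *.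
destruct (w (x, t, true)) as [p1 p2] eqn:ep. destruct (w (x, t, false)) as [q1 q2] eqn:eq.
injection re as r1 r2. injection im as i1 i2.
destruct i; [rewrite ep|rewrite eq]; apply injective_projections; simpl; lra.
Qed.

Definition initial_coef (w : R * R * bool -> C) (i : bool) (n : Z) : C := coef (fun t => w (0, t, i)) n.

Lemma Cbmeasurable_pair_solution w i : B w -> Cbmeasurable (fun t => w (0, t, i)).
Proof.
intros [_ [[M wM] [wx [wt h]]]]. apply (Cbmeasurable_continuous _ M); [|intros t; apply wM].
apply (Cderiv_at_Ccontinuous _ (fun t => wt (0, t, i))). intros t. apply h.
Qed.

Lemma initial_coef_linear i n : linear_on B (fun w => initial_coef w i n).
Proof.
intros k v w Bv Bw. pose proof (Cbmeasurable_pair_solution v i Bv). pose proof (Cbmeasurable_pair_solution w i Bw).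
unfold initial_coef. rewrite <- coef_scal by assumption. apply coef_plus; Cbmeas.
Qed.

Lemma coef_real_sum_eq_0 w n : B w -> initial_coef w true n = RtoC 0 -> initial_coef w false (- n) = RtoC 0 ->
  coef (real_sum w 0) n = RtoC 0.
Proof.
intros Bw c1 c2. unfold initial_coef in *.
pose proof (Cbmeasurable_pair_solution w true Bw). pose proof (Cbmeasurable_pair_solution w false Bw).
unfold real_sum. rewrite coef_plus, coef_conj, c1, c2 by Cbmeas. apply injective_projections; simpl; ring.
Qed.

Lemma pair_solutions_interpolated e' e'' : 0 < fst lam -> Rabs nu < 1 ->
  (forall t, Cderiv_at e t (e' t)) -> (forall t, Cderiv_at e' t (e'' t)) -> Ccontinuous e'' -> periodic e ->
  exists L, (forall p b, In (p, b) L -> B b) /\ forall w, B w -> forall y, w y = interpolate L w y.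
Proof.
intros a0 nu1 de de' ce'' pe.
destruct (strip_solution_finitely_determined lam nu e e' e'' a0 nu1 de de' ce'' pe) as [N hN].
set (ls := flat_map (fun n => [fun w => initial_coef w true n; fun w => initial_coef w false n]) (Zball (Z.to_nat N))).
apply (exists_interpolation _ ls B pair_solution_subspace).
- intros l h. apply in_flat_map in h. destruct h as [n [_ [<-|[<-|[]]]]]; apply initial_coef_linear.
- intros w Bw zero.
  assert (coefs : forall n i, (Z.abs n <= N)%Z -> initial_coef w i n = RtoC 0).
  { intros n i nN. apply (zero (fun w => initial_coef w i n)), in_flat_map. exists n.
    split; [apply In_Zball; lia|]. destruct i; [left|right; left]; reflexivity. }
  assert (Biw : B (fun y => Ci * w y)%C) by (apply subspace_scal; [apply pair_solution_subspace|exact Bw]).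
  assert (scaled : forall i n, initial_coef (fun y => Ci * w y)%C i n = (Ci * initial_coef w i n)%C).
  { intros i n. unfold initial_coef. apply coef_scal, Cbmeasurable_pair_solution, Bw. }
  apply eq_0_of_real_sums; (apply hN; [apply strip_solution_real_sum; assumption|]); intros n nN;
    apply coef_real_sum_eq_0; rewrite ?scaled, ?coefs by lia; try assumption; try reflexivity; apply Cmult_0_r.
Qed.

End PairSolutions.

(** * Solutions on the half-cylinder *)

Section Cylinder.
Variables (a b nu : R) (c : R -> C).
Let e (t : R) : C := (Ci * c t)%C.

Definition on_cylinder (v : R -> R -> C) (r t : R) : C := v (ln r) t.

Lemma is_solution_on_cylinder v : strip_solution (a, b) nu e v -> is_solution a b nu c (on_cylinder v).
Proof.
intros [pv [_ [vx [vt h]]]]. split; [intros r t _; apply pv|].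
exists (fun r t => RtoC (/ r) * vx (ln r) t)%C, (fun r t => vt (ln r) t). intros r t r0.
destruct (h (ln r) t) as [dx [dt eq]]. split; [|split].
- apply (Cderiv_at_comp ln (fun x => v x t)); [apply derivable_pt_lim_ln, r0|exact dx].
- exact dt.
- rewrite eq. unfold on_cylinder, e, Cadd, Cmul, Defs.Cconj, Defs.Ci, Defs.RtoC, C0.
  apply injective_projections; simpl; field; lra.
Qed.

Lemma strip_solution_of_is_solution u : is_solution a b nu c u -> bounded_on_half_cyl u ->
  strip_solution (a, b) nu e (fun x t => u (exp x) t).
Proof.
intros [pu [ur [ut h]]] [M uM]. split; [|split].
- intros x t. apply pu, exp_pos.
- exists M. intros x t. specialize (uM (exp x) t (exp_pos x)). unfold Cnorm in uM. unfold Cmod. simpl.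
  rewrite !Rmult_1_r. exact uM.
- exists (fun x t => RtoC (exp x) * ur (exp x) t)%C, (fun x t => ut (exp x) t). intros x t.
  destruct (h (exp x) t (exp_pos x)) as [dr [dt eq]]. split; [|split].
  + apply (Cderiv_at_comp exp (fun r => u r t)); [apply derivable_pt_lim_exp|exact dr].
  + exact dt.
  + injection eq as eq1 eq2. unfold e. apply injective_projections; simpl in *; lra.
Qed.

Definition shift_mode (tau : R) (w : R * R * bool -> C) : Prop :=
  pair_solution (a, b) nu e w /\ forall x t i, w (x, t, i) = (cis (tau * x) * w (0%R, t, i))%C.

Lemma basic_solution_of_shift_mode tau w : shift_mode tau w -> (exists x t, real_sum w x t <> RtoC 0) ->
  basic_solution a b nu c (on_cylinder (real_sum w)) (0, tau).
Proof.
intros [Bw ew] [x [t nz]]. split; [apply is_solution_on_cylinder, strip_solution_real_sum, Bw|split].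
- exists (exp x), t. split; [apply exp_pos|]. unfold on_cylinder. rewrite ln_exp. exact nz.
- exists (fun t => w (0, t, true)), (fun t => w (0, t, false)). split; [|split].
  + intros s. apply Bw.
  + intros s. apply Bw.
  + intros r s r0. unfold on_cylinder, real_sum. rewrite (ew (ln r) s true), (ew (ln r) s false).
    replace (Defs.Cpow r (0, tau)) with (cis (tau * ln r)); [reflexivity|].
    unfold Defs.Cpow, cis. simpl. rewrite Rmult_0_l, exp_0, !Rmult_1_l. reflexivity.
Qed.

Lemma lin_comb_of_shift_modes k l : (forall tau w, In (tau, w) l -> shift_mode tau w) ->
  exists l' : list ((R -> R -> CC) * CC * R),
    (forall m, In m l' -> basic_solution a b nu c (fst (fst m)) (snd (fst m)) /\ Cre (snd (fst m)) = 0) /\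
    forall r t, lin_comb l' r t = (RtoC k * real_sum (mode_sum l) (ln r) t)%C.
Proof.
induction l as [|[tau w] l IH]; intros hl.
{ exists []. split; [intros m []|]. intros r t. apply injective_projections; simpl; ring. }
destruct (IH (fun t v h => hl t v (or_intror h))) as [l' [hl' el']].
destruct (classic (exists x t, real_sum w x t <> RtoC 0)) as [nz|z].
- exists ((on_cylinder (real_sum w), (0, tau), k) :: l'). split.
  + intros m [<-|h]; [|apply hl', h]. split; [|reflexivity].
    apply basic_solution_of_shift_mode; [apply hl; left; reflexivity|exact nz].
  + intros r t. change (RtoC k * real_sum w (ln r) t + lin_comb l' r t
      = RtoC k * real_sum (mode_sum ((tau, w) :: l)) (ln r) t)%C.
    rewrite el'. apply injective_projections; simpl; ring.
- exists l'. split; [exact hl'|]. intros r t. rewrite el'. f_equal.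
  assert (w0 : real_sum w (ln r) t = RtoC 0) by (apply NNPP; intros h; apply z; eauto).
  transitivity (real_sum w (ln r) t + real_sum (mode_sum l) (ln r) t)%C; [rewrite w0; ring|].
  apply injective_projections; simpl; ring.
Qed.

Lemma bounded_solution_lin_comb c' c'' u : 0 < a -> Rabs nu < 1 -> periodic c ->
  (forall t, Cderiv_at c t (c' t)) -> (forall t, Cderiv_at c' t (c'' t)) -> Ccontinuous c'' ->
  is_solution a b nu c u -> bounded_on_half_cyl u ->
  exists l : list ((R -> R -> CC) * CC * R),
    (forall m, In m l -> basic_solution a b nu c (fst (fst m)) (snd (fst m)) /\ Cre (snd (fst m)) = 0) /\
    forall r t, 0 < r -> u r t = lin_comb l r t.
Proof.
intros a0 nu1 pc dc dc' cc'' sol bounded. set (v x t := u (exp x) t).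
destruct (pair_solutions_interpolated (a, b) nu e (fun t => Ci * c' t)%C (fun t => Ci * c'' t)%C) as [L [LB interp]];
  try assumption.
- intros t. apply Cderiv_at_scal, dc.
- intros t. apply Cderiv_at_scal, dc'.
- apply (Ccontinuous_mult (fun _ => Ci)); [apply Ccontinuous_const|exact cc''].
- intros t. unfold e. rewrite pc. reflexivity.
- assert (shift0 : forall y, strip_shift 0 y = y).
  { intros [[x t] i]. unfold strip_shift. simpl. rewrite Rplus_0_r. reflexivity. }
  assert (shift_plus : forall s r y, strip_shift (s + r) y = strip_shift s (strip_shift r y)).
  { intros s r [[x t] i]. unfold strip_shift. simpl. do 2 f_equal. ring. }
  destruct (bounded_sum_of_eigenfunctions _ strip_shift (pair_solution (a, b) nu e) L shift0 shift_plus
    (pair_solution_subspace _ _ _) (pair_solution_shift _ _ _) (fun w Bw => proj1 (proj2 Bw))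
    (pair_solution_differentiable _ _ _) LB interp (conj_pair v)) as [l [hl el]].
  { apply pair_solution_conj_pair, strip_solution_of_is_solution; assumption. }
  destruct (lin_comb_of_shift_modes (/ 2) l) as [l' [hl' el']].
  { intros tau w h. pose proof (hl tau w h) as eig. split; [apply eig|]. intros x t i.
    rewrite <- (eigenfunction_flow _ strip_shift (pair_solution (a, b) nu e) shift0 shift_plus
      (pair_solution_differentiable _ _ _) tau w _ x eig).
    unfold strip_shift. simpl. rewrite Rplus_0_l. reflexivity. }
  exists l'. split; [exact hl'|]. intros r t r0. rewrite el'. unfold real_sum. rewrite <- !el.
  unfold conj_pair, v. simpl. rewrite exp_ln by exact r0. apply injective_projections; simpl; field.
Qed.
End Cylinder.

Lemma Ck_Ccontinuous k f : Ck k f -> Ccontinuous f.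
Proof. destruct k as [|k]; [tauto|]. intros [f' [df _]]. exact (Cderiv_at_Ccontinuous f f' df). Qed.

Theorem theorem6p8 (a b nu : R) (k : nat) (c : R -> CC)
  (ha : 0 < a) (hb : b <> 0) (hnu0 : 0 <= nu) (hnu1 : nu < 1)
  (hk : (2 <= k)%nat) (hcper : periodic c) (hcreg : Ck k c)
  (u : R -> R -> CC)
  (hu : is_solution a b nu c u) (hbd : bounded_on_half_cyl u) :
  (exists l : list ((R -> R -> CC) * CC * R),
     (forall x, In x l ->
        basic_solution a b nu c (fst (fst x)) (snd (fst x)) /\
        Cre (snd (fst x)) = 0) /\
     (forall r t, 0 < r -> u r t = lin_comb l r t)) /\
  ((~ exists sigma, spectral_value a b nu c sigma /\ Cre sigma = 0) ->
     forall r t, 0 < r -> u r t = C0).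
Proof.
destruct k as [|[|k]]; [lia|lia|]. destruct hcreg as [c' [dc [c'' [dc' hc'']]]].
assert (nu1 : Rabs nu < 1) by (apply Rabs_def1; lra).
pose proof (bounded_solution_lin_comb a b nu c c' c'' u ha nu1 hcper dc dc' (Ck_Ccontinuous k c'' hc'') hu hbd)
  as decomposition.
split; [exact decomposition|]. intros no_imaginary_exponent r t r0.
destruct decomposition as [[|m l] [basic combination]].
- apply combination, r0.
- exfalso. apply no_imaginary_exponent. destruct (basic m (or_introl eq_refl)) as [m_basic m_imaginary].
  exists (snd (fst m)). split; [exists (fst (fst m)); exact m_basic|exact m_imaginary].
Qed.
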